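(* (i) For $0\leqslant\zeta<\xi\leqslant\omega_1$, there do not exist basic sequences $(f_i)_{i=1}^\infty$ and $(g_i)_{i=1}^\infty$ in Banach spaces such that $(f_i)$ is $\xi$-weakly null, $(g_i)$ is not $\zeta$-weakly null, and the formal identity $U:[f_i:i\in\mathbb{N}]\to[g_i:i\in\mathbb{N}]$ (with $Uf_i=g_i$) is well-defined, bounded, and subsequentially universal for $\complement\mathfrak{G}_{\xi,\zeta}$. (ii) For any $0\leqslant\zeta<\xi<\omega_1$, there exists a formal identity operator $I$ between mixed Schreier spaces with $I\notin\mathfrak{G}_{\xi,\zeta}$ such that for each $\zeta<\beta<\xi$, $I$ is subsequentially universal for $\complement\mathfrak{G}_{\beta,\zeta}$.
   Context: Schreier families $\mathcal{S}_\xi$ ($\xi<\omega_1$): $\mathcal{S}_0=\{\varnothing\}\cup\{\{n\}:n\in\mathbb{N}\}$; $\mathcal{S}=\{\varnothing\}\cup\{E\subset\mathbb{N}\text{ finite}:|E|\leqslant\min E\}$; $\mathcal{G}[\mathcal{F}]=\{\varnothing\}\cup\{\bigcup_{i=1}^nE_i:\varnothing\neq E_i\in\mathcal{F},\max E_i<\min E_{i+1},(\min E_i)_{i=1}^n\in\mathcal{G}\}$; $\mathcal{S}_{\xi+1}=\mathcal{S}[\mathcal{S}_\xi]$; for limit $\xi$, with a fixed $\xi_n\uparrow\xi$ satisfying $\mathcal{S}_{\xi_n+1}\subset\mathcal{S}_{\xi_{n+1}}$, $\mathcal{S}_\xi=\{\varnothing\}\cup\{E\neq\varnothing:E\in\mathcal{S}_{\xi_{\min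 E}+1}\}$. For $\xi<\omega_1$, a bounded sequence $(x_n)$ is an $\ell_1^\xi+$-spreading model if $\inf\{\|x\|:F\in\mathcal{S}_\xi,x\in\mathrm{co}(x_n:n\in F)\}>0$; $(x_n)$ is $\xi$-weakly null if no subsequence is an $\ell_1^\xi+$-spreading model; $\omega_1$-weakly null means weakly null. $\mathfrak{G}_{\xi,\zeta}$ is the class of bounded operators $A:X\to Y$ such that $(Ax_n)$ is $\zeta$-weakly null whenever $(x_n)\subset X$ is $\xi$-weakly null; $\complement\mathfrak{G}_{\xi,\zeta}$ is its complement among bounded operators. A regular family is a family of finite subsets of $\mathbb{N}$ that is hereditary, spreading (closed under replacing $(m_i)_{i=1}^k$ by $(n_i)_{i=1}^k$ with $n_1<\dots<n_k$, $m_i\leqslant n_i$) and compact in $2^{\mathbb{N}}$. For $E\subset\mathbb{N}$ and $x=\sum a_ne_n\in c_{00}$, $Ex=\sum_{n\in E}a_ne_n$. For a regular family $\mathcal{F}$ containing all singletons, $\|x\|_{\mathcal{F}}=\sup\{\|Ex\|_{\ell_1}:E\in\mathcal{F}\}$; the Schreier space $X_\zeta$ is the completion of $c_{00}$ under $\|\cdot\|_{\mathcal{S}_\zeta}$. A mixed Schreier space is the completion of $c_{00}$ under $[x]=\sup\{\varpi_n\|Ex\|_{\ell_1}:n\in\mathbb{N},E\in\mathcal{F}_n\}$ for some null sequence $(\varpi_n)\subset(0,1]$ and regular families $\mathcal{F}_n$ containing all singletons. A formal identity between two such spaces maps $e_i\mapsto e_i$. Subsequential universality: let $F,G$ have bases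 $(f_i),(g_i)$ such that the formal inclusion $U:F\to G$, $Uf_i=g_i$, is bounded. For $M\in[\mathbb{N}]$ let $F_M$, $G_M$ be the closed spans of $(f_m)_{m\in M}$, $(g_m)_{m\in M}$, and $U_M:F_M\to G_M$ the restriction of $U$. For a class $\mathfrak{I}$ of operators, $U$ is subsequentially universal for $\complement\mathfrak{I}$ if for every bounded $A:X\to Y$ not in $\mathfrak{I}$ and every $L\in[\mathbb{N}]$ there exist $M\in[L]$ and closed subspaces $X_0\subset X$, $Y_0\subset Y$ with $A(X_0)\subset Y_0$ and bounded operators $R:F_M\to X_0$, $S:Y_0\to G_M$ with $U_M=S\,A|_{X_0}R$. *)

(* Defs.v *)
From mathcomp Require Import all_boot all_order all_algebra.
From mathcomp Require Import all_classical all_reals all_analysis.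
From mathcomp Require Import Rstruct.
Set Implicit Arguments. Unset Strict Implicit. Unset Printing Implicit Defensive.
Import Order.TTheory GRing.Theory Num.Theory.
Local Open Scope ring_scope.
Local Open Scope classical_set_scope.

Notation RR := Rdefinitions.R.

(* Countable ordinals as Brouwer trees; a limit node carries its       *)
(* fundamental sequence (xi_n).                                       *)
Inductive ord : Type :=
| OZ : ord
| OS : ord -> ord
| OL : (nat -> ord) -> ord.

Inductive ole : ord -> ord -> Prop :=
| ole_Z b : ole OZ b
| ole_SR a b : ole a b -> ole a (OS b)
| ole_SS a b : ole a b -> ole (OS a) (OS b)
| ole_LR a f n : ole a (f n) -> ole a (OL f)
| ole_LL f b : (forall n, ole (f n) b) -> ole (OL f) b.

Definition olt (a b : ord) : Prop := ole (OS a) b.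

(* Families of finite subsets of N.  A finite set is a strictly       *)
(* increasing list; N = {1,2,...} of the paper is identified with nat *)
(* via n+1 |-> n, so the Schreier condition |E| <= min E reads        *)
(* |E| <= min E + 1.                                                   *)
Definition fam := seq nat -> Prop.

Definition S0 : fam := fun E => E = [::] \/ exists n, E = [:: n].

Definition schreier : fam := fun E => (size E <= (head 0%N E).+1)%N.

Definition fam_comp (G F : fam) : fam := fun E =>
  E = [::] \/
  exists Es : seq (seq nat),
    flatten Es = E /\ all (fun e => e != [::]) Es /\
    (forall e, e \in Es -> F e) /\ G (map (head 0%N) Es).

(* S_xi, computed along the tree; for a limit xi with sequence f,
   S_xi = {0} u {E nonempty : E in S_{f(min E)+1}}  (shifted indexing) *)
Fixpoint Sch (a : ord) : fam :=
  match a with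
  | OZ => S0
  | OS b => fam_comp schreier (Sch b)
  | OL f => fun E => fam_comp schreier (Sch (f (head 0%N E))) E
  end.

Fixpoint wf_ord (a : ord) : Prop :=
  match a with
  | OZ => True
  | OS b => wf_ord b
  | OL f => (forall n, wf_ord (f n)) /\ (forall n, olt (f n) (f n.+1)) /\
            (forall n E, sorted ltn E -> Sch (OS (f n)) E -> Sch (f n.+1) E)
  end.

Inductive ordw : Type := Ctbl of ord | Omega1.

Definition ltw (a b : ordw) : Prop :=
  match a, b with
  | Ctbl x, Ctbl y => olt x y
  | Ctbl _, Omega1 => True
  | Omega1, _ => False
  end.

Definition wf_ordw (a : ordw) : Prop :=
  match a with Ctbl x => wf_ord x | Omega1 => True end.

Section Banach.

Definition strictly_incr (p : nat -> nat) : Prop := forall n, (p n < p n.+1)%N.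

Definition bounded_seq (X : normedModType RR) (x : nat -> X) : Prop :=
  exists M : RR, forall n, `|x n| <= M.

Definition in_co (X : normedModType RR) (x : nat -> X) (F : seq nat) (v : X) : Prop :=
  exists a : nat -> RR, (forall i, 0 <= a i) /\ \sum_(i <- F) a i = 1 /\
    v = \sum_(i <- F) a i *: x i.

Definition l1_spreading (xi : ord) (X : normedModType RR) (x : nat -> X) : Prop :=
  bounded_seq x /\
  exists delta : RR, 0 < delta /\
    forall F v, sorted ltn F -> Sch xi F -> in_co x F v -> delta <= `|v|.

Definition lin_functional (X : normedModType RR) (phi : X -> RR) : Prop :=
  (forall (a : RR) u v, phi (a *: u + v) = a * phi u + phi v) /\
  exists c : RR, forall v, `|phi v| <= c * `|v|.

Definition weakly_null (X : normedModType RR) (x : nat -> X) : Prop :=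
  forall phi, lin_functional phi ->
    forall eps : RR, 0 < eps -> exists N, forall n, (N <= n)%N -> `|phi (x n)| < eps.

Definition wnull (xi : ordw) (X : normedModType RR) (x : nat -> X) : Prop :=
  match xi with
  | Ctbl a => bounded_seq x /\
              ~ exists p, strictly_incr p /\ l1_spreading a (x \o p)
  | Omega1 => weakly_null x
  end.

Definition bounded_op_on (V W : normedModType RR) (D : set V) (C : set W) (T : V -> W)
  : Prop :=
  (forall v, D v -> C (T v)) /\
  (forall (a : RR) u v, D u -> D v -> T (a *: u + v) = a *: T u + T v) /\
  exists c : RR, forall v, D v -> `|T v| <= c * `|v|.

Definition bounded_op (V W : normedModType RR) (T : V -> W) : Prop :=
  bounded_op_on setT setT T.

Definition closed_subspace (V : normedModType RR) (D : set V) : Prop :=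
  D 0 /\ (forall (a : RR) u v, D u -> D v -> D (a *: u + v)) /\
  (forall x, (forall eps : RR, 0 < eps -> exists y, D y /\ `|x - y| < eps) -> D x).

Definition lin_span (V : normedModType RR) (f : nat -> V) : set V :=
  fun v => exists (N : nat) (a : nat -> RR), v = \sum_(i < N) a i *: f i.

Definition cspan (V : normedModType RR) (f : nat -> V) : set V :=
  fun x => forall eps : RR, 0 < eps -> exists y, lin_span f y /\ `|x - y| < eps.

Definition series_to (V : normedModType RR) (f : nat -> V) (a : nat -> RR) (x : V) : Prop :=
  forall eps : RR, 0 < eps -> exists N, forall n, (N <= n)%N ->
    `|x - \sum_(i < n) a i *: f i| < eps.

Definition basic (V : normedModType RR) (f : nat -> V) : Prop :=
  forall x, cspan f x ->
    exists a, series_to f a x /\ forall b, series_to f b x -> forall i, b i = a i.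

Definition inG (xi zeta : ordw) (X Y : normedModType RR) (A : X -> Y) : Prop :=
  forall x : nat -> X, wnull xi x -> wnull zeta (A \o x).

(* U : [f_i] -> [g_i] is subsequentially universal for the complement of
   G_{xi,zeta}.  Infinite subsets L, M of N are given by their strictly
   increasing enumerations; M in [L] means M = L o p, p strictly increasing. *)
Definition subseq_universal (xi zeta : ordw) (F G : completeNormedModType RR)
  (f : nat -> F) (g : nat -> G) (U : F -> G) : Prop :=
  forall (X Y : completeNormedModType RR) (A : X -> Y),
    bounded_op A -> ~ inG xi zeta A ->
    forall L, strictly_incr L ->
    exists p, strictly_incr p /\
    exists (X0 : set X) (Y0 : set Y) (Rop : F -> X) (Sop : Y -> G),
      closed_subspace X0 /\ closed_subspace Y0 /\
      (forall x, X0 x -> Y0 (A x)) /\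
      bounded_op_on (cspan (f \o (L \o p))) X0 Rop /\
      bounded_op_on Y0 (cspan (g \o (L \o p))) Sop /\
      (forall v, cspan (f \o (L \o p)) v -> U v = Sop (A (Rop v))).

End Banach.

Definition hereditary (F : fam) : Prop :=
  forall E E', sorted ltn E -> F E -> subseq E' E -> F E'.

Definition spreading (F : fam) : Prop :=
  forall m n : seq nat, sorted ltn m -> sorted ltn n -> size m = size n ->
    (forall i, (i < size m)%N -> (nth 0 m i <= nth 0 n i)%N) -> F m -> F n.

(* compact in 2^N: every pointwise limit of members is (a finite set) in F *)
Definition compact_fam (F : fam) : Prop :=
  forall (Es : nat -> seq nat) (A : nat -> bool),
    (forall k, sorted ltn (Es k) /\ F (Es k)) ->
    (forall n, exists K, forall k, (K <= k)%N -> (n \in Es k) = A n) ->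
    exists E, sorted ltn E /\ F E /\ forall n, A n = (n \in E).

Definition regular (F : fam) : Prop := hereditary F /\ spreading F /\ compact_fam F.

Definition has_singletons (F : fam) : Prop := forall n, F [:: n].

(* r = [x] for the finitely supported x = sum_{i<N} a_i e_i *)
Definition mixed_norm_is (w : nat -> RR) (Fs : nat -> fam) (N : nat) (a : nat -> RR)
  (r : RR) : Prop :=
  (forall n E, sorted ltn E -> Fs n E ->
     w n * \sum_(i <- E | (i < N)%N) `|a i| <= r) /\
  (forall eps : RR, 0 < eps -> exists n E, sorted ltn E /\ Fs n E /\
     r - eps < w n * \sum_(i <- E | (i < N)%N) `|a i|).

(* (Z, e) is (an isometric copy of) the completion of c00 under the mixed
   Schreier norm given by (w, Fs), with e the unit vector basis *)
Definition mixed_schreier (w : nat -> RR) (Fs : nat -> fam)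
  (Z : completeNormedModType RR) (e : nat -> Z) : Prop :=
  (forall n, 0 < w n <= 1) /\
  (forall eps : RR, 0 < eps -> exists K, forall n, (K <= n)%N -> w n < eps) /\
  (forall n, regular (Fs n) /\ has_singletons (Fs n)) /\
  (forall N a, mixed_norm_is w Fs N a `|\sum_(i < N) a i *: e i|) /\
  (forall z, cspan e z).

(* Main.v *)
(**
A family such as [S_b] captures, on a subsequence, the sets on which a sequence has lower l1-estimates, by a
Nash-Williams dichotomy.  For (ii), let [x] be [beta]-weakly null with [A x] an l1-spreading model of order [zeta].
The sets where a norm-one functional is large on [x] then lie in a Schreier family of order below [xi], and a dyadic
decomposition shows that [x] is dominated by the unit vector basis of the mixed space.  Schreier unconditionality of the
weakly null sequence [A x] shows that it dominates the basis of the Schreier space of order [zeta].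

For (i), the sets on which [f] has lower estimates [1/(j+1)^2] lie in families [F_j] strictly below order [xi]
(for [xi = omega_1] a weakly null sequence is already [a]-weakly null for some countable [a], by ranking well-founded
trees).  Take the mixed Schreier space with weights of order [1/j] on families which are too large to embed into [F_j],
and its formal identity [A] into the Schreier space of order [zeta].  If [U] factored through [A], the images [x_m] of
[f_m] would have blocks with lower estimates of order [zeta]; writing the order of each family as [zeta + eta], these
estimates propagate to all families of the mixed norm, so that [f] would have lower estimates on sets outside [F_j].
*)
Require Import Defs.
From mathcomp Require Import all_boot all_order all_algebra.
From mathcomp Require Import all_classical all_reals all_analysis.
From mathcomp Require Import Rstruct.
From HB Require Import structures.
From mathcomp Require Import zify ring lra.
Set Implicit Arguments. Unset Strict Implicit. Unset Printing Implicit Defensive.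
Import Order.TTheory GRing.Theory Num.Theory.
Local Open Scope ring_scope.

(** * Infinite subsets of nat and the Nash-Williams theorem *)

(** Families are compared up to an increasing re-indexing ([emb]): at limits, inclusions between
    Schreier families hold only after a shift, and weak nullity passes to subsequences anyway. A
    bounded sequence is null of order a when [Schr a] embeds into none of its families [lowE x d].

    If xi is the successor of b, no order lies strictly between, so orders alone do not supply ever
    larger families below xi. Hence the use of unions of n+1 sets from S_{g n}. They are separated
    by counting: 2n+3 successive blocks carry unit masses such that a single set of that order
    catches total mass at most 2, so n+1 of them cannot cover all.

    A factorisation costs an unknown but fixed constant, and the estimate recovered for [f] from
    level j is a multiple of 1/(j+2). For large j this exceeds 1/(j+1)^2, whence the squares.

    Propagation of block estimates rests on two facts: S_{zeta+eta} is built over S_zeta by the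
    operations that build S_eta, and a set G meeting only blocks with index in E satisfies min G >=
    min E, so that admissibility of E passes to G. *)

Lemma sincr_lt p i j : strictly_incr p -> (i < j)%N -> (p i < p j)%N.
Proof.
move=> hp; elim: j => // j IH; rewrite ltnS leq_eqVlt => /orP[/eqP->|/IH h].
  exact: hp.
exact: ltn_trans h (hp j).
Qed.

Lemma sincr_le p i j : strictly_incr p -> (i <= j)%N -> (p i <= p j)%N.
Proof. by move=> hp; rewrite leq_eqVlt => /orP[/eqP->//|/(sincr_lt hp)/ltnW]. Qed.

Lemma sincr_ltE p i j : strictly_incr p -> (p i < p j)%N = (i < j)%N.
Proof.
move=> hp; case: (ltnP i j) => h; first by rewrite sincr_lt.
by rewrite ltnNge sincr_le.
Qed.

Lemma sincr_inj p : strictly_incr p -> injective p.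
Proof.
move=> hp i j e; case: (ltngtP i j) => // h; have := sincr_lt hp h;
  by rewrite e ltnn.
Qed.

Lemma sincr_ge p i : strictly_incr p -> (i <= p i)%N.
Proof. by move=> hp; elim: i => // i IH; exact: leq_ltn_trans IH (hp i). Qed.

Lemma sincr_comp p q : strictly_incr p -> strictly_incr q -> strictly_incr (p \o q).
Proof. by move=> hp hq i /=; apply: sincr_lt. Qed.

Lemma sincr_addn K : strictly_incr (addn K).
Proof. by move=> i; rewrite addnS. Qed.

Lemma sincr_id : strictly_incr id.
Proof. by move=> i. Qed.

Lemma sorted_map_sincr p E : strictly_incr p -> sorted ltn E -> sorted ltn (map p E).
Proof.
move=> hp; rewrite sorted_map; apply: sub_sorted => i j /=.
exact: sincr_lt.
Qed.

Lemma sorted_mkseq_sincr p k : strictly_incr p -> sorted ltn (mkseq p k).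
Proof. by move=> hp; apply: sorted_map_sincr => //; exact: iota_ltn_sorted. Qed.

Lemma sincr_factor (L b : nat -> nat) : strictly_incr L -> strictly_incr b ->
  (forall i, exists j, b i = L j) -> exists p, strictly_incr p /\ b = L \o p.
Proof.
move=> hL hb /choice[p hp]; exists p; split; last by apply/funext => i; exact: hp.
by move=> i; rewrite -(sincr_ltE _ _ hL) -!hp.
Qed.

Definition infin (A : nat -> Prop) := forall n, exists m, (n <= m)%N /\ A m.

Lemma infin_enum (A : nat -> Prop) : infin A ->
  exists p, strictly_incr p /\ forall i, A (p i).
Proof.
move=> iA; have [f hf] := choice iA.
pose p := fix p n := if n is m.+1 then f (p m).+1 else f 0%N.
exists p; split; first by move=> i /=; case: (hf (p i).+1).
by case=> [|i] /=; [have [] := hf 0%N|have [] := hf (p i).+1].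
Qed.

Lemma infin_range p : strictly_incr p -> infin (fun m => exists i, m = p i).
Proof. by move=> hp n; exists (p n); split; [exact: sincr_ge|exists n]. Qed.

Lemma infin_tail A k : infin A -> infin (fun n => A n /\ (k <= n)%N).
Proof.
move=> iA n; have [m [h Am]] := iA (maxn n k).
by exists m; split; [lia|split=> //; lia].
Qed.

(* [u] lists the elements chosen so far and [A] is the reservoir for later choices. *)
Lemma fusion (Psi : seq nat -> (nat -> Prop) -> Prop) (A0 : nat -> Prop) :
  (forall u A A', (forall n, A' n -> A n) -> Psi u A -> Psi u A') ->
  (forall u A, infin A -> (forall n, A n -> A0 n) ->
     exists A', infin A' /\ (forall n, A' n -> A n) /\ Psi u A') ->
  infin A0 ->
  exists a, strictly_incr a /\ (forall k, A0 (a k)) /\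
    forall k, Psi (mkseq a k) (fun n => exists i, n = a (k + i)%N).
Proof.
move=> mono dense iA0.
pose st := {x : seq nat * (nat -> Prop) |
  [/\ infin x.2, forall n, x.2 n -> A0 n & Psi x.1 x.2]}.
have step (x : st) : {y : st | exists a, [/\ (sval x).2 a, (sval y).1 = rcons (sval x).1 a &
    forall n, (sval y).2 n -> (sval x).2 n /\ (a < n)%N]}.
  apply: cid; case: x => [[u A] /= [iA sA PA]].
  have [a [_ Aa]] := iA 0%N.
  have [|A' [iA' [sA' PA']]] := dense (rcons u a) _ (infin_tail a.+1 iA).
    by move=> n [/sA].
  have h : [/\ infin (rcons u a, A').2, forall n, (rcons u a, A').2 n -> A0 n
        & Psi (rcons u a, A').1 (rcons u a, A').2].
    by split=> //= n /sA'[/sA].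
  exists (exist _ (rcons u a, A') h); exists a; split=> //= n /sA'[]; split=> //.
have [A1 [iA1 [sA1 PA1]]] := dense [::] A0 iA0 (fun n h => h).
have h1 : [/\ infin ([::] : seq nat, A1).2, forall n, ([::] : seq nat, A1).2 n -> A0 n
   & Psi ([::] : seq nat, A1).1 ([::] : seq nat, A1).2] by split.
pose x0 : st := exist _ ([::], A1) h1.
pose X := fix X n := if n is m.+1 then sval (step (X m)) else x0.
have XS k : exists a, [/\ (sval (X k)).2 a, (sval (X k.+1)).1 = rcons (sval (X k)).1 a &
    forall n, (sval (X k.+1)).2 n -> (sval (X k)).2 n /\ (a < n)%N].
  by rewrite /=; case: (step (X k)).
have [a ha] := choice XS.
have dec_ k i n : (sval (X (k + i)%N)).2 n -> (sval (X k)).2 n.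
  elim: i => [|i IH]; first by rewrite addn0.
  by rewrite addnS => h; apply: IH; case: (ha (k + i)%N) => _ _ /(_ n h)[].
exists a; split; last split.
- move=> k; have [_ _ h] := ha k; have [h' _ _] := ha k.+1.
  by case: (h _ h').
- move=> k; have [h _ _] := ha k.
  by case: (svalP (X k)) => _ + _; apply.
- move=> k; have -> : mkseq a k = (sval (X k)).1.
    elim: k => [//|k IH]; rewrite mkseqS IH.
    by case: (ha k) => _ -> _.
  case: (svalP (X k)) => _ _; apply: mono => n [i ->].
  by have [h _ _] := ha (k + i)%N; exact: dec_ h.
Qed.

(** An explicit finite list, so that requirements indexed by the subsets of [u] can be met one after
    another by [dense_list]. *)
Fixpoint subs (u : seq nat) : seq (seq nat) :=
  if u is x :: v then subs v ++ map (cons x) (subs v) else [:: [::]].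

Lemma mem_subs u s : (s \in subs u) = subseq s u.
Proof.
elim: u s => [|x u IH] s /=; first by rewrite inE; case: s.
rewrite mem_cat IH; case: s => [|y s] /=; first by rewrite sub0seq.
have [->|nyx] := eqVneq y x.
  rewrite mem_map; last by move=> ? ? [].
  rewrite IH; apply/orP/idP; last by right.
  by case=> // h; apply: subseq_trans h; exact: subseq_cons.
case: mapP => [[t _ [e]]|_]; last by rewrite orbF.
by rewrite e eqxx in nyx.
Qed.

Lemma dense_list (T : eqType) (l : seq T) (P : T -> (nat -> Prop) -> Prop) (A : nat -> Prop) :
  (forall t A A', (forall n, A' n -> A n) -> P t A -> P t A') ->
  (forall t A', infin A' -> (forall n, A' n -> A n) ->
     exists A'', infin A'' /\ (forall n, A'' n -> A' n) /\ P t A'') ->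
  infin A -> exists A', infin A' /\ (forall n, A' n -> A n) /\ forall t, t \in l -> P t A'.
Proof.
move=> mono dense iA; elim: l => [|t l [A1 [i1 [s1 h1]]]]; first by exists A.
have [A2 [i2 [s2 h2]]] := dense t A1 i1 s1.
exists A2; split=> //; split; first by move=> n /s2/s1.
move=> t'; rewrite inE => /orP[/eqP->//|/h1]; exact: mono.
Qed.

Lemma sorted_subset_filter (s t : seq nat) : sorted ltn s -> sorted ltn t ->
  {subset s <= t} -> s = [seq x <- t | x \in s].
Proof.
move=> ss st sub; apply: (irr_sorted_eq ltn_trans ltnn) => //.
  exact: sorted_filter ltn_trans _ _ _.
by move=> x; rewrite mem_filter andb_idr //; exact: sub.
Qed.

Lemma sorted_subset_subseq (s t : seq nat) : sorted ltn s -> sorted ltn t ->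
  {subset s <= t} -> subseq s t.
Proof. by move=> ss st /(sorted_subset_filter ss st) ->; exact: filter_subseq. Qed.

Lemma mkseq_subseq_range a (M : nat -> nat) k : strictly_incr a -> strictly_incr M ->
  (forall i, exists j, M i = a j) -> exists n, subseq (mkseq M k) (mkseq a n).
Proof.
move=> ha hM hr; have [j [hj ->]] := sincr_factor ha hM hr.
exists (j k); rewrite /mkseq (map_comp a j) map_subseq //.
apply: sorted_subset_subseq.
- exact: (sorted_mkseq_sincr k hj).
- exact: iota_ltn_sorted.
move=> x /mapP[i]; rewrite mem_iota /= add0n => hi ->.
by rewrite mem_iota /= add0n sincr_ltE.
Qed.

Section NashWilliams.
Variable O : seq nat -> Prop.
Hypothesis Oext : forall s t, O s -> O (s ++ t).

(** The accept/reject notions of Galvin and Prikry for the open set generated by [O]. Both survive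
    shrinking the reservoir, as [fusion] demands. *)
Let acc s (A : nat -> Prop) :=
  forall N, strictly_incr N -> (forall i, A (N i)) -> exists k, O (s ++ mkseq N k).
Let rej s (A : nat -> Prop) :=
  forall B, infin B -> (forall n, B n -> A n) -> ~ acc s B.

Let acc_mono s A A' : (forall n, A' n -> A n) -> acc s A -> acc s A'.
Proof. by move=> h hA N sN hN; apply: hA => // i; exact/h. Qed.

Let rej_mono s A A' : (forall n, A' n -> A n) -> rej s A -> rej s A'.
Proof. by move=> h hA B iB hB; apply: hA => // n /hB/h. Qed.

Theorem nash_williams L : strictly_incr L -> exists p, strictly_incr p /\
  ((forall q, strictly_incr q -> exists k, O (mkseq (L \o p \o q) k)) \/
   (forall q k, strictly_incr q -> ~ O (mkseq (L \o p \o q) k))).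
Proof.
move=> hL; have iL := infin_range hL.
(* First fusion: along [a], the tail after each finite [s] decides it. If rejection fails, the
   failure itself hands over an infinite subset that accepts. *)
have [a [sa [aL ha]]] : exists a, strictly_incr a /\
   (forall k, exists i, a k = L i) /\
   forall k s, s \in subs (mkseq a k) ->
     acc s (fun n => exists i, n = a (k + i)%N) \/ rej s (fun n => exists i, n = a (k + i)%N).
  apply: (@fusion (fun u A => forall s, s \in subs u -> acc s A \/ rej s A) _ _ _ iL).
    move=> u A A' sA h s /h[h1|h1]; [left; exact: acc_mono h1|right; exact: rej_mono h1].
  move=> u A iA sA; apply: (@dense_list _ _ (fun s A => acc s A \/ rej s A)) => //.
    move=> s A1 A2 sA1 [h1|h1]; [left; exact: acc_mono h1|right; exact: rej_mono h1].
  move=> s A' iA' sA'; have [h|h] := EM (rej s A'); first by exists A'; split=> //; split=> //; right.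
  move/existsNP: h => [B] /not_implyP[iB] /not_implyP[sB] /contrapT aB.
  by exists B; split=> //; split=> //; left.
pose A k n := exists i, n = a (k + i)%N.
have Amono j k n : (j <= k)%N -> A k n -> A j n.
  by move=> h [i ->]; exists (k - j + i)%N; congr a; lia.
have iA k : infin (A k).
  move=> n; exists (a (k + n)%N); split; last by exists n.
  by apply: leq_trans (leq_addl k n) (sincr_ge _ sa).
pose Rej s := exists j, rej s (A j).
have notRej k s : subseq s (mkseq a k) -> ~ Rej s -> acc s (A k).
  move=> h nR; case: (ha k s); first by rewrite mem_subs.
    by [].
  by move=> r; case: nR; exists k.
(* Not rejecting the empty sequence means accepting it, which is the first alternative along [a].
   Otherwise rejection has to be propagated to all finite sets. *)
have [Rn|nRn] := EM (Rej [::]); last first.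
  have [p [sp ep]] := sincr_factor hL sa aL.
  exists p; split=> //; left => q sq; rewrite -ep.
  have := @notRej 0%N [::] isT nRn _ (sincr_comp sa sq); apply=> i.
  by exists (q i).
pose Ra s := exists k, subseq s (mkseq a k).
(* Second fusion: one-point extensions of rejected sets stay rejected, so every finite subset of the
   range of [b] ends up rejected. *)
have [b [sb [ba hb]]] : exists b, strictly_incr b /\ (forall k, A 0%N (b k)) /\
   forall k s, s \in subs (mkseq b k) -> Ra s ->
     Rej s -> forall n, (exists i, n = b (k + i)%N) -> Rej (rcons s n).
  apply: (@fusion (fun u A' => forall s, s \in subs u -> Ra s -> Rej s ->
     forall n, A' n -> Rej (rcons s n)) _ _ _ (iA 0%N)).
    by move=> u A1 A2 sA h s /h{}h /h{}h /h{}h n /sA; exact: h.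
  move=> u A1 iA1 sA1.
  apply: (@dense_list _ _ (fun s A' => Ra s -> Rej s -> forall n, A' n -> Rej (rcons s n))) => //.
    by move=> s A2 A3 sA2 h /h{}h /h{}h n /sA2; exact: h.
  move=> s A2 iA2 sA2.
  have [[j rj]|] := EM (Rej s); last by move=> nR; exists A2.
  have [[k0 hk0]|nRa] := EM (Ra s); last by exists A2.
  (* Only finitely many extensions can fail: infinitely many accepted extensions of [s] would form a
     set accepting [s] itself. *)
  suff [k hk] : exists k, forall n, (k <= n)%N -> A2 n -> Rej (rcons s n).
    exists (fun n => A2 n /\ (k <= n)%N); split; first exact: infin_tail.
    by split=> [n []//|_ _ n [h1 h2]]; exact: hk.
  apply: contrapT => /forallNP hn.
  pose m := maxn j k0; pose B n := A m n /\ ~ Rej (rcons s n).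
  apply: (rj B).
  - move=> n; have /existsNP[l] := hn (maxn n (a m)).
    move=> /not_implyP[h1] /not_implyP[h2 h3]; exists l; split; first lia.
    split=> //; have [i e] := sA1 _ (sA2 _ h2).
    exists (i - m)%N; rewrite e; congr a.
    have {}h1 : (a m <= a i)%N by rewrite -e (leq_trans _ h1) // leq_maxr.
    by move: h1; rewrite leqNgt sincr_ltE // -leqNgt; lia.
  - by move=> n [+ _]; apply: Amono; rewrite leq_maxl.
  move=> N sN hN; have [[i0 e0] nR] := hN 0%N.
  have hs : subseq (rcons s (N 0%N)) (mkseq a (m + i0).+1).
    rewrite mkseqS e0 -!cats1 cat_subseq //; apply: subseq_trans hk0 _.
    have -> : (m + i0 = k0 + (m - k0 + i0))%N by lia.
    by rewrite /mkseq iotaD map_cat prefix_subseq.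
  have tl i : A (m + i0).+1 (N i.+1).
    have [[i1 e1] _] := hN i.+1.
    have : (N 0 < N i.+1)%N by apply: sincr_lt.
    rewrite e0 e1 sincr_ltE // => h.
    by exists (i1 - i0.+1)%N; congr a; lia.
  have [k hk] := notRej _ _ hs nR (N \o S) (sincr_comp sN (fun i => ltnSn i.+1)) tl.
  exists k.+1; move: hk; rewrite cat_rcons.
  by rewrite /mkseq /= (iotaDl 1 0 k) -map_comp.
have Ba i : exists j, b i = a j by have [j ej] := ba i; exists j.
have Rb k : Rej (mkseq b k).
  elim: k => [//|k IH]; rewrite mkseqS; apply: hb IH _ _.
  - by rewrite mem_subs.
  - exact: mkseq_subseq_range.
  - by exists 0%N; rewrite addn0.
have Rq q k : strictly_incr q -> Rej (mkseq (b \o q) k).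
  move=> sq; elim: k => [//|k IH]; rewrite mkseqS.
  apply: (hb (q k)) IH _ _; last by exists 0%N; rewrite addn0.
    rewrite mem_subs /mkseq (map_comp b q) map_subseq //.
    apply: sorted_subset_subseq.
    - exact: (sorted_mkseq_sincr k sq).
    - exact: iota_ltn_sorted.
    move=> x /mapP[i]; rewrite mem_iota /= add0n => hi ->.
    by rewrite mem_iota /= add0n sincr_ltE.
  apply: mkseq_subseq_range => //; first exact: sincr_comp.
  by move=> i; exact: Ba.
have [p [sp ep]] : exists p, strictly_incr p /\ b = L \o p.
  by apply: sincr_factor => // i; have [j ->] := Ba i; exact: aL.
exists p; split=> //; right => q k sq; rewrite -ep => Oq.
have [j rj] := Rq q k sq; apply: (rj (A j)) => // N sN hN.
by exists 0%N; exact: Oext.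
Qed.

End NashWilliams.

(** * Regular families and transfinite Schreier families *)

Definition wfd (F : fam) := forall N, strictly_incr N -> exists k, ~ F (mkseq N k).

(** The preorder measuring the size of families; passing to a subsequence is exactly such a
    re-indexing. *)
Definition emb (A B : fam) := exists p, strictly_incr p /\
  forall E, sorted ltn E -> A E -> B (map p E).

(** For [phi := S] this is the operation S[F]; for constant [phi] it consists of unions of boundedly
    many successive members of F, which gives families intermediate between two consecutive Schreier
    orders. *)
Definition comp (phi : nat -> nat) (F : fam) : fam := fun E =>
  exists Es, [/\ flatten Es = E, all (fun e => e != [::]) Es,
    (forall e, e \in Es -> F e) & (size Es <= phi (head 0%N E))%N].

(* A variant of [Sch] that is regular for every tree: at a limit it takes the union over [n <= min E]. *)
(* By [Sch_emb] and [Schr_emb] the two agree up to passing to subsequences. *)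
Fixpoint Schr (a : ord) : fam :=
  match a with
  | OZ => fun E => (size E <= 1)%N
  | OS b => comp S (Schr b)
  | OL f => fun E => exists n, (n <= head 0%N E)%N /\ Schr (f n) E
  end.

Lemma head_le_mem (E : seq nat) x : sorted ltn E -> x \in E -> (head 0%N E <= x)%N.
Proof.
case: E => [//|y E] /= /(order_path_min ltn_trans)/allP h.
by rewrite inE => /orP[/eqP->//|/h/ltnW].
Qed.

Lemma head_mem (E : seq nat) : E != [::] -> head 0%N E \in E.
Proof. by case: E => //= x E _; rewrite mem_head. Qed.

Lemma head_map_sincr p (E : seq nat) : E != [::] -> head 0%N (map p E) = p (head 0%N E).
Proof. by case: E. Qed.

Lemma flatten_nil (T : eqType) (Es : seq (seq T)) :
  flatten [seq e <- Es | e != [::]] = flatten Es.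
Proof. by elim: Es => //= e Es IH; case: eqP => [->|_] //=; rewrite IH. Qed.

Lemma flatten_eq_nil (T : eqType) (Es : seq (seq T)) : all (fun e => e != [::]) Es ->
  flatten Es = [::] -> Es = [::].
Proof. by case: Es => [//|[|x e] Es]. Qed.

Lemma mem_flatten_subseq (T : eqType) (e : seq T) Es : e \in Es -> subseq e (flatten Es).
Proof.
elim: Es => //= f Es IH; rewrite inE => /orP[/eqP->|/IH h]; first exact: prefix_subseq.
exact: subseq_trans h (suffix_subseq _ _).
Qed.

Lemma sorted_subseq_ltn (s t : seq nat) : subseq s t -> sorted ltn t -> sorted ltn s.
Proof. exact: subseq_sorted ltn_trans _ _. Qed.

Lemma spreading_map F p q E : spreading F -> sorted ltn E -> strictly_incr p ->
  strictly_incr q -> (forall i, i \in E -> (p i <= q i)%N) -> F (map p E) -> F (map q E).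
Proof.
move=> sF sE sp sq h; apply: sF; rewrite ?sorted_map_sincr ?size_map // => i hi.
by rewrite !(nth_map 0%N) // h // mem_nth.
Qed.

Lemma spreading_sincr F p E : spreading F -> sorted ltn E -> strictly_incr p ->
  F E -> F (map p E).
Proof.
move=> sF sE sp FE; apply: (spreading_map sF sE sincr_id sp); last by rewrite map_id.
by move=> i _; exact: sincr_ge.
Qed.

Lemma compW (phi psi : nat -> nat) (F G : fam) (E : seq nat) :
  (phi (head 0%N E) <= psi (head 0%N E))%N -> (forall e, subseq e E -> F e -> G e) ->
  comp phi F E -> comp psi G E.
Proof.
move=> le FG [Es [e1 e2 e3 e4]]; exists Es; split=> //; last exact: leq_trans le.
by move=> e he; apply: FG (e3 _ he); rewrite -e1 mem_flatten_subseq.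
Qed.

Lemma comp_nil phi F : comp phi F [::].
Proof. by exists [::]. Qed.

Lemma comp_restrict F (Q : pred nat) Es : hereditary F ->
  sorted ltn (flatten Es) -> (forall e, e \in Es -> F e) ->
  exists Es', [/\ flatten Es' = seq.filter Q (flatten Es), all (fun e => e != [::]) Es',
    (forall e, e \in Es' -> F e) & (size Es' <= size Es)%N].
Proof.
move=> hF sE hEs.
exists [seq e <- map (seq.filter Q) Es | e != [::]]; split.
- by rewrite flatten_nil filter_flatten.
- exact: filter_all.
- move=> e; rewrite mem_filter => /andP[_ /mapP[e0 h0 ->]].
  apply: hF (hEs _ h0) (filter_subseq _ _).
  exact: sorted_subseq_ltn (mem_flatten_subseq h0) sE.
- by rewrite size_filter (leq_trans (count_size _ _)) // size_map.
Qed.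

Lemma head_subseq (E E' : seq nat) : sorted ltn E -> subseq E' E -> E' != [::] ->
  (head 0%N E <= head 0%N E')%N.
Proof. by move=> sE sub h; rewrite head_le_mem // (mem_subseq sub) // head_mem. Qed.

Lemma comp_hered phi F : {homo phi : i j / (i <= j)%N} -> hereditary F ->
  hereditary (comp phi F).
Proof.
move=> mphi hF E E' sE [Es [e1 e2 e3 e4]] sub.
have sE' := sorted_subseq_ltn sub sE.
have [|nE] := eqVneq E' [::]; first by move=> ->; exact: comp_nil.
have [|Es' [f1 f2 f3 f4]] := @comp_restrict F (mem E') Es hF _ e3; first by rewrite e1.
exists Es'; split=> //.
  by rewrite f1 e1 [RHS](sorted_subset_filter sE' sE) //; exact: mem_subseq.
apply: leq_trans f4 (leq_trans e4 _); exact/mphi/head_subseq.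
Qed.

(** Cutting [n] at the positions where [m] is cut yields spreads of the pieces of [m], and the
    minimum only grows. *)
Lemma comp_spreading phi F : {homo phi : i j / (i <= j)%N} -> spreading F ->
  spreading (comp phi F).
Proof.
move=> mphi sF m n sm sn sz le [Es [e1 e2 e3 e4]].
suff [Es' [f1 f2 f3 f4]] : exists Es', [/\ flatten Es' = n, all (fun e => e != [::]) Es',
    (forall e, e \in Es' -> F e) & size Es' = size Es].
  exists Es'; split=> //; rewrite f4 (leq_trans e4) // mphi //.
  by case: m n sz le {sm sn e1 e4 f1} => [|x m] [|y n] //= _ /(_ 0%N isT).
move: e1 e2 e3 {e4}; elim: Es m n sm sn sz le => [|e Es IH] m n sm sn sz le /=.
  by move=> e _ _; exists [::]; case: n {sn le} sz; rewrite -e.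
move=> em /andP[ne nes] hF.
have sz1 : size (take (size e) n) = size e.
  by rewrite size_take_min -sz -em size_cat; apply/minn_idPl; rewrite leq_addr.
have nthn i : nth 0%N n i = if (i < size e)%N then nth 0%N (take (size e) n) i
     else nth 0%N (drop (size e) n) (i - size e).
  by rewrite -[in LHS](cat_take_drop (size e) n) nth_cat sz1.
have [|||||||Es' [f1 f2 f3 f4]] := IH (flatten Es) (drop (size e) n).
- by move: sm; rewrite -em => /cat_sorted2[].
- exact: sorted_subseq_ltn (drop_subseq _ _) sn.
- by rewrite size_drop -sz -em size_cat addKn.
- move=> i hi; have := le (size e + i)%N.
  rewrite -em size_cat ltn_add2l => /(_ hi).
  by rewrite nthn nth_cat ltnNge leq_addr /= addKn.
- by [].
- by [].
- by move=> e' he; apply: hF; rewrite inE he orbT.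
exists (take (size e) n :: Es'); split=> /=.
- by rewrite f1 cat_take_drop.
- by rewrite f2 -size_eq0 sz1 size_eq0 ne.
- move=> e'; rewrite inE => /orP[/eqP->|]; last exact: f3.
  apply: (sF e) => //; last by apply: hF; rewrite mem_head.
  + by move: sm; rewrite -em => /cat_sorted2[].
  + exact: sorted_subseq_ltn (take_subseq _ _) sn.
  + move=> i hi; have := le i; rewrite -em size_cat nth_cat hi nthn hi; apply.
    by rewrite ltn_addr.
- by rewrite f4.
Qed.

Lemma hered_prefix F N j k : hereditary F -> strictly_incr N -> (j <= k)%N ->
  F (mkseq N k) -> F (mkseq N j).
Proof.
move=> hF sN jk FN; apply: hF FN _; first exact: sorted_mkseq_sincr.
by rewrite /mkseq -(subnKC jk) iotaD map_cat prefix_subseq.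
Qed.

(** All nonempty prefixes of [N] have the same minimum [N 0], so a constant number of pieces is at
    stake. That case is an induction: the first piece ends within a fixed initial segment of [N],
    the others live on a tail. *)
Lemma comp_wfd phi F : hereditary F -> wfd F -> wfd (comp phi F).
Proof.
move=> hF wF.
have wK K : wfd (comp (fun=> K) F).
  elim: K => [|K IH] N sN.
    by exists 1%N => -[[|e Es] [//]].
  have [k0 hk0] := wF N sN.
  have [k1 hk1] := IH _ (sincr_comp sN (sincr_addn k0)).
  exists (k0 + k1)%N => -[[|e Es] [/= e1 e2 e3 e4]].
    apply: hk0; have : size (mkseq N (k0 + k1)) = 0%N by rewrite -e1.
    rewrite size_mkseq; case: k0 hk1 {e1} => // hk1 /=; rewrite add0n => k10.
    by case: hk1; rewrite k10; exact: comp_nil.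
  have {}e2 : all (fun e => e != [::]) Es by case/andP: e2.
  have mk : mkseq N (k0 + k1) = mkseq N k0 ++ mkseq (N \o addn k0) k1.
    by rewrite /mkseq iotaD map_cat (map_comp N) -iotaDl addn0.
  have sm := sorted_mkseq_sincr (k0 + k1) sN.
  have lt : (size e <= k0)%N.
    rewrite leqNgt; apply/negP => lt; apply: hk0.
    have := e3 e (mem_head _ _); have : subseq (mkseq N k0) e.
      move: e1; rewrite mk => /(congr1 (take k0)).
      rewrite take_cat lt take_size_cat ?size_mkseq // => <-.
      exact: take_subseq.
    move=> sub he; apply: hF he sub; move: sm; rewrite -e1.
    by case/cat_sorted2.
  apply: hk1; have se : sorted ltn (flatten Es).
    by move: sm; rewrite -e1 => /cat_sorted2[].
  apply: (@comp_hered (fun=> K) F _ hF _ _ se).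
  - by [].
  - by exists Es; split=> // e' he; apply: e3; rewrite inE he orbT.
  - move: e1; rewrite mk => /(congr1 (drop (size e))).
    rewrite drop_size_cat // drop_cat size_mkseq.
    case: ltnP => h ->; first exact: suffix_subseq.
    have -> : (size e - k0 = 0)%N by lia.
    by rewrite drop0 subseq_refl.
move=> N sN; have [k hk] := wK (phi (N 0%N)) N sN; exists k => hc; apply: hk.
case: k hc => [_|k [Es [e1 e2 e3 e4]]]; first exact: comp_nil.
by exists Es.
Qed.

(** Finite parts of a pointwise limit lie inside some [Es K], hence in F; an infinite limit would be
    a branch contradicting [wfd]. *)
Lemma wfd_compact F : hereditary F -> wfd F -> compact_fam F.
Proof.
move=> hF wF Es A hEs cv.
have sub (E : seq nat) : sorted ltn E -> (forall n, n \in E -> A n) -> F E.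
  move=> sE hE; have [K hK] : exists K, forall n, n \in E -> n \in Es K.
    have [K hK] := choice cv; exists (\max_(n <- E) K n) => n hn.
    by rewrite (hK n) ?hE //; exact: leq_bigmax_seq.
  have [sK FK] := hEs K; apply: hF FK _ => //; exact: sorted_subset_subseq.
have [iA|] := EM (infin A).
  have [N [sN AN]] := infin_enum iA; have [k []] := wF N sN.
  apply: sub; first exact: sorted_mkseq_sincr.
  by move=> n /mapP[i _ ->].
move=> /existsNP[b /forallNP hb].
have s1 : sorted ltn [seq n <- iota 0 b | A n].
  by apply: sorted_filter; [exact: ltn_trans|exact: iota_ltn_sorted].
exists [seq n <- iota 0 b | A n]; split=> //; split.
  by apply: sub => // n; rewrite mem_filter => /andP[].
move=> n; rewrite mem_filter mem_iota /= add0n.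
case: (boolP (A n)) => //= An; case: (ltnP n b) => // h.
by case: (hb n).
Qed.

Lemma Schr_nil a : Schr a [::].
Proof. by elim: a => [//|b _|f IH] /=; [exact: comp_nil|exists 0%N]. Qed.

Lemma Schr_hered a : hereditary (Schr a).
Proof.
elim: a => [|b IH|f IH] /=.
- by move=> E E' _ h /size_subseq/leq_trans; apply.
- by apply: comp_hered => // i j.
- move=> E E' sE [n [hn FE]] sub; have [->|ne] := eqVneq E' [::].
    by exists 0%N; split=> //; exact: Schr_nil.
  by exists n; split; [rewrite (leq_trans hn) // head_subseq|exact: IH FE sub].
Qed.

Lemma Schr_spreading a : spreading (Schr a).
Proof.
elim: a => [|b IH|f IH] /=.
- by move=> m n _ _ ->.
- by apply: comp_spreading => // i j.
- move=> m n sm sn sz le [k [hk Fm]]; exists k; split; last exact: IH Fm.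
  apply: leq_trans hk _.
  by case: m n sz le {sm sn Fm} => [|x m] [|y n] //= _ /(_ 0%N isT).
Qed.

Lemma Schr_wfd a : wfd (Schr a).
Proof.
elim: a => [|b IH|f IH] /=.
- by move=> N _; exists 2%N; rewrite size_mkseq.
- by apply: comp_wfd => //; exact: Schr_hered.
- move=> N sN; have [k hk] := choice (fun n => IH n N sN).
  pose K := (\max_(n < (N 0%N).+1) k n).+1; exists K => -[n [hn]].
  rewrite -ltnS in hn => hF; apply: (hk n); apply: (hered_prefix _ sN _ hF).
    exact: Schr_hered.
  exact: leqW (leq_bigmax (Ordinal hn)).
Qed.

Lemma size1_comp phi F E : (0 < phi (head 0%N E))%N -> F E -> comp phi F E.
Proof.
move=> h FE; have [->|ne] := eqVneq E [::]; first exact: comp_nil.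
exists [:: E]; split=> //=; first by rewrite cats0.
  by rewrite ne.
by move=> e; rewrite inE => /eqP->.
Qed.

Lemma Schr1 a n : Schr a [:: n].
Proof.
elim: a => [//|b IH|f IH] /=; first exact: size1_comp.
by exists 0%N.
Qed.

Lemma Schr_regular a : regular (Schr a).
Proof.
split; first exact: Schr_hered; split; first exact: Schr_spreading.
by apply: wfd_compact; [exact: Schr_hered|exact: Schr_wfd].
Qed.

Lemma emb_trans A B C : emb A B -> emb B C -> emb A C.
Proof.
move=> [p [sp hp]] [q [sq hq]]; exists (q \o p); split; first exact: sincr_comp.
by move=> E sE /(hp _ sE)/(hq _ (sorted_map_sincr sp sE)); rewrite -map_comp.
Qed.

Lemma comp_map phi psi F G p E : sorted ltn E ->
  (phi (head 0%N E) <= psi (p (head 0%N E)))%N ->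
  (forall e, sorted ltn e -> F e -> G (map p e)) ->
  comp phi F E -> comp psi G (map p E).
Proof.
move=> sE le FG [Es [e1 e2 e3 e4]]; have [->|ne] := eqVneq E [::]; first exact: comp_nil.
exists (map (map p) Es); split.
- by rewrite -map_flatten e1.
- rewrite all_map; apply: sub_all e2 => e /=.
  by rewrite -!size_eq0 size_map.
- move=> e' /mapP[e he ->]; apply: FG (e3 _ he).
  by apply: sorted_subseq_ltn (mem_flatten_subseq he) _; rewrite e1.
- by rewrite size_map head_map_sincr // (leq_trans e4).
Qed.

(** Together with spreading, one diagonal map replaces the embeddings chosen separately along a
    fundamental sequence. The range reaches [i.+1] because [Sch_emb] uses the term of index min E +
    1. *)
Lemma diag_sincr (P : nat -> nat -> nat) : exists p, strictly_incr p /\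
  forall j i, (j <= i.+1)%N -> (P j i <= p i)%N.
Proof.
pose u i := (\max_(j < i.+2) P j i)%N.
pose p := fix p n := if n is m.+1 then (p m + u n).+1 else u 0%N.
exists p; split=> [i|j i h] /=; first lia.
have hu : (P j i <= u i)%N by exact: (leq_bigmax (Ordinal (h : (j < i.+2)%N))).
by apply: leq_trans hu _; case: i {h} => [|i] //=; lia.
Qed.

(** Below a limit on the right, a shift by [n] makes the [n]-th term admissible; for a limit on the
    left, the embeddings of the terms are diagonalised, only those with index at most min E being
    concerned. *)
Lemma ole_emb a b : ole a b -> emb (Schr a) (Schr b).
Proof.
elim=> {a b} [b|a b _ [p [sp hp]]|a b _ [p [sp hp]]|a f n _ [p [sp hp]]|f b _ IH].
- exists id; split=> // -[|x [|//]] _ _; [exact: Schr_nil|exact: Schr1].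
- by exists p; split=> // E sE /(hp _ sE); exact: size1_comp.
- exists p; split=> // E sE; apply: comp_map => //.
  by rewrite ltnS; exact: sincr_ge.
- exists (addn n \o p); split; first exact: sincr_comp (sincr_addn n) sp.
  move=> E sE /(hp _ sE) h; have [->|ne] := eqVneq E [::]; first exact: Schr_nil.
  exists n; rewrite head_map_sincr //= leq_addr; split=> //.
  rewrite map_comp; apply: spreading_sincr h; [exact: Schr_spreading| |exact: sincr_addn].
  exact: sorted_map_sincr.
- have [P hP] := choice IH; have [p [sp hp]] := diag_sincr P.
  exists p; split=> // E sE [n [hn hE]]; have [sP {}hP] := hP n.
  apply: (spreading_map (@Schr_spreading b) sE sP sp _ (hP _ sE hE)) => i hi.
  by apply: hp; rewrite (leq_trans hn) // leqW // head_le_mem.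
Qed.

(** * Ordinal arithmetic on Brouwer trees *)

Lemma ole_refl a : ole a a.
Proof. by elim: a => *; [exact: ole_Z|exact: ole_SS|apply: ole_LL => n; exact: ole_LR]. Qed.

Lemma ole_S_inv a b : ole (OS a) b -> ole a b.
Proof.
move e: (OS a) => a' h; elim: h a e => {a' b} [//|a' b _ IH a e|a' b h _ a [->]|a' f n _ IH a e|//].
- by apply: ole_SR; exact: IH.
- exact: ole_SR.
- by apply: ole_LR; exact: IH.
Qed.

Lemma ole_L_inv f b n : ole (OL f) b -> ole (f n) b.
Proof.
move e: (OL f) => a' h; elim: h f e => {a' b} [//|a' b _ IH f e|//|a' g m _ IH f e|g b h _ f [->]].
- by apply: ole_SR; exact: IH.
- by apply: ole_LR; exact: IH.
- exact: h.
Qed.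

Lemma ole_trans a b c : ole a b -> ole b c -> ole a c.
Proof.
move=> h; elim: h c => {a b} [b c _|a b _ IH c /ole_S_inv|a b _ IH c h|a f n _ IH c /(ole_L_inv n)|f b _ IH c h].
- exact: ole_Z.
- exact: IH.
- move e: (OS b) h => b' h; elim: h e => {b' c} [//|b' c _ IH' e|b' c h _ [e]|b' f n _ IH' e|//].
  + by apply: ole_SR; exact: IH'.
  + by apply: ole_SS; apply: IH; rewrite e.
  + by apply: ole_LR; exact: IH'.
- exact: IH.
- by apply: ole_LL => n; exact: IH.
Qed.

Lemma ole_SS_inv a b : ole (OS a) (OS b) -> ole a b.
Proof.
move=> h; inversion h as [|a' b' h'|a' b' h'| |]; subst => //; exact: ole_S_inv.
Qed.

Lemma olt_L_inv a f : olt a (OL f) -> exists n, olt a (f n).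
Proof. by move=> h; inversion h as [| | |a' f' n h'|]; subst; exists n. Qed.

Lemma olt_Z_inv a : ~ olt a OZ.
Proof. by move=> h; inversion h. Qed.

Lemma ole_total a b : ole a b \/ olt b a.
Proof.
rewrite /olt; elim: a b => [b|a IH b|f IH b]; first by left; exact: ole_Z.
- elim: b => [|b _|g IHb].
  + by right; apply: ole_SS; exact: ole_Z.
  + by case: (IH b) => h; [left|right]; exact: ole_SS.
  + have [[n h]|/forallNP h] := EM (exists n, ole (OS a) (g n)).
      by left; exact: ole_LR h.
    right; apply: ole_SS; apply: ole_LL => n; case: (IHb n) => [/h//|].
    exact: ole_SS_inv.
- have [[n h]|/forallNP h] := EM (exists n, ole (OS b) (f n)).
    by right; exact: ole_LR h.
  by left; apply: ole_LL => n; case: (IH n b) => // /h.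
Qed.

(* Limits are required to be strictly increasing, which rules out degenerate trees such as [OL (fun=> a)]. *)
Fixpoint proper (a : ord) : Prop :=
  match a with
  | OZ => True
  | OS b => proper b
  | OL f => (forall n, proper (f n)) /\ (forall n, olt (f n) (f n.+1))
  end.

Lemma wf_proper a : wf_ord a -> proper a.
Proof. by elim: a => //= f IH [h1 [h2 _]]; split=> // n; exact: IH. Qed.

Lemma ole_homo f : (forall n, ole (f n) (f n.+1)) -> forall i j, (i <= j)%N -> ole (f i) (f j).
Proof.
move=> h i j; elim: j => [|j IH]; first by rewrite leqn0 => /eqP ->; exact: ole_refl.
rewrite leq_eqVlt => /orP[/eqP->|/IH/ole_trans]; [exact: ole_refl|apply; exact: h].
Qed.

Fixpoint oadd (a b : ord) : ord :=
  match b with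
  | OZ => a
  | OS c => OS (oadd a c)
  | OL f => OL (fun n => oadd a (f n))
  end.

Lemma oadd_l a b : ole a (oadd a b).
Proof.
elim: b => [|b IH|f IH] /=; [exact: ole_refl|exact: ole_SR|].
exact: (@ole_LR _ _ 0%N).
Qed.

Lemma oadd_r a b : ole b (oadd a b).
Proof.
elim: b => [|b IH|f IH] /=; [exact: ole_Z|exact: ole_SS|].
by apply: ole_LL => n; apply: (@ole_LR _ _ n).
Qed.

Lemma oadd_mono a b c : ole b c -> ole (oadd a b) (oadd a c).
Proof.
elim=> {b c} [b|b c _ IH|b c _ IH|b f n _ IH|f b _ IH] /=.
- exact: oadd_l.
- exact: ole_SR.
- exact: ole_SS.
- exact: (@ole_LR _ _ n).
- exact: ole_LL.
Qed.

Lemma oadd_proper a b : proper a -> proper b -> proper (oadd a b).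
Proof.
move=> pa; elim: b => [//|b IH|f IH] //= [h1 h2]; split=> n; first exact: IH.
exact: (oadd_mono a (h2 n)).
Qed.

(** Left subtraction, with equality replaced by [ole] in both directions. It brings every order
    above zeta to the form [oadd z eta], on which block estimates can be proved by induction. *)
Lemma osub a b : ole a b -> exists c, ole (oadd a c) b /\ ole b (oadd a c).
Proof.
elim: b => [|b IH|f IH] h.
- by exists OZ; split=> //; exact: ole_Z.
- have [/IH[c [h1 h2]]|h'] := ole_total a b; first by exists (OS c); split; exact: ole_SS.
  by exists OZ.
- have [[n0 h0]|/forallNP hn] := EM (exists n, ole a (f n)); last first.
    exists OZ; split=> //=; apply: ole_LL => n.
    by case: (ole_total a (f n)) => [/hn//|/ole_S_inv].
  have hc n : exists c, ole (oadd a c) (OL f) /\ ole (f n) (oadd a c).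
    have [/IH[c [h1 h2]]|h'] := ole_total a (f n).
      by exists c; split=> //; exact: ole_LR h1.
    by exists OZ; split=> //=; exact: ole_S_inv.
  have [c {}hc] := choice hc.
  exists (OL c); split=> /=; first by apply: ole_LL => n; case: (hc n).
  by apply: ole_LL => n; apply: (@ole_LR _ _ n); case: (hc n).
Qed.

(** A bare supremum need not be [proper]; partial sums with a successor added at each step make the
    fundamental sequence strictly increasing. *)
Lemma osup (g : nat -> ord) : (forall n, proper (g n)) ->
  exists f, proper (OL f) /\ forall n, ole (g n) (f n).
Proof.
move=> pg; pose f := fix f n := if n is m.+1 then oadd (f m) (OS (g n)) else g 0%N.
exists f; split; last by case=> [|n] /=; [exact: ole_refl|exact: ole_SR (oadd_r _ _)].
split=> n; last by rewrite /olt; apply: ole_SS; exact: oadd_l.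
by elim: n => [|n IH] /=; [|exact: oadd_proper].
Qed.

(** * Comparison of [Sch] with [Schr] *)

Lemma fam_compE F E : fam_comp schreier F E <-> comp S F E.
Proof.
split=> [[->|[Es [e1 [e2 [e3 e4]]]]]|[Es [e1 e2 e3 e4]]]; first exact: comp_nil.
- exists Es; split=> //; move: e4; rewrite /schreier size_map -e1.
  by case: Es e1 e2 e3 => [|[|x e] Es].
- right; exists Es; split=> //; split=> //; split=> //; move: e4.
  by rewrite /schreier size_map -e1; case: Es e1 e2 e3 => [|[|x e] Es].
Qed.

Lemma Sch_nil a : Sch a [::].
Proof. by elim: a => [|b _|f IH] /=; by left. Qed.

Lemma Sch_chain f i j E : wf_ord (OL f) -> (i <= j)%N -> sorted ltn E ->
  Sch (f i) E -> Sch (f j) E.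
Proof.
move=> [_ [_ h]] + sE hE; elim: j => [|j IH]; first by rewrite leqn0 => /eqP <-.
rewrite leq_eqVlt => /orP[/eqP<-//|/IH{}hE]; apply: h sE _.
by apply/fam_compE; exact: size1_comp.
Qed.

(** The limit clause uses the successor of the term at min E, and the nesting in [wf_ord] puts that
    inside the next term. *)
Lemma Sch_L f E : wf_ord (OL f) -> sorted ltn E -> Sch (OL f) E -> Sch (f (head 0%N E).+1) E.
Proof. by move=> [_ [_ h]] sE hE; exact: h. Qed.

Lemma Sch_spreading a : wf_ord a -> spreading (Sch a).
Proof.
elim: a => [|b IH|f IH] wf.
- move=> m n _ _ sz _ h; have {h} : (size n <= 1)%N.
    by rewrite -sz; case: h => [->|[k ->]].
  by case: n {sz} => [|x [|//]] _; [left|right; exists x].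
- move=> m n sm sn sz le /= /fam_compE h; apply/fam_compE.
  by apply: (comp_spreading _ (IH wf) sm sn sz le h) => i j.
- move=> m n sm sn sz le /= /fam_compE h; apply/fam_compE.
  have hh : (head 0 m <= head 0 n)%N.
    by case: m n sz le {sm sn h} => [|x m] [|y n] //= _ /(_ 0%N isT).
  have : comp S (Sch (f (head 0%N n))) m.
    apply: compW h => // e se; apply: Sch_chain => //.
    exact: sorted_subseq_ltn se sm.
  by apply: (comp_spreading _ (IH _ (wf.1 _)) sm sn sz le) => i j.
Qed.

Lemma Sch_emb a : wf_ord a -> emb (Sch a) (Schr a).
Proof.
elim: a => [_|b IH wf|f IH wf].
- by exists id; split=> // E _ [->|[n ->]].
- have [p [sp hp]] := IH wf; exists p; split=> // E sE /= /fam_compE.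
  by apply: comp_map => //; rewrite ltnS; exact: sincr_ge.
- have [P hP] := choice (fun n => IH n (wf.1 n)).
  have [p [sp hp]] := diag_sincr P.
  exists (addn 1 \o p); split; first exact: sincr_comp (sincr_addn 1) sp.
  move=> E sE /(Sch_L wf sE) h; have [->|ne] := eqVneq E [::]; first exact: Schr_nil.
  exists (head 0%N E).+1; rewrite head_map_sincr //= add1n ltnS sincr_ge //; split=> //.
  have [sP {}hP] := hP (head 0%N E).+1.
  apply: (spreading_map (@Schr_spreading _) sE sP _ _ (hP _ sE h)).
    exact: sincr_comp (sincr_addn 1) sp.
  move=> i hi /=; rewrite add1n leqW //; apply: hp.
  by rewrite ltnS head_le_mem.
Qed.

Lemma Schr_emb a : wf_ord a -> emb (Schr a) (Sch a).
Proof.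
elim: a => [_|b IH wf|f IH wf].
- by exists id; split=> // -[|x [|//]] _ _; [left|right; exists x].
- have [p [sp hp]] := IH wf; exists p; split=> // E sE /= h; apply/fam_compE.
  by move: h; apply: comp_map => //; rewrite ltnS; exact: sincr_ge.
- have [P hP] := choice (fun n => IH n (wf.1 n)).
  have [p [sp hp]] := diag_sincr P; exists p; split=> // E sE [n [hn hE]].
  have [->|ne] := eqVneq E [::]; first exact: Sch_nil.
  have [sP {}hP] := hP n; apply/fam_compE; apply: size1_comp => //.
  rewrite head_map_sincr //; apply: (@Sch_chain f n) => //.
  + by rewrite (leq_trans hn) // sincr_ge.
  + exact: sorted_map_sincr.
  apply: (spreading_map (Sch_spreading (wf.1 n)) sE sP _ _ (hP _ sE hE)) => // i hi.
  by apply: hp; rewrite (leq_trans hn) // leqW // head_le_mem.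
Qed.

(** * Dichotomy, and convex combinations with small Schreier norm *)

Lemma sorted_extend (E : seq nat) : sorted ltn E ->
  exists q, strictly_incr q /\ mkseq q (size E) = E.
Proof.
move=> sE; pose b := (\max_(x <- E) x).+1.
exists (fun i => if (i < size E)%N then nth 0%N E i else (b + i)%N); split.
  move=> i; case: (ltnP i.+1 (size E)) => h1; last case: (ltnP i (size E)) => h2.
  - have := sorted_ltn_nth ltn_trans 0%N sE i i.+1; rewrite !inE ltnW //.
    by move=> ->.
  - rewrite ltn_addr // /b ltnS; apply: leq_bigmax_seq => //; exact: mem_nth.
  - by lia.
apply: (@eq_from_nth _ 0%N); rewrite size_mkseq // => i hi.
by rewrite nth_mkseq // hi.
Qed.

(** Nash-Williams is applied to the sets having an initial segment that is last in F and belongs to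
    T. If all subsets have one, a member of F extends to such a segment and so lies in T. If none
    has, a member of T outside F would produce one through its longest prefix in F. *)
Lemma dichotomy F T L : hereditary F -> F [::] -> hereditary T -> strictly_incr L ->
  exists p, strictly_incr p /\
   ((forall E, sorted ltn E -> T (map (L \o p) E) -> F (map (L \o p) E)) \/
    (forall E, sorted ltn E -> F (map (L \o p) E) -> T (map (L \o p) E))).
Proof.
move=> hF F0 hT sL.
pose O s := exists k, [/\ (k < size s)%N, F (take k s), ~ F (take k.+1 s) & T (take k s)].
have Oext s t : O s -> O (s ++ t).
  move=> [k [h1 h2 h3 h4]]; exists k; rewrite size_cat ltn_addr //.
  by rewrite !takel_cat // ltnW.
have [p [sp hp]] := nash_williams Oext sL; exists p; split=> //.
have sM := sincr_comp sL sp; set M := L \o p in sM hp *.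
have tk (q : nat -> nat) j n : (j <= n)%N -> take j (mkseq q n) = mkseq q j.
  by move=> h; rewrite /mkseq -map_take take_iota (minn_idPl h).
case: hp => hp; [right|left] => E sE.
  have [q [sq qE]] := sorted_extend sE.
  have EE : map M E = mkseq (M \o q) (size E) by rewrite -[in LHS]qE -map_comp.
  have sMq := sincr_comp sM sq.
  have [n [k [+ h2 h3 h4]]] := hp q sq; rewrite size_mkseq => h1.
  rewrite EE => FE; case: (leqP (size E) k) => h.
    apply: (hered_prefix hT sMq h); by rewrite tk in h4; last exact: ltnW.
  by case: h3; rewrite tk //; exact: hered_prefix FE.
move=> TE; apply: contrapT => nF.
have [q [sq qE]] := sorted_extend sE.
have EE : map M E = mkseq (M \o q) (size E) by rewrite -[in LHS]qE -map_comp.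
have sMq := sincr_comp sM sq.
have ex : exists k, `[< ~ F (mkseq (M \o q) k) >].
  by exists (size E); apply/asboolP; rewrite -EE.
case: (ex_minnP ex) => [[|k]] /asboolP nk mink; first by apply: nk; exact: F0.
have kE : (k < size E)%N by apply: mink; apply/asboolP; rewrite -EE.
apply: (hp q (size E) sq); exists k; rewrite size_mkseq !tk //; last exact: ltnW.
split=> //; last by rewrite EE in TE; apply: hered_prefix TE => //; exact: ltnW.
by apply: contrapT => /asboolP/mink; rewrite ltnn.
Qed.

Lemma sorted_ltn_cat (s t : seq nat) : sorted ltn s -> sorted ltn t ->
  (forall i j, i \in s -> j \in t -> (i < j)%N) -> sorted ltn (s ++ t).
Proof.
rewrite !(sorted_pairwise ltn_trans) pairwise_cat => -> -> h; rewrite !andbT.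
by apply/allrelP => i j; exact: h.
Qed.

Lemma sorted_ltn_cat_lt (s t : seq nat) i j : sorted ltn (s ++ t) ->
  i \in s -> j \in t -> (i < j)%N.
Proof.
rewrite (sorted_pairwise ltn_trans) pairwise_cat => /and3P[/allrelP h _ _].
exact: h.
Qed.

(** The property of repeated averages: G carries probability vectors nearly invisible to H.
    Quantifying over [p] makes it stable under re-indexing of H, see [SM_emb]. *)
Definition SM (G H : fam) := forall p, strictly_incr p -> forall eps : RR, 0 < eps ->
  exists F a, [/\ sorted ltn F, G F, (forall i, 0 <= a i), \sum_(i <- F) a i = 1 &
    forall E, sorted ltn E -> H E -> \sum_(i <- F | p i \in E) a i <= eps].

Lemma sum_sub_le (I : eqType) (F : seq I) (P : pred I) (a : I -> RR) : (forall i, 0 <= a i) ->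
  \sum_(i <- F | P i) a i <= \sum_(i <- F) a i.
Proof.
move=> a0; rewrite [leRHS](bigID P) /= lerDl; exact: sumr_ge0.
Qed.

Lemma SM_emb G H H' : SM G H -> emb H' H -> SM G H'.
Proof.
move=> sm [q [sq hq]] p sp e e0; have [F [a [h1 h2 h3 h4 h5]]] := sm _ (sincr_comp sq sp) e e0.
exists F, a; split=> // E sE HE.
apply: le_trans (h5 _ (sorted_map_sincr sq sE) (hq _ sE HE)).
rewrite (eq_bigl (fun i => q (p i) \in map q E)) // => i.
by rewrite mem_map //; exact: sincr_inj.
Qed.

Lemma SM_shift G H p (eps : RR) K : spreading G -> SM G H -> strictly_incr p -> 0 < eps ->
  exists F a, [/\ sorted ltn F, G F, (forall i, i \in F -> (K <= i)%N), (forall i, 0 <= a i)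
    & \sum_(i <- F) a i = 1 /\
    forall E, sorted ltn E -> H E -> \sum_(i <- F | p i \in E) a i <= eps].
Proof.
move=> sG sm sp e0.
have [F [a [h1 h2 h3 h4 h5]]] := sm _ (sincr_comp sp (sincr_addn K)) eps e0.
have aK i : a ((K + i) - K)%N = a i by rewrite addKn.
exists (map (addn K) F), (fun i => a (i - K)%N); split.
- exact: sorted_map_sincr (sincr_addn K) h1.
- exact: spreading_sincr sG h1 (sincr_addn K) h2.
- by move=> i /mapP[j _ ->]; exact: leq_addr.
- by [].
split; first by rewrite big_map -h4; apply: eq_bigr => i _; exact: aK.
move=> E sE HE; apply: le_trans (h5 E sE HE); rewrite big_map /=.
by under eq_bigr do rewrite aK.
Qed.

(** The form of smallness that survives inside a single order: a set of [Schr c] could contain the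
    whole support, so only test sets starting at or before K are considered, while the support
    starts after K. *)
Definition Pre (c : ord) := forall p, strictly_incr p -> forall K (eps : RR), 0 < eps ->
  exists F a, [/\ sorted ltn F, Schr c F, (forall i, i \in F -> (K < i)%N), (forall i, 0 <= a i)
    & \sum_(i <- F) a i = 1 /\
    forall E, sorted ltn E -> Schr c E -> (head 0%N E <= K)%N ->
      \sum_(i <- F | p i \in E) a i <= eps].

(* Once [E] meets the first block its minimum is bounded, so the later blocks are small on [E]. *)
Lemma Pre_blocks c N : Pre c -> forall p, strictly_incr p -> forall K (tau : RR), 0 < tau ->
  exists Fs a, [/\ sorted ltn (flatten Fs), size Fs = N,
      all (fun e => e != [::]) Fs, (forall e, e \in Fs -> Schr c e)
    & [/\ (forall i, i \in flatten Fs -> (K < i)%N), (forall i, 0 <= a i),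
      \sum_(i <- flatten Fs) a i = N%:R &
    forall E, sorted ltn E -> Schr c E ->
      \sum_(i <- flatten Fs | p i \in E) a i <= 2 /\
      ((head 0%N E <= K)%N -> \sum_(i <- flatten Fs | p i \in E) a i <= tau)]].
Proof.
move=> pre p sp; elim: N => [|N IH] K tau t0.
  exists [::], (fun=> 0); split=> //; split=> //=; first by rewrite big_nil.
  by move=> E _ _; rewrite big_nil; split=> // _; exact: ltW.
have t20 : 0 < tau / 2 by lra.
have [F [a [f1 f2 f3 f4 [f5 f6]]]] := pre p sp K (tau / 2) t20.
pose K' := maxn K (\max_(i <- F) p i).
pose tau' := Num.min (tau / 2) 1.
have t'0 : 0 < tau' by rewrite lt_min t20 ltr01.
have [Fs [b [g1 g2 g3 g4 [g5 g6 g7 g8]]]] := IH K' tau' t'0.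
have pK i : i \in F -> (p i <= K')%N.
  by move=> hi; rewrite /K' leq_max; apply/orP; right; exact: leq_bigmax_seq.
have FK i j : i \in F -> j \in flatten Fs -> (i < j)%N.
  move=> hi /g5; apply: leq_ltn_trans; exact: leq_trans (sincr_ge i sp) (pK i hi).
pose ab i := if i \in F then a i else b i.
have abF (P : pred nat) : \sum_(i <- F | P i) ab i = \sum_(i <- F | P i) a i.
  by rewrite big_seq_cond [RHS]big_seq_cond; apply: eq_bigr => i /andP[hi _]; rewrite /ab hi.
have abFs (P : pred nat) :
    \sum_(i <- flatten Fs | P i) ab i = \sum_(i <- flatten Fs | P i) b i.
  rewrite big_seq_cond [RHS]big_seq_cond; apply: eq_bigr => i /andP[hi _]; rewrite /ab.
  by case: ifP => // /FK/(_ hi); rewrite ltnn.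
have Fne : F != [::] by apply/eqP => e; move: f5; rewrite e big_nil => /eqP; rewrite eq_sym oner_eq0.
exists (F :: Fs), ab; split=> /=.
- exact: sorted_ltn_cat.
- by rewrite g2.
- by rewrite Fne.
- by move=> e; rewrite inE => /orP[/eqP->//|]; exact: g4.
split.
- move=> i; rewrite mem_cat => /orP[/f3//|/g5]; apply: leq_ltn_trans.
  exact: leq_maxl.
- by move=> i; rewrite /ab; case: ifP.
- by rewrite big_cat /= abF abFs f5 g7 -natr1 addrC.
move=> E sE cE; rewrite big_cat /= abF abFs.
have [g81 g82] := g8 E sE cE; split; last first.
  move=> hK; have h1 := f6 E sE cE hK.
  have h2 : \sum_(i <- flatten Fs | p i \in E) b i <= tau / 2.
    apply: le_trans (g82 _) _; last by rewrite ge_min lexx.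
    by rewrite /K' leq_max hK.
  by lra.
(* The constant 2: if [E] meets the first block, that block gives at most 1 and all later ones
   together at most [tau'], which is at most 1. *)
case: (boolP (has (fun i => p i \in E) F)) => [/hasP[i iF piE]|nh].
  have h1 : \sum_(i <- F | p i \in E) a i <= 1 by rewrite -f5; exact: sum_sub_le.
  have h2 : \sum_(i <- flatten Fs | p i \in E) b i <= 1.
    apply: le_trans (g82 _) _; last by rewrite ge_min lexx orbT.
    by apply: leq_trans (pK i iF); exact: head_le_mem.
  by lra.
rewrite big_hasC // add0r; exact: g81.
Qed.

(** Averaging N+1 blocks placed beyond N+1: their union is admissible for the successor, while a set
    of order c sees a total of at most 2 before division by N+1. *)
Lemma Pre_SM_succ c : Pre c -> SM (Schr (OS c)) (Schr c).
Proof.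
move=> pre p sp e e0.
have [N hN] : exists N : nat, 2 / e < N.+1%:R.
  exists (Num.truncn (2 / e)); apply: truncnS_gt.
have [Fs [a [g1 g2 g3 g4 [g5 g6 g7 g8]]]] := @Pre_blocks c N.+1 pre p sp N.+1 1 ltr01.
have N0 : (0 : RR) < N.+1%:R by rewrite ltr0n.
exists (flatten Fs), (fun i => a i / N.+1%:R); split=> //.
- exists Fs; split=> //; rewrite g2 ltnW // ltnS ltnW // g5 //.
  rewrite head_mem //; case: Fs g2 g3 {g1 g4 g5 g7 g8} => [//|[//|x f] Fs] _ _ //.
- by move=> i; rewrite divr_ge0.
- by rewrite -big_distrl /= g7 divff // gt_eqF.
- move=> E sE cE; rewrite -big_distrl /= ler_pdivrMr //.
  have [h _] := g8 E sE cE; apply: le_trans h _.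
  by rewrite mulrC -ler_pdivrMr // ltW.
Qed.

Lemma comp_sum_le K c (p : nat -> nat) F (a : nat -> RR) eps E : (forall i, 0 <= a i) ->
  (forall e, sorted ltn e -> Schr c e -> \sum_(i <- F | p i \in e) a i <= eps) ->
  sorted ltn E -> comp (fun=> K) (Schr c) E -> \sum_(i <- F | p i \in E) a i <= K%:R * eps.
Proof.
move=> a0 h sE [Es [e1 _ e3 e4]].
have e0 : 0 <= eps.
  by apply: le_trans (h [::] isT (Schr_nil c)); exact: sumr_ge0.
apply: (@le_trans _ _ ((size Es)%:R * eps)); last by rewrite ler_wpM2r // ler_nat.
move: sE e3; rewrite -e1; elim: Es {e1 e4} => [|e Es IH] sE e3 /=.
  by rewrite mul0r big_pred0.
have [s1 s2] := cat_sorted2 sE.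
have h1 : \sum_(i <- F | p i \in e) a i <= eps by apply: h => //; apply: e3; rewrite mem_head.
have h2 : \sum_(i <- F | p i \in flatten Es) a i <= (size Es)%:R * eps.
  by apply: IH => // e' he; apply: e3; rewrite inE he orbT.
rewrite -natr1 mulrDl mul1r addrC.
apply: (@le_trans _ _ (\sum_(i <- F | p i \in e) a i + \sum_(i <- F | p i \in flatten Es) a i)).
  rewrite [leLHS]big_mkcond [X in _ <= X + _]big_mkcond [X in _ <= _ + X]big_mkcond -big_split /=.
  apply: ler_sum => i _; rewrite mem_cat.
  by case: (p i \in e); case: (p i \in flatten Es); rewrite ?addr0 ?add0r ?lerDl.
exact: lerD.
Qed.

(** The two statements feed each other. [Pre] at c gives [SM] at its successor; conversely, a set of
    [Schr (OS b)] starting at or before K is a union of at most K+1 sets of order b, each caught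
    with mass at most eps/(K+1). *)
Lemma SM_Pre b : proper b -> (forall c, olt c b -> SM (Schr b) (Schr c)) /\ Pre b.
Proof.
elim: b => [_|b IH pb|f IH [pf lf]].
- split; first by move=> c /olt_Z_inv.
  move=> p sp K e e0; exists [:: K.+1], (fun=> 1); split=> //.
    by move=> i; rewrite inE => /eqP->.
  split=> [|E sE cE hK]; first by rewrite big_seq1.
  rewrite big_seq_cond big_pred0 ?(ltW e0) // => i; rewrite inE.
  apply/negP => /andP[/eqP-> h]; move: cE hK h; case: E {sE} => [|x [|//]] //= _ hK.
  by rewrite inE => /eqP pe; have := sincr_ge K.+1 sp; lia.
- have [IH1 IH2] := IH pb.
  have sm := Pre_SM_succ IH2; split.
    by move=> c /ole_SS_inv/ole_emb; exact: SM_emb.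
  move=> p sp K e e0.
  have e'0 : 0 < e / K.+1%:R by rewrite divr_gt0 // ltr0n.
  have [F [a [f1 f2 f3 f4 [f5 f6]]]] :=
    SM_shift K.+1 (@Schr_spreading (OS b)) sm sp e'0.
  exists F, a; split=> //; split=> // E sE cE hK.
  have -> : e = K.+1%:R * (e / K.+1%:R).
    by rewrite mulrC divfK // pnatr_eq0.
  apply: comp_sum_le sE _ => //; first exact: f6.
  exact: compW cE.
- have smL c n : olt c (f n) -> SM (Schr (OL f)) (Schr c).
    move=> /(IH n (pf n)).1 sm p sp e e0.
    have [F [a [f1 f2 f3 f4 [f5 f6]]]] := SM_shift n (@Schr_spreading (f n)) sm sp e0.
    exists F, a; split=> //; exists n; split=> //; apply: f3; apply: head_mem.
    by apply/eqP => F0; move: f5; rewrite F0 big_nil => /eqP; rewrite eq_sym oner_eq0.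
  split; first by move=> c /olt_L_inv[n]; exact: smL.
  move=> p sp K e e0.
  (* At a limit, test sets starting at or before K come from the terms up to [f K]. All of these
     embed into [f K], over which [f K.+1] already has small averages. *)
  have h n : (n <= K)%N -> emb (Schr (f n)) (Schr (f K)).
    move=> h; apply: ole_emb; apply: (ole_homo _ h) => i; exact: ole_S_inv (lf i).
  have /choice[P hP] : forall n, exists q, strictly_incr q /\ ((n <= K)%N ->
      forall E, sorted ltn E -> Schr (f n) E -> Schr (f K) (map q E)).
    by move=> n; case: (leqP n K) => [/h[q []]|_]; [exists q|exists id; split=> // i].
  pose q i := (\sum_(n < K.+1) P n i + i)%N.
  have sq : strictly_incr q.
    move=> i; rewrite /q addnS ltnS leq_add2r; apply: leq_sum => n _.
    by have [sn _] := hP n; exact/ltnW/sn.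
  have hq n E : (n <= K)%N -> sorted ltn E -> Schr (f n) E -> Schr (f K) (map q E).
    move=> nK sE hE; have [sn /(_ nK _ sE hE) {}hn] := hP n.
    apply: spreading_map hn => //; first exact: Schr_spreading.
    move=> i _; rewrite /q; move: nK; rewrite -ltnS => nK.
    by rewrite (bigD1 (Ordinal nK)) //= -addnA leq_addr.
  have sm := (IH K.+1 (pf K.+1)).1 _ (lf K).
  have [F [a [f1 f2 f3 f4 [f5 f6]]]] :=
    SM_shift K.+1 (@Schr_spreading (f K.+1)) sm (sincr_comp sq sp) e0.
  exists F, a; split=> //; last split=> // E sE [n [nE hE]] hK.
    exists K.+1; split=> //; apply: f3; apply: head_mem.
    by apply/eqP => F0; move: f5; rewrite F0 big_nil => /eqP; rewrite eq_sym oner_eq0.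
  apply: le_trans (f6 _ (sorted_map_sincr sq sE) (hq n E (leq_trans nE hK) sE hE)).
  rewrite (eq_bigl (fun i => q (p i) \in map q E)) // => i.
  by rewrite mem_map //; exact: sincr_inj.
Qed.

(** * Chains of families approximating a Schreier family *)

(** Each [Q n] is secured along a nested chain of subsequences, and the diagonal lies in the [n]-th
    one from position n on. The growth condition [u] is added so that spreading arguments can be run
    on the diagonal. *)
Lemma diagonalize (Q : nat -> (nat -> nat) -> Prop) L (u : nat -> nat) :
  (forall n L', strictly_incr L' -> exists p, strictly_incr p /\ Q n (L' \o p)) ->
  strictly_incr L ->
  exists p (M : nat -> nat -> nat), [/\ strictly_incr p, forall i, (u i <= L (p i))%N,
    forall n, strictly_incr (M n) /\ Q n (M n) &
    forall n E, sorted ltn E -> (forall i, i \in E -> (n <= i)%N) ->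
      exists D, sorted ltn D /\ map (L \o p) E = map (M n) D].
Proof.
move=> step sL.
have [P hP] : exists P : nat -> (nat -> nat) -> nat -> nat, forall n L', strictly_incr L' ->
    strictly_incr (P n L') /\ Q n (L' \o P n L').
  have h n L' : exists p, strictly_incr L' -> strictly_incr p /\ Q n (L' \o p).
    have [/(step n)[p hp]|ns] := EM (strictly_incr L'); first by exists p.
    by exists id.
  by exists (fun n => projT1 (choice (h n))) => n; exact: projT2 (choice (h n)).
pose G := fix G n := if n is m.+1 then G m \o P n (L \o G m) else P 0%N L.
have sG n : strictly_incr (G n) /\ Q n (L \o G n).
  elim: n => [|n [IH _]]; first exact: hP.
  have [h1 h2] := hP n.+1 _ (sincr_comp sL IH); split=> //=; exact: sincr_comp.
have Gdec n m i : (n <= m)%N -> exists j, G m i = G n j.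
  move=> nm; rewrite -(subnKC nm); elim: (m - n)%N i => [|d IH] i.
    by exists i; rewrite addn0.
  by rewrite addnS /=; exact: IH.
pose v n x := (x + u n)%N.
pose p := fix p n := if n is m.+1 then G n (v n (p m).+1) else G 0%N (v 0%N 0%N).
have pS n : p n.+1 = G n.+1 (v n.+1 (p n).+1) by [].
have pG n : exists x, p n = G n (v n x).
  by case: n => [|n]; [exists 0%N|exists (p n).+1].
have sp : strictly_incr p.
  move=> n; rewrite pS; apply: leq_trans (sincr_ge _ (sG n.+1).1).
  by rewrite /v leq_addr.
exists p, (fun n => L \o G n); split=> //.
- move=> i; apply: leq_trans (sincr_ge _ sL); have [x ->] := pG i.
  by apply: leq_trans (sincr_ge _ (sG i).1); rewrite /v leq_addl.
- by move=> n; have [h1 h2] := sG n; split=> //; exact: sincr_comp.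
move=> n E sE nE.
have /choice[r hr] : forall i, exists j, (n <= i)%N -> p i = G n j.
  move=> i; case: (leqP n i) => h; last by exists 0%N.
  have [x ->] := pG i; have [j ej] := Gdec n i (v i x) h; by exists j.
have e1 : map p E = map (G n) (map r E).
  by rewrite -map_comp; apply/eq_in_map => i iE /=; rewrite hr // nE.
exists (map r E); split; last by rewrite (map_comp L p) e1 (map_comp L (G n)).
have : sorted ltn (map (G n) (map r E)) by rewrite -e1 sorted_map_sincr.
rewrite sorted_map; apply: sub_sorted => i j /=.
by rewrite sincr_ltE //; case: (sG n).
Qed.

(** One ladder for both kinds of xi: for a successor it is constant and n+1 pieces are used; for a
    limit it is a tail of the fundamental sequence and one piece suffices. Later arguments need not
    distinguish the cases. *)
Lemma approx z xi : proper xi -> olt z xi -> exists g : nat -> ord,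
  [/\ forall n, proper (g n), forall i j, (i <= j)%N -> ole (g i) (g j),
      forall n, olt (g n) xi, forall n, ole z (g n) &
      (forall b, olt b xi -> exists n, ole b (g n)) /\
      exists q, strictly_incr q /\ forall E, sorted ltn E -> Schr xi E ->
        exists n, (n <= head 0%N E)%N /\ comp (fun=> n.+1) (Schr (g n)) (map q E)].
Proof.
case: xi => [_ /olt_Z_inv//|b pb /ole_SS_inv zb|f [pf lf] /olt_L_inv[n0 zf]].
- exists (fun=> b); split=> //.
  + by move=> i j _; exact: ole_refl.
  + by move=> _; exact: ole_refl.
  split; first by move=> c /ole_SS_inv; exists 0%N.
  exists id; split=> // E sE hE; exists (head 0%N E); split=> //.
  by rewrite map_id; exact: compW hE.
- have fh i j : (i <= j)%N -> ole (f i) (f j).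
    by apply: ole_homo => n; exact: ole_S_inv (lf n).
  exists (fun n => f (n0 + n)%N); split.
  + by move=> n; exact: pf.
  + by move=> i j h; apply: fh; rewrite leq_add2l.
  + by move=> n; exact: ole_LR (lf _).
  + by move=> n; apply: ole_trans (ole_S_inv zf) (fh _ _ _); exact: leq_addr.
  split.
    move=> b /olt_L_inv[n /ole_S_inv h]; exists n; apply: ole_trans h (fh _ _ _).
    exact: leq_addl.
  have [P hP] := choice (fun n => ole_emb (fh n (n0 + n)%N (leq_addl _ _))).
  have [q [sq hq]] := diag_sincr P; exists q; split=> // E sE [n [hn hE]].
  exists n; split=> //; apply: size1_comp => //.
  have [sP {}hP] := hP n.
  apply: (spreading_map (@Schr_spreading _) sE sP sq _ (hP _ sE hE)) => i hi.
  by apply: hq; rewrite (leq_trans hn) // leqW // head_le_mem.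
Qed.

(** Counting mass: 2(n+1)+1 blocks of unit mass are built by [Pre_blocks], and n+1 sets of order c,
    each catching at most 2, cover at most 2(n+1). *)
Lemma blocks_not_emb b c c' n p : proper b -> ole b c' -> ole c b -> strictly_incr p ->
  exists F, [/\ sorted ltn F, comp (fun=> (2 * n.+1).+1) (Schr c') F &
    ~ comp (fun=> n.+1) (Schr c) (map p F)].
Proof.
move=> pb /ole_emb[r [sr hr]] /ole_emb[s [ss hs]] sp.
have st := sincr_comp ss (sincr_comp sp sr).
have [Fs [a [g1 g2 g3 g4 [g5 g6 g7 g8]]]] :=
  @Pre_blocks b (2 * n.+1).+1 (SM_Pre pb).2 _ st 0%N 1 ltr01.
have cF : comp (fun=> (2 * n.+1).+1) (Schr b) (flatten Fs) by exists Fs; split=> //; rewrite g2.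
exists (map r (flatten Fs)); split; first exact: sorted_map_sincr.
  exact: comp_map cF.
move=> h; have := comp_map (sorted_map_sincr sp (sorted_map_sincr sr g1)) _ hs h.
move=> /(_ (fun=> n.+1) (leqnn _)); rewrite -!map_comp => h'.
have := comp_sum_le g6 (fun e se he => (g8 e se he).1) (sorted_map_sincr st g1) h'.
rewrite big_seq_cond (eq_bigl (fun i => i \in flatten Fs)); last first.
  by move=> i; case: (boolP (i \in flatten Fs)) => //= iF; rewrite map_f.
by rewrite -big_seq g7 -natrM ler_nat mulnC ltnn.
Qed.

Lemma SM_fin G d (c : nat -> ord) n0 : SM G (Schr d) -> (forall n, (n < n0)%N -> ole (c n) d) ->
  forall p, strictly_incr p -> forall eps : RR, 0 < eps ->
  exists F a, [/\ sorted ltn F, G F, (forall i, 0 <= a i), \sum_(i <- F) a i = 1 &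
    forall n E, (n < n0)%N -> sorted ltn E -> Schr (c n) E ->
      \sum_(i <- F | p i \in E) a i <= eps].
Proof.
move=> sm hc p sp e e0.
have /choice[P hP] : forall n, exists q, strictly_incr q /\ ((n < n0)%N ->
    forall E, sorted ltn E -> Schr (c n) E -> Schr d (map q E)).
  move=> n; case: (ltnP n n0) => [/hc/ole_emb[q []]|_]; first by exists q.
  by exists id; split=> // i.
have [q [sq hq]] := diag_sincr (fun j i => \sum_(n < n0) P n i)%N.
have hq' n E : (n < n0)%N -> sorted ltn E -> Schr (c n) E -> Schr d (map q E).
  move=> nn sE hE; have [sn /(_ nn _ sE hE) {}hn] := hP n.
  apply: spreading_map hn => //; first exact: Schr_spreading.
  move=> i _; apply: leq_trans (hq 0%N i _) => //.
  by rewrite (bigD1 (Ordinal nn)) //= leq_addr.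
have [F [a [f1 f2 f4 f5 f6]]] := sm _ (sincr_comp sq sp) e e0.
exists F, a; split=> // n E nn sE hE.
apply: le_trans (f6 _ (sorted_map_sincr sq sE) (hq' n E nn sE hE)).
rewrite (eq_bigl (fun i => q (p i) \in map q E)) // => i.
by rewrite mem_map //; exact: sincr_inj.
Qed.

Section Chain.
Variables (z xi : ord) (g c : nat -> ord).
Hypotheses (pxi : proper xi) (gh : forall i j, (i <= j)%N -> ole (g i) (g j))
  (gxi : forall n, olt (g n) xi) (zg : forall n, ole z (g n))
  (cg : forall n, ole (c n) (g n)).

(** Level 0 is [Schr z], which makes the formal identity into the Schreier space of order z bounded.
    The remaining levels climb towards xi at a speed set by [N]. *)
Definition chain (N : nat -> nat) (k : nat) : fam :=
  if k is j.+1 then comp (fun=> (N j).+1) (Schr (c (N j))) else Schr z.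

Lemma chain_hered N k : hereditary (chain N k).
Proof.
case: k => [|k]; first exact: Schr_hered.
by apply: comp_hered => //; exact: Schr_hered.
Qed.

Lemma chain_regular N k : regular (chain N k) /\ has_singletons (chain N k).
Proof.
case: k => [|k]; first by split; [exact: Schr_regular|move=> n; exact: Schr1].
split; last by move=> n; apply: size1_comp => //; exact: Schr1.
have h : hereditary (chain N k.+1) by exact: chain_hered.
split=> //; split.
  by apply: comp_spreading => //; exact: Schr_spreading.
by apply: wfd_compact => //; apply: comp_wfd; [exact: Schr_hered|exact: Schr_wfd].
Qed.

(** This makes unit vectors xi-weakly null: finitely many levels are finite unions of sets of orders
    below xi, and [Schr xi] has small averages against such. The index m bounds both the number of
    pieces and the orders. *)
Lemma chain_small N K p (eps : RR) : strictly_incr p -> 0 < eps ->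
  exists F a, [/\ sorted ltn F, Schr xi F, (forall i, 0 <= a i), \sum_(i <- F) a i = 1 &
    forall k E, (k < K)%N -> sorted ltn E -> chain N k E ->
      \sum_(i <- F | p i \in E) a i <= eps].
Proof.
move=> sp e0; pose m := (\max_(k < K) (N k).+1)%N.
have m0 : (0 : RR) < m.+1%:R by rewrite ltr0n.
have [||F [a [f1 f2 f3 f4 f5]]] := @SM_fin (Schr xi) (g m)
    (fun k => if k is j.+1 then c (N j) else z) K.+1 ((SM_Pre pxi).1 _ (gxi m)) _ p sp
    (eps / m.+1%:R).
- case=> [_|k]; first exact: zg.
  rewrite ltnS => hk; apply: ole_trans (cg _) (gh _).
  have hm : ((N k).+1 <= m)%N by exact: (leq_bigmax (Ordinal hk)).
  exact: ltnW.
- by rewrite divr_gt0.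
exists F, a; split=> // -[|k] E kK sE hE.
  apply: le_trans (f5 0%N E isT sE hE) _.
  by rewrite ler_pdivrMr // ler_peMr ?(ltW e0) // ler1n.
have kK' := ltnW kK.
apply: le_trans (comp_sum_le f3 (fun e => f5 k.+1 e (leqW kK)) sE hE) _.
rewrite mulrCA ler_piMr ?(ltW e0) // ler_pdivrMr // mul1r ler_nat.
have hm : ((N k).+1 <= m)%N by exact: (leq_bigmax (Ordinal kK')).
exact: leqW.
Qed.

Hypothesis gc : forall n, ole (g n) (c n).
Hypothesis gap : exists q, strictly_incr q /\ forall E, sorted ltn E -> Schr xi E ->
        exists n, (n <= head 0%N E)%N /\ comp (fun=> n.+1) (Schr (g n)) (map q E).

(** If no level captured T, the dichotomy would place each level inside T along a subsequence; after
    diagonalising, the decomposition [gap] of [Schr xi] would embed all of it into T. *)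
Lemma chain_captures T L : hereditary T -> T [::] -> strictly_incr L -> ~ emb (Schr xi) T ->
  exists p n, strictly_incr p /\ forall E, sorted ltn E -> T (map (L \o p) E) ->
    comp (fun=> n.+1) (Schr (c n)) (map (L \o p) E).
Proof.
move=> hT T0 sL nT; apply: contrapT => /forallNP nC; apply: nT.
have step n M : strictly_incr M -> exists p, strictly_incr p /\
    forall E, sorted ltn E -> comp (fun=> n.+1) (Schr (c n)) (map (L \o (M \o p)) E) ->
      T (map (L \o (M \o p)) E).
  move=> sM.
  have [|p [sp [h|h]]] := @dichotomy (comp (fun=> n.+1) (Schr (c n))) T (L \o M)
    _ (comp_nil _ _) hT (sincr_comp sL sM).
  + by apply: comp_hered => //; exact: Schr_hered.
  + by have /forallNP/(_ n) [] := nC (M \o p); split=> //; exact: sincr_comp.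
  + by exists p.
have [q [sq hq]] := gap.
have [R hR] := choice (fun n => ole_emb (gc n)).
have [r [sr hr]] := diag_sincr R.
(* The growth [r \o q] makes the diagonal dominate the re-indexings of [gap] and of [gc], so both
   are absorbed by spreading. *)
have [p [M [sp ur hM hD]]] := @diagonalize (fun n M => forall E, sorted ltn E ->
    comp (fun=> n.+1) (Schr (c n)) (map (L \o M) E) -> T (map (L \o M) E)) id
    (r \o q) step sincr_id.
exists (L \o p); split; first exact: sincr_comp.
move=> E sE /(hq _ sE)[n [hn hE]].
have [D [sD eD]] := hD n E sE (fun i hi => leq_trans hn (head_le_mem sE hi)).
rewrite map_comp; rewrite /= in eD; rewrite eD -map_comp.
have [_ {}hM] := hM n; apply: hM => //.
rewrite map_comp -eD -map_comp.
have sLp := sincr_comp sL sp.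
have hRE : comp (fun=> n.+1) (Schr (c n)) (map (R n) (map q E)).
  have [sR {}hR] := hR n; apply: comp_map hE => //; exact: sorted_map_sincr.
have [sR _] := hR n.
rewrite -map_comp in hRE; apply: spreading_map hRE => //.
- by apply: comp_spreading => //; exact: Schr_spreading.
- exact: sincr_comp.
move=> i hi /=; apply: leq_trans (leq_trans (ur i) (sincr_ge _ sL)) => /=.
apply: hr; rewrite (leq_trans hn) // (leq_trans (head_le_mem sE hi)) // leqW //.
exact: sincr_ge.
Qed.

End Chain.

(** * Functionals *)

Section Sublinear.
Variable V : lmodType RR.

Definition sublinear (q : V -> RR) :=
  (forall u v, q (u + v) <= q u + q v) /\ (forall t v, 0 < t -> q (t *: v) <= t * q v).

Lemma sublinear0 q : sublinear q -> q 0 = 0.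
Proof.
move=> [_ h]; have h1 := h 2 0 (ltr0Sn _ _); have h2 := h (1 / 2) 0.
rewrite !scaler0 in h1 h2; have := h2 (divr_gt0 ltr01 (ltr0Sn _ _)); lra.
Qed.

Lemma sublinear_opp q v : sublinear q -> - q (- v) <= q v.
Proof. by move=> sq; have := sq.1 v (- v); rewrite subrr sublinear0 //; lra. Qed.

Lemma sublinearZ q t v : sublinear q -> 0 <= t -> q (t *: v) = t * q v.
Proof.
move=> sq; rewrite le_eqVlt => /orP[/eqP<-|t0]; first by rewrite scale0r mul0r sublinear0.
apply/eqP; rewrite eq_le sq.2 //= -ler_pdivlMl //.
have := sq.2 t^-1 (t *: v); rewrite scalerA mulVf ?gt_eqF // scale1r; apply.
by rewrite invr_gt0.
Qed.

(** Serves three times: lower bounds of chains for Zorn, the test of minimality in [hahn_banach],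
    and the gauge of a cone in [hahn_banach_cone]. *)
Lemma sublinear_inf q (I : Type) (i0 : I) (f : I -> V -> RR) : sublinear q ->
  (forall i v, - q (- v) <= f i v) ->
  (forall i j u v, exists k, f k (u + v) <= f i u + f j v) ->
  (forall i t v, 0 < t -> exists k, f k (t *: v) <= t * f i v) ->
  let g v := inf (range (fun i => f i v)) in
  sublinear g /\ forall i v, g v <= f i v.
Proof.
move=> sq lb fD fZ g.
have hlb v : has_lbound (range (fun i => f i v)).
  by exists (- q (- v)) => _ [i _ <-].
have ne v : (range (fun i => f i v) !=set0)%classic by exists (f i0 v), i0.
have gle i v : g v <= f i v by apply: ge_inf => //; exists i.
split=> //; split=> [u v|t v t0].
- rewrite -lerBlDr; apply: lb_le_inf => // _ [i _ <-].
  rewrite lerBlDr -lerBlDl; apply: lb_le_inf => // _ [j _ <-].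
  rewrite lerBlDl; have [k hk] := fD i j u v.
  exact: le_trans (gle k _) hk.
- rewrite -ler_pdivrMl //; apply: lb_le_inf => // _ [i _ <-].
  rewrite ler_pdivrMl //; have [k hk] := fZ i t v t0.
  exact: le_trans (gle k _) hk.
Qed.

(* A minimal sublinear functional is linear. *)
Theorem hahn_banach p : sublinear p -> exists phi : V -> RR,
  (forall a u v, phi (a *: u + v) = a * phi u + phi v) /\ forall v, phi v <= p v.
Proof.
move=> sp; pose T := {q : V -> RR | sublinear q /\ forall v, q v <= p v}.
pose R (s t : T) := `[< forall v, sval t v <= sval s v >].
have [||||m hm] := @Zorn T R.
- by move=> t; apply/asboolP.
- move=> r s t /asboolP h1 /asboolP h2; apply/asboolP => v; exact: le_trans (h2 v) (h1 v).
- move=> [s hs] [t ht] /asboolP h1 /asboolP h2; apply: eq_exist => /=.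
  by apply/funext => v; apply/eqP; rewrite eq_le h1 h2.
- move=> A tot; have [[s0 As0]|/forallNP nA] := EM (exists s, A s); last first.
    have hp : sublinear p /\ forall v, p v <= p v by split.
    by exists (exist _ p hp) => s /nA.
  pose I := {s : T | A s}.
  have [|||sg gle] := @sublinear_inf p I (exist _ s0 As0) (fun i => sval (sval i)) sp.
  + move=> [[s [ss sle]] As] v /=; apply: le_trans (sublinear_opp v ss).
    by rewrite lerN2.
  + move=> [s As] [t At] u v; case: (tot s t As At) => /asboolP le.
    * exists (exist _ t At) => /=; apply: le_trans ((svalP t).1.1 u v) _.
      exact: lerD (le u) (lexx _).
    * exists (exist _ s As) => /=; apply: le_trans ((svalP s).1.1 u v) _.
      exact: lerD (lexx _) (le v).
  + by move=> [s As] t v t0; exists (exist _ s As) => /=; apply: (svalP s).1.2.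
  set g := (fun v => inf _) in sg gle.
  have hg : sublinear g /\ forall v, g v <= p v.
    by split=> // v; apply: le_trans (gle (exist _ s0 As0) v) _; case: (svalP s0).
  by exists (exist _ g hg) => s As; apply/asboolP => v; exact: (gle (exist _ s As)).
case: m hm => q [sq qp] hm; exists q; split=> //.
have addq x v : q (x + v) = q x + q v.
  apply/eqP; rewrite eq_le sq.1 /=.
  (* The infimum over t >= 0 of q(x + t v) - t q(v) is sublinear and at most q, so it equals q by
     minimality; t = 1 then gives the reverse of subadditivity. *)
  have [|||sg gle] := @sublinear_inf q {t : RR | 0 <= t} (exist _ 0 (lexx 0))
    (fun t x => q (x + sval t *: v) - sval t * q v) sq.
  - move=> [t t0] y /=.
    have h1 := sq.1 (y + t *: v) (- y); rewrite addrAC subrr add0r in h1.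
    have := sublinearZ v sq t0; lra.
  - move=> [t t0] [s s0] y w; exists (exist _ (t + s) (addr_ge0 t0 s0)) => /=.
    by rewrite scalerDl addrACA mulrDl; have := sq.1 (y + t *: v) (w + s *: v); lra.
  - move=> [t t0] s y s0; exists (exist _ (s * t) (mulr_ge0 (ltW s0) t0)) => /=.
    rewrite mulrBr -scalerA -scalerDr mulrA; have := sq.2 s (y + t *: v) s0; lra.
  set g := (fun x => inf _) in sg gle.
  have gq y : g y <= q y.
    by have := gle (exist _ 0 (lexx 0)) y; rewrite /= scale0r addr0 mul0r subr0.
  have hg : sublinear g /\ forall v, g v <= p v.
    by split=> // y; exact: le_trans (gq y) (qp y).
  have /(congr1 sval) /= e : exist _ q (conj sq qp) = exist _ g hg :> T.
    by apply/esym/hm/asboolP => y; exact: gq.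
  have := gle (exist _ 1 ler01) x; rewrite -[X in X <= _]/(g x) -e /= scale1r mul1r; lra.
have negq v : q (- v) = - q v.
  by have := addq v (- v); rewrite subrr sublinear0 //; lra.
move=> a u v; rewrite addq; congr (_ + _).
case: (leP 0 a) => [|/ltW] a0; first exact: sublinearZ.
have := @sublinearZ q (- a) u sq; rewrite oppr_ge0 scaleNr negq => /(_ a0).
by lra.
Qed.

End Sublinear.

Definition dual_ball (V : normedModType RR) (phi : V -> RR) :=
  (forall a u v, phi (a *: u + v) = a * phi u + phi v) /\ forall v, `|phi v| <= `|v|.

Section Dual.
Variable V : normedModType RR.
Implicit Types (phi : V -> RR) (v : V).

Lemma dual_ball_lin phi : dual_ball phi -> lin_functional phi.
Proof. by move=> [h1 h2]; split=> //; exists 1 => v; rewrite mul1r. Qed.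

Lemma lin_sum (I : Type) phi (s : seq I) (a : I -> RR) (y : I -> V) : lin_functional phi ->
  phi (\sum_(i <- s) a i *: y i) = \sum_(i <- s) a i * phi (y i).
Proof.
move=> [h _]; have h0 : phi 0 = 0.
  by have := h (-1) 0 0; rewrite scaler0 addr0; lra.
by elim: s => [|i s IH]; rewrite ?big_nil // !big_cons h IH.
Qed.

(* Mazur-Orlicz: extend the sublinear functional [v |-> inf {`|v + w| - t | C w t}]. *)
Lemma hahn_banach_cone (C : V -> RR -> Prop) : C 0 0 ->
  (forall u v s t, C u s -> C v t -> C (u + v) (s + t)) ->
  (forall l u s, 0 < l -> C u s -> C (l *: u) (l * s)) ->
  (forall w t, C w t -> t <= `|w|) ->
  exists phi, dual_ball phi /\ forall w t, C w t -> t <= phi w.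
Proof.
move=> C0 CD CZ Cle; pose I := {x : V * RR | C x.1 x.2}.
have snorm : sublinear (fun v : V => `|v|).
  split=> [u v|t v t0]; first exact: ler_normD.
  by rewrite normrZ gtr0_norm.
have [|||sg gle] := @sublinear_inf V _ I (exist _ (0, 0) C0)
    (fun i v => `|v + (sval i).1| - (sval i).2) snorm.
- move=> [[w t] /= c] v; have := Cle _ _ c; have := ler_normD (v + w) (- v).
  by rewrite addrAC subrr add0r; lra.
- move=> [[w t] /= c] [[w' t'] /= c'] u v; exists (exist _ (w + w', t + t') (CD _ _ _ _ c c')) => /=.
  by rewrite addrACA; have := ler_normD (u + w) (v + w'); lra.
- move=> [[w t] /= c] l v l0; exists (exist _ (l *: w, l * t) (CZ _ _ _ l0 c)) => /=.
  by rewrite -scalerDr normrZ gtr0_norm // mulrBr.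
set g := (fun v => inf _) in sg gle.
have [phi [lphi phile]] := hahn_banach sg.
have phi0 : phi 0 = 0 by have := lphi (-1) 0 0; rewrite scaler0 addr0; lra.
have phiN v : phi (- v) = - phi v.
  by have := lphi (-1) v 0; rewrite addr0 scaleN1r phi0; lra.
have phin v : phi v <= `|v|.
  apply: le_trans (phile v) _; apply: le_trans (gle (exist _ (0, 0) C0) v) _ => /=.
  by rewrite addr0 subr0.
exists phi; split.
  by split=> // v; rewrite ler_norml phin andbT lerNl -phiN -normrN.
move=> w t c; have := le_trans (phile (- w)) (gle (exist _ (w, t) c) (- w)).
by rewrite /= addNr normr0 phiN; lra.
Qed.

Lemma norming v : exists phi, dual_ball phi /\ phi v = `|v|.
Proof.
have [||||phi [bp hp]] := @hahn_banach_cone (fun w t => exists s, [/\ 0 <= s, w = s *: v & t = s * `|v|]).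
- by exists 0; rewrite scale0r mul0r.
- move=> u w s t [a [a0 -> ->]] [b [b0 -> ->]]; exists (a + b).
  by rewrite addr_ge0 // scalerDl mulrDl.
- move=> l u s l0 [a [a0 -> ->]]; exists (l * a).
  by rewrite mulr_ge0 ?(ltW l0) // scalerA mulrA.
- by move=> w t [s [s0 -> ->]]; rewrite normrZ ger0_norm.
exists phi; split=> //; apply/eqP; rewrite eq_le hp ?andbT.
  by apply: le_trans (bp.2 v); exact: ler_norm.
by exists 1; rewrite ler01 scale1r mul1r.
Qed.

(** The bound of [l1_spreading] on a single set, made homogeneous. For fixed [y] and [d] it is a
    hereditary family, to which [emb] and [dichotomy] apply. *)
Definition lowE (y : nat -> V) (d : RR) (E : seq nat) := forall a : nat -> RR,
  (forall i, 0 <= a i) -> d * \sum_(i <- E) a i <= `|\sum_(i <- E) a i *: y i|.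

Lemma lowE_in_co y d E : 0 < d ->
  (forall v, in_co y E v -> d <= `|v|) <-> lowE y d E.
Proof.
move=> d0; split=> [h a a0|h v [a [a0 [a1 ->]]]]; last first.
  by have := h a a0; rewrite a1 mulr1.
have s0 : 0 <= \sum_(i <- E) a i by exact: sumr_ge0.
move: s0; rewrite le_eqVlt => /orP[/eqP<-|s0]; first by rewrite mulr0.
rewrite -ler_pdivlMr //; set S := \sum_(i <- E) a i in s0 *.
have := h (S^-1 *: \sum_(i <- E) a i *: y i).
rewrite normrZ gtr0_norm ?invr_gt0 // mulrC; apply.
exists (fun i => S^-1 * a i); split; first by move=> i; rewrite mulr_ge0 // invr_ge0 ltW.
rewrite -big_distrr /= mulVf ?gt_eqF //; split=> //.
by rewrite scaler_sumr; apply: eq_bigr => i _; rewrite scalerA.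
Qed.

Lemma lowE_nil y d : lowE y d [::].
Proof. by move=> a _; rewrite !big_nil mulr0. Qed.

Lemma lowE_hered y d : hereditary (lowE y d).
Proof.
move=> E E' sE h sub a a0.
have sE' := sorted_subseq_ltn sub sE.
have := h (fun i => if i \in E' then a i else 0).
have -> : \sum_(i <- E) (if i \in E' then a i else 0) = \sum_(i <- E') a i.
  rewrite -big_mkcond -big_filter -sorted_subset_filter //; exact: mem_subseq.
have -> : \sum_(i <- E) (if i \in E' then a i else 0) *: y i = \sum_(i <- E') a i *: y i.
  rewrite (eq_bigr (fun i => if i \in E' then a i *: y i else 0)); last first.
    by move=> i _; case: ifP => // _; rewrite scale0r.
  rewrite -big_mkcond -big_filter -sorted_subset_filter //; exact: mem_subseq.
by apply=> i; case: ifP.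
Qed.

Lemma lowE_le y d d' E : d' <= d -> lowE y d E -> lowE y d' E.
Proof.
move=> dd h a a0; apply: le_trans (h a a0); rewrite ler_wpM2r //; exact: sumr_ge0.
Qed.

Lemma lowE_map y d p E : strictly_incr p -> lowE (y \o p) d E <-> lowE y d (map p E).
Proof.
move=> sp; split=> h a a0; first by rewrite !big_map; exact: (h (a \o p) (fun i => a0 (p i))).
have [q hq] : exists q : nat -> nat, forall i, q (p i) = i.
  have hh x : exists i, (exists j, x = p j) -> x = p i.
    by have [[j ->]|nx] := EM (exists j, x = p j); [exists j|exists 0%N].
  have [q hq] := choice hh; exists q => i.
  by apply: (sincr_inj sp); rewrite -hq //; exists i.
have := h (a \o q); rewrite !big_map /=.
under eq_bigr do rewrite hq; under [X in `|X|]eq_bigr do rewrite hq.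
by apply=> i; exact: a0.
Qed.

(** Separation from the cone generated by the pairs (y_i, d) with i in P: estimates on finite
    subsets yield a single functional even for infinite P. *)
Lemma lowE_functional y d (P : pred nat) : (forall E, sorted ltn E -> all P E -> lowE y d E) ->
  exists phi, dual_ball phi /\ forall i, P i -> d <= phi (y i).
Proof.
move=> h.
have [||||phi [bp hp]] := @hahn_banach_cone (fun w t => exists s : seq (nat * RR),
    [/\ all (fun x => P x.1 && (0 <= x.2)) s, w = \sum_(x <- s) x.2 *: y x.1 &
        t = d * \sum_(x <- s) x.2]).
- by exists [::]; rewrite !big_nil mulr0.
- move=> u v s t [a [ha -> ->]] [b [hb -> ->]]; exists (a ++ b).
  by rewrite all_cat ha hb !big_cat /= mulrDr.
- move=> l u s l0 [a [ha -> ->]]; exists [seq (x.1, l * x.2) | x <- a]; split.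
  + rewrite all_map; apply: sub_all ha => x /= /andP[-> x0] /=.
    by rewrite mulr_ge0 // ltW.
  + by rewrite big_map scaler_sumr; apply: eq_bigr => x _; rewrite scalerA.
  + by rewrite big_map -big_distrr /= mulrCA.
- move=> w t [s [hs -> ->]].
  pose E := [seq i <- iota 0 (\max_(x <- s) x.1).+1 | i \in map fst s].
  have sE : sorted ltn E by apply: sorted_filter; [exact: ltn_trans|exact: iota_ltn_sorted].
  have memE x : x \in s -> x.1 \in E.
    move=> xs; rewrite mem_filter map_f // mem_iota leq0n add0n ltnS.
    exact: (@leq_bigmax_seq _ s predT (fun x => x.1) x).
  pose a i := \sum_(x <- s | x.1 == i) x.2.
  (* Indices may repeat in an element of the cone; their coefficients are collected so that the
     estimate on the set [E] applies. *)
  have coll (W : lmodType RR) (z : nat -> W) :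
      \sum_(x <- s) x.2 *: z x.1 = \sum_(i <- E) a i *: z i.
    under [RHS]eq_bigr do rewrite /a scaler_suml.
    rewrite (exchange_big_dep predT) //= big_seq [RHS]big_seq; apply: eq_bigr => x xs.
    rewrite (eq_bigl (fun i => i == x.1)); last by move=> i; rewrite eq_sym.
    rewrite -big_filter filter_pred1_uniq ?memE // ?big_seq1 //.
    exact: sorted_uniq ltn_trans ltnn _ sE.
  have -> : \sum_(x <- s) x.2 = \sum_(i <- E) a i.
    have := coll RR^o (fun=> 1); rewrite /GRing.scale /=.
    by under eq_bigr do rewrite mulr1; under [in RHS]eq_bigr do rewrite mulr1.
  rewrite coll; apply: h => //.
    apply/allP => i; rewrite mem_filter => /andP[/mapP[x xs ->] _].
    by have /andP[] := allP hs x xs.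
  move=> i; rewrite /a big_seq_cond; apply: sumr_ge0 => x /andP[xs _].
  by have /andP[] := allP hs x xs.
exists phi; split=> // i Pi; apply: hp; exists [:: (i, 1)].
by rewrite /= Pi ler01 !big_seq1 scale1r mulr1.
Qed.

End Dual.

(** * Bounded operators on closed spans *)

Section Spans.
Variables V : normedModType RR.
Implicit Types (f : nat -> V) (x y : V).

Lemma sum_widen f (a : nat -> RR) N M : (N <= M)%N ->
  \sum_(i < N) a i *: f i = \sum_(i < M) (if (i < N)%N then a i else 0) *: f i.
Proof.
move=> NM; rewrite (big_ord_widen _ (fun i => a i *: f i) NM) big_mkcond.
by apply: eq_bigr => i _; case: ifP => // _; rewrite scale0r.
Qed.

Lemma sum_delta f (i N : nat) : (i < N)%N -> f i = \sum_(j < N) (j == i :> nat)%:R *: f j.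
Proof.
move=> h; rewrite (bigD1 (Ordinal h)) //= eqxx scale1r big1 ?addr0 // => j.
by rewrite -val_eqE /= => /negbTE ->; rewrite scale0r.
Qed.

Lemma lin_span_mem f i : lin_span f (f i).
Proof. by exists i.+1, (fun j => (j == i)%:R); exact: sum_delta. Qed.

Lemma cspan_lin f x : lin_span f x -> cspan f x.
Proof. by move=> h e e0; exists x; rewrite subrr normr0. Qed.

Lemma cspan_mem f i : cspan f (f i).
Proof. exact/cspan_lin/lin_span_mem. Qed.

Lemma lin_spanD f (a : RR) x y : lin_span f x -> lin_span f y -> lin_span f (a *: x + y).
Proof.
move=> [N [b ->]] [M [c ->]]; exists (maxn N M).
exists (fun i => a * (if (i < N)%N then b i else 0) + (if (i < M)%N then c i else 0)).
rewrite (sum_widen f b (leq_maxl N M)) (sum_widen f c (leq_maxr N M)).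
rewrite scaler_sumr -big_split /=; apply: eq_bigr => i _.
by rewrite scalerDl scalerA.
Qed.

Lemma cspan_closed f : closed_subspace (cspan f).
Proof.
split; first by apply: cspan_lin; exists 0%N, (fun=> 0); rewrite big_ord0.
split=> [a u v hu hv e e0|x hx e e0].
- have e1 : 0 < e / 2 / (`|a| + 1) by rewrite !divr_gt0 // ltr_wpDl.
  have e2 : 0 < e / 2 by rewrite divr_gt0.
  have [u' [su hu']] := hu _ e1; have [v' [sv hv']] := hv _ e2.
  exists (a *: u' + v'); split; first exact: lin_spanD.
  rewrite opprD addrACA -scalerBr; apply: le_lt_trans (ler_normD _ _) _.
  rewrite normrZ; have : `|a| * `|u - u'| <= e / 2.
    have h : (`|a| + 1) * `|u - u'| <= e / 2.
      by rewrite mulrC -ler_pdivlMr ?ltW // ltr_wpDl.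
    by apply: le_trans h; rewrite ler_wpM2r // lerDl.
  lra.
- have e2 : 0 < e / 2 by rewrite divr_gt0.
  have [y [hy xy]] := hx _ e2; have [w [sw yw]] := hy _ e2.
  exists w; split=> //; apply: le_lt_trans (_ : `|x - y| + `|y - w| < e); last lra.
  by rewrite -[x - w](subrKA y) ler_normD.
Qed.

Lemma sum_in_subspace (D : set V) (I : Type) (s : seq I) (a : I -> RR) (g : I -> V) :
  closed_subspace D -> (forall i, D (g i)) -> D (\sum_(i <- s) a i *: g i).
Proof.
move=> [D0 [DD _]] hg; elim: s => [|i s IH]; rewrite ?big_nil // big_cons.
exact: DD.
Qed.

End Spans.

Lemma op_on_sum (V W : normedModType RR) (D : set V) (C : set W) T (I : Type) (s : seq I)
    (a : I -> RR) (g : I -> V) : closed_subspace D -> bounded_op_on D C T ->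
  (forall i, D (g i)) -> T (\sum_(i <- s) a i *: g i) = \sum_(i <- s) a i *: T (g i).
Proof.
move=> cD [_ [lT _]] hg; have [D0 _] := cD.
have T0 : T 0 = 0.
  by have := lT (-1) 0 0 D0 D0; rewrite scaler0 addr0 scaleN1r addNr.
elim: s => [|i s IH]; rewrite ?big_nil // !big_cons lT ?IH //.
exact: sum_in_subspace.
Qed.

Lemma op_on_bound (V W : normedModType RR) (D : set V) (C : set W) T :
  bounded_op_on D C T -> exists c : RR, 0 < c /\ forall v, D v -> `|T v| <= c * `|v|.
Proof.
move=> [_ [_ [c hc]]]; exists (`|c| + 1); split; first by rewrite ltr_wpDl.
move=> v Dv; apply: le_trans (hc v Dv) _; rewrite ler_wpM2r //.
by apply: le_trans (ler_norm c) _; rewrite lerDl.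
Qed.

Lemma inv_succ_lt (e : RR) : 0 < e -> exists N, forall n, (N <= n)%N -> n.+1%:R^-1 < e.
Proof.
move=> e0; exists (Num.truncn e^-1) => n hn.
by rewrite invf_plt ?posrE // (lt_le_trans (truncnS_gt _)) // ler_nat ltnS.
Qed.

Lemma seq_complete (W : completeNormedModType RR) (t : nat -> W) :
  (forall e : RR, 0 < e -> exists N, forall m n, (N <= m)%N -> (N <= n)%N -> `|t m - t n| < e) ->
  exists l, forall e : RR, 0 < e -> exists N, forall n, (N <= n)%N -> `|l - t n| < e.
Proof.
move=> ct.
have /cvg_ex[l hl] : cvg (t n @[n --> \oo])%classic.
  apply: cauchy_cvg; apply: cauchy_exP => e e0; have [N hN] := ct e e0.
  by exists (t N); exists N => // n /= hn; rewrite -ball_normE /=; exact: hN.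
exists l => e e0.
have /cvgrPdist_lt /(_ e e0) [N _ hN] := hl.
by exists N => n hn; exact: hN.
Qed.

Section Extension.
Variables (V : normedModType RR) (W : completeNormedModType RR).
Variables (u : nat -> V) (w : nat -> W) (C : RR).
Hypothesis dom : forall N (a : nat -> RR),
  `|\sum_(i < N) a i *: w i| <= C * `|\sum_(i < N) a i *: u i|.

Let span2 x z := exists N (a : nat -> RR), x = \sum_(i < N) a i *: u i /\ z = \sum_(i < N) a i *: w i.

Let span2D a x z x' z' : span2 x z -> span2 x' z' -> span2 (a *: x + x') (a *: z + z').
Proof.
move=> [N [b [-> ->]]] [M [c [-> ->]]]; exists (maxn N M).
exists (fun i => a * (if (i < N)%N then b i else 0) + (if (i < M)%N then c i else 0)).
rewrite (sum_widen u b (leq_maxl N M)) (sum_widen u c (leq_maxr N M)).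
rewrite (sum_widen w b (leq_maxl N M)) (sum_widen w c (leq_maxr N M)).
by split; rewrite scaler_sumr -big_split /=; apply: eq_bigr => i _;
  rewrite scalerDl scalerA.
Qed.

Let span2_le x z : span2 x z -> `|z| <= (`|C| + 1) * `|x|.
Proof.
move=> [N [a [-> ->]]]; apply: le_trans (dom N a) _; rewrite ler_wpM2r //.
by apply: le_trans (ler_norm C) _; rewrite lerDl.
Qed.

(** The closure of the graph of the linear map sending [u i] to [w i]. Domination makes it
    single-valued, and completeness of W makes it defined on the whole closed span. *)
Let graph v z := forall e : RR, 0 < e -> exists x y, [/\ span2 x y, `|v - x| < e & `|z - y| < e].

Let graph_le v z : graph v z -> `|z| <= (`|C| + 1) * `|v|.
Proof.
set K := `|C| + 1; have K0 : 0 < K by rewrite ltr_wpDl.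
move=> g; apply/ler_addgt0Pr => e e0.
have [q q0 h5] : exists2 q, 0 < q & (K + 1) * q = e.
  by exists (e / (K + 1)); [rewrite divr_gt0 // addr_gt0|rewrite mulrC divfK // gt_eqF // addr_gt0].
have [x [y [s hx hy]]] := g _ q0.
have h1 := span2_le s; rewrite -/K in h1.
have h2 : `|z| <= `|z - y| + `|y| by rewrite -[in leLHS](subrK y z) ler_normD.
have h3 : `|x| <= `|v| + `|v - x|.
  by rewrite -[in leLHS](subKr v x) (le_trans (ler_normB _ _)).
have h4 : K * `|x| <= K * (`|v| + `|v - x|) by rewrite ler_wpM2l // ltW.
have h6 : K * `|v - x| <= K * q by rewrite ler_wpM2l // ltW.
lra.
Qed.

Let graphD a v z v' z' : graph v z -> graph v' z' -> graph (a *: v + v') (a *: z + z').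
Proof.
move=> g g' e e0; set K := `|a| + 1; have K0 : 0 < K by rewrite ltr_wpDl.
have e1 : 0 < e / 2 / K by rewrite !divr_gt0.
have e2 : 0 < e / 2 by rewrite divr_gt0.
have [x [y [s hx hy]]] := g _ e1; have [x' [y' [s' hx' hy']]] := g' _ e2.
exists (a *: x + x'), (a *: y + y').
have aux (Z : normedModType RR) (p q p' q' : Z) : `|p - q| < e / 2 / K -> `|p' - q'| < e / 2 ->
    `|(a *: p + p') - (a *: q + q')| < e.
  move=> h h'; rewrite opprD addrACA -scalerBr; apply: le_lt_trans (ler_normD _ _) _.
  rewrite normrZ; have : K * `|p - q| <= e / 2 by rewrite mulrC -ler_pdivlMr ?ltW.
  have : `|a| * `|p - q| <= K * `|p - q| by rewrite ler_wpM2r // lerDl.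
  lra.
by split; [exact: span2D|exact: aux|exact: aux].
Qed.

Lemma extend_op : exists T, bounded_op_on (cspan u) (cspan w) T /\ forall i, T (u i) = w i.
Proof.
have uniq v z z' : graph v z -> graph v z' -> z = z'.
  move=> g g'; have := graph_le (graphD (-1) g g').
  rewrite !scaleN1r addNr normr0 mulr0 normr_le0 addrC subr_eq0 => /eqP.
  by move->.
have ex v : cspan u v -> exists z, graph v z.
  move=> hv.
  have hn n : exists x y, span2 x y /\ `|v - x| < n.+1%:R^-1.
    have [x [[N [a e]] h]] := hv n.+1%:R^-1 ltac:(by rewrite invr_gt0).
    by exists x, (\sum_(i < N) a i *: w i); split=> //; exists N, a.
  have [x hx] := choice hn; have {hn hx} [y hx] := choice hx.
  have [|z hz] := @seq_complete W y.
    move=> e e0; set K := `|C| + 1; have K0 : 0 < K by rewrite ltr_wpDl.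
    have [N hN] := @inv_succ_lt (e / 2 / K) ltac:(by rewrite !divr_gt0).
    exists N => m n hm hn.
    have [sm xm] := hx m; have [sn xn] := hx n.
    have := span2_le (span2D (-1) sn sm); rewrite !scaleN1r addrC [- x n + _]addrC -/K.
    move/le_lt_trans; apply.
    have : `|x m - x n| < e / K.
      have -> : e / K = e / 2 / K + e / 2 / K by field; rewrite gt_eqF.
      rewrite -(subrKA v); apply: le_lt_trans (ler_normD _ _) _.
      by rewrite ltrD // ?(lt_trans xn) ?hN // distrC (lt_trans xm) // hN.
    by move=> h; rewrite mulrC -ltr_pdivlMr.
  exists z => e e0; have [N1 h1] := inv_succ_lt e0; have [N2 h2] := hz e e0.
  exists (x (maxn N1 N2)), (y (maxn N1 N2)); have [h3 h4] := hx (maxn N1 N2).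
  by split=> //; [apply: lt_trans h4 _; apply: h1; rewrite leq_maxl|apply: h2; rewrite leq_maxr].
have exT v : exists z, cspan u v -> graph v z.
  have [/ex[z gz]|nv] := EM (cspan u v); first by exists z.
  by exists 0.
have [T hT] := choice exT.
have gu i : graph (u i) (w i).
  move=> e e0; exists (u i), (w i); rewrite !subrr !normr0; split=> //.
  by exists i.+1, (fun j => (j == i)%:R); split; exact: sum_delta.
exists T; split; last by move=> i; apply: uniq (hT _ (cspan_mem u i)) (gu i).
split; last split.
- move=> v /hT g e e0; have [x [y [[N [a [_ ey]]] _ h]]] := g e e0.
  by exists y; split=> //; exists N, a.
- move=> a v v' hv hv'; have [_ [cD _]] := cspan_closed u.
  exact: uniq (hT _ (cD a _ _ hv hv')) (graphD a (hT _ hv) (hT _ hv')).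
- by exists (`|C| + 1) => v /hT; exact: graph_le.
Qed.

End Extension.

(** * Weak nullity *)

(** Weak nullity through [Schr], meaningful for any tree; the orders produced by [osup] and [osub]
    need not satisfy the nesting required by [wf_ord]. *)
Definition wn (a : ord) (X : normedModType RR) (x : nat -> X) :=
  bounded_seq x /\ forall d : RR, 0 < d -> ~ emb (Schr a) (lowE x d).

Lemma wnull_wn a (X : normedModType RR) (x : nat -> X) : wf_ord a ->
  wnull (Ctbl a) x <-> wn a x.
Proof.
move=> wf; split=> -[bx h]; split=> //.
- move=> d d0 /(emb_trans (Sch_emb wf)) [p [sp hp]]; apply: h; exists p; split=> //.
  split; first by have [M hM] := bx; exists M => n; exact: hM.
  exists d; split=> // F v sF hF; move: v; apply/(lowE_in_co _ _ d0).
  by apply/(lowE_map _ _ _ sp)/hp.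
- move=> [p [sp [_ [d [d0 hp]]]]]; apply: (h d d0).
  apply: emb_trans (Schr_emb wf) _; exists p; split=> // E sE hE.
  by apply/(lowE_map _ _ _ sp)/(lowE_in_co _ _ d0) => v; exact: hp.
Qed.

Section WeaklyNull.
Variable X : normedModType RR.
Implicit Types x : nat -> X.

Lemma wn_sub a x p : strictly_incr p -> wn a x -> wn a (x \o p).
Proof.
move=> sp [[M hM] h]; split; first by exists M => n; exact: hM.
move=> d d0 [q [sq hq]]; apply: (h d d0); exists (p \o q); split; first exact: sincr_comp.
by move=> E sE /(hq _ sE)/(lowE_map _ _ _ sp); rewrite -map_comp.
Qed.

Lemma wn_ole a b x : ole a b -> wn a x -> wn b x.
Proof.
by move=> /ole_emb ab [bx h]; split=> // d d0 /(emb_trans ab); exact: h.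
Qed.

Lemma infin_or (P Q : nat -> Prop) : infin (fun n => P n \/ Q n) -> infin P \/ infin Q.
Proof.
move=> h; have [|/existsNP[n hn]] := EM (infin P); first by left.
right=> m; have [k [hk [Pk|Qk]]] := h (maxn m n).
  by case: hn; exists k; split=> //; rewrite (leq_trans _ hk) // leq_maxr.
by exists k; split=> //; rewrite (leq_trans _ hk) // leq_maxl.
Qed.

(** A functional staying above e on a subsequence bounds nonnegative combinations there from below
    on every finite set, hence embeds [Schr a]. *)
Lemma wn_weakly_null a x : wn a x -> weakly_null x.
Proof.
have main (phi : X -> RR) e : lin_functional phi -> 0 < e ->
    (exists p, strictly_incr p /\ forall i, e <= phi (x (p i))) -> ~ wn a x.
  move=> lphi e0 [p [sp hp]] [_ h].
  have [_ [c hc]] := lphi; pose c' := `|c| + 1; have c'0 : 0 < c' by rewrite ltr_wpDl.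
  apply: (h (e / c')); first by rewrite divr_gt0.
  exists p; split=> // E sE _; apply/(lowE_map _ _ _ sp) => b b0.
  rewrite mulrAC ler_pdivrMr // mulrC.
  apply: (@le_trans _ _ (\sum_(i <- E) b i * phi (x (p i)))).
    rewrite big_distrl /=; apply: ler_sum => i _; exact: ler_wpM2l.
  rewrite -(lin_sum _ _ (x \o p)) // mulrC; apply: le_trans (ler_norm _) _.
  apply: le_trans (hc _) _; rewrite ler_wpM2r // /c'.
  by apply: le_trans (ler_norm c) _; rewrite lerDl.
move=> wx phi lphi e e0; apply: contrapT => /forallNP hn.
have : infin (fun n => e <= phi (x n) \/ e <= - phi (x n)).
  move=> N; have /existsNP[n /not_implyP[Nn /negP]] := hn N.
  rewrite -leNgt ler_normr => /orP h; by exists n.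
case/infin_or => /infin_enum[p [sp hp]].
  by apply: (main phi e) => //; exists p.
apply: (main (fun v => - phi v) e) => //; last by exists p.
have [l1 [c hc]] := lphi; split; last by exists c => v; rewrite normrN.
by move=> b u v; rewrite l1 opprD mulrN.
Qed.

(** An infinite branch would give, by separation, one functional that is at least d along an
    infinite subsequence. *)
Lemma weakly_null_wfd x d : weakly_null x -> 0 < d -> wfd (lowE x d).
Proof.
move=> wx d0 N sN; apply: contrapT => /forallNP hN.
have [|phi [bp hp]] := @lowE_functional X (x \o N) d predT.
  move=> E sE _; apply/(lowE_map _ _ _ sN).
  have /contrapT := hN (\max_(i <- E) i).+1.
  move/lowE_hered; apply; first exact: sorted_mkseq_sincr.
  apply: map_subseq; apply: sorted_subset_subseq => //; first exact: iota_ltn_sorted.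
  by move=> i iE; rewrite mem_iota leq0n add0n ltnS; exact: (@leq_bigmax_seq _ E predT id i).
have [M hM] := wx phi (dual_ball_lin bp) d d0.
have := hM (N M) (sincr_ge _ sN); rewrite ltNge; case/negP.
exact: le_trans (hp M isT) (ler_norm _).
Qed.

(** A gliding hump in the dual: an unbounded sequence admits a signed series of norming functionals
    that stays large on it. *)
Lemma weakly_null_bounded x : weakly_null x -> bounded_seq x.
Proof.
move=> wx; apply: contrapT => nb.
have big M : exists n, M < `|x n|.
  apply: contrapT => /forallNP h; apply: nb; exists M => n.
  by rewrite leNgt; apply/negP; exact: h.
(* The factor 3^k offsets the weight of the k-th summand. The factor k+1 later forces [n k] past any
   given index, and 4 leaves a margin after the tail of the series takes away half. *)
have /choice[n hn] := fun k => big (4 * k.+1%:R * 3 ^+ k).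
have /choice[psi hpsi] := fun k => norming (x (n k)).
have r0 k : (0 : RR) < 3 ^- k by rewrite invr_gt0 exprn_gt0.
(* The sign of each summand agrees with the value already reached at [x (n k)], so nothing cancels
   there. *)
pose th := fix th k v : RR := if k is j.+1 then
   th j v + (if 0 <= th j (x (n j)) then 1 else -1) * 3 ^- j * psi j v else 0.
have thlin k a u v : th k (a *: u + v) = a * th k u + th k v.
  elim: k => [|k IH] /=; first by rewrite mulr0 addr0.
  have [[lp _] _] := hpsi k; rewrite IH lp; ring.
have step k v : `|th k.+1 v - th k v| <= 3 ^- k * `|v|.
  rewrite /= addrAC subrr add0r !normrM (gtr0_norm (r0 k)) mulrAC.
  have -> : `|if 0 <= th k (x (n k)) then 1 else -1| = 1 :> RR.
    by case: ifP => _; rewrite ?normrN normr1.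
  by rewrite mul1r mulrC ler_wpM2l ?(ltW (r0 k)) //; case: (hpsi k) => -[].
have hump k : 3 ^- k * `|x (n k)| <= `|th k.+1 (x (n k))|.
  rewrite /=; have [_ ->] := hpsi k.
  have p0 : 0 <= 3 ^- k * `|x (n k)| by rewrite mulr_ge0 // ltW.
  case: (leP 0 (th k (x (n k)))) => h; rewrite ?mul1r ?mulN1r ?mulNr.
    by apply: le_trans (ler_norm _); rewrite lerDr.
  by rewrite -[leRHS]normrN; apply: le_trans (ler_norm _); lra.
have tail k m v : `|th (k + m)%N v - th k v| <= 3 / 2 * (3 ^- k - 3 ^- (k + m)) * `|v|.
  elim: m => [|m IH]; first by rewrite addn0 !subrr normr0 mulr0 mul0r.
  rewrite addnS; have h1 := step (k + m)%N v.
  have h2 := ler_distD (th (k + m)%N v) (th (k + m).+1 v) (th k v).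
  have e1 : 3 ^- (k + m).+1 = 3 ^- (k + m) / 3 :> RR by rewrite exprSr invfM.
  apply: le_trans h2 (le_trans (lerD h1 IH) _).
  rewrite -mulrDl ler_wpM2r // e1; lra.
have tail' k m v : (k <= m)%N -> `|th m v - th k v| <= 3 / 2 * 3 ^- k * `|v|.
  move=> km; rewrite -(subnKC km); apply: le_trans (tail _ _ _) _.
  rewrite ler_wpM2r // ler_wpM2l // lerBlDr lerDl; exact: ltW.
have geo (e : RR) : 0 < e -> exists K, 3 ^- K < e.
  move=> e0; exists (Num.truncn e^-1).+1.
  rewrite invf_plt ?posrE ?exprn_gt0 // (lt_le_trans (truncnS_gt _)) //.
  rewrite -natrX ler_nat ltnW // ltn_expl //.
have lim v : exists l, forall e : RR, 0 < e -> exists N, forall m, (N <= m)%N -> `|l - th m v| < e.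
  apply: (@seq_complete RR^o) => e e0.
  have e1 : 0 < e / 3 / (`|v| + 1) by rewrite !divr_gt0 // ltr_wpDl.
  have [K hK] := geo _ e1; exists K => i j hi hj.
  have h1 := tail' _ _ v hi; have h2 := tail' _ _ v hj.
  have h3 := ler_distD (th K v) (th i v) (th j v); rewrite [`|th K v - _|]distrC in h3.
  have h4 : 3 ^- K * (`|v| + 1) < e / 3 by rewrite -ltr_pdivlMr // ltr_wpDl.
  have := r0 K; lra.
have [T hT] := choice lim.
have Tlin a u v : T (a *: u + v) = a * T u + T v.
  apply/eqP; rewrite -subr_eq0 -normr_le0; apply/ler_addgt0Pr => e e0; rewrite add0r.
  have a1 : 0 < `|a| + 1 by rewrite ltr_wpDl.
  have e1 : 0 < e / 3 / (`|a| + 1) by rewrite !divr_gt0.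
  have e3 : 0 < e / 3 by rewrite divr_gt0.
  have [N1 h1] := hT (a *: u + v) _ e3; have [N2 h2] := hT u _ e1.
  have [N3 h3] := hT v _ e3; pose N := (N1 + N2 + N3)%N.
  have {}h1 := h1 N ltac:(lia); have {}h2 := h2 N ltac:(lia).
  have {}h3 := h3 N ltac:(lia).
  have -> : T (a *: u + v) - (a * T u + T v) = (T (a *: u + v) - th N (a *: u + v))
      - a * (T u - th N u) - (T v - th N v) by rewrite thlin; ring.
  apply: le_trans (ler_normB _ _) _; have := ler_normB (T (a *: u + v) - th N (a *: u + v)) (a * (T u - th N u)).
  have : `|a * (T u - th N u)| <= e / 3.
    rewrite normrM; have : (`|a| + 1) * `|T u - th N u| <= e / 3.
      by rewrite mulrC -ler_pdivlMr // ltW.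
    have := normr_ge0 (T u - th N u); lra.
  lra.
have Tth k v : `|T v - th k v| <= 3 / 2 * 3 ^- k * `|v|.
  apply/ler_addgt0Pr => e e0; have [N hN] := hT v _ e0.
  have := hN (maxn N k) (leq_maxl _ _); have := tail' k (maxn N k) v (leq_maxr _ _).
  have := ler_distD (th (maxn N k) v) (T v) (th k v); lra.
have lT : lin_functional T.
  split=> //; exists (3 / 2) => v; have := Tth 0%N v.
  by rewrite /= subr0 expr0 invr1 mulr1.
have [N hN] := wx T lT 1 ltr01.
have [k kB] : exists k : nat, \sum_(i < N) `|x i| < k.+1%:R.
  by exists (Num.truncn (\sum_(i < N) `|x i|)); exact: truncnS_gt.
have k1 : (1 : RR) <= k.+1%:R by rewrite ler1n.
have hk : 4 * k.+1%:R < 3 ^- k * `|x (n k)|.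
  by rewrite [ltRHS]mulrC ltr_pdivlMr ?exprn_gt0.
have q1 : 3 ^- k <= 1 :> RR by rewrite invf_le1 ?exprn_gt0 // exprn_ege1 // ler1n.
(* Otherwise [x (n k)] would be one of the first N terms, whose total norm was chosen below k+1. *)
have Nn : (N <= n k)%N.
  rewrite leqNgt; apply/negP => lt.
  have h1 : `|x (n k)| <= \sum_(i < N) `|x i|.
    by rewrite (bigD1 (Ordinal lt)) //= lerDl sumr_ge0.
  have h2 : 3 ^- k * `|x (n k)| <= `|x (n k)| by rewrite ler_piMl.
  move: (le_lt_trans h2 (le_lt_trans h1 kB)) hk; clear -k1.
  move: (3 ^- k * _) => A; lra.
have h1 := hN _ Nn; have h2 := Tth k.+1 (x (n k)); have h3 := hump k.
have h4 := lerB_dist (th k.+1 (x (n k))) (T (x (n k))).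
have e1 : 3 / 2 * 3 ^- k.+1 * `|x (n k)| = 3 ^- k * `|x (n k)| / 2.
  by rewrite exprSr invfM; field.
rewrite distrC in h4; rewrite e1 in h2.
move: h1 h2 h3 h4 hk k1; clear; move: (3 ^- k * _) (k.+1%:R) => A K.
by move: `|T _| `|th _ _| `|_ - _| => a b c; lra.
Qed.

End WeaklyNull.

(** If every one-point extension of a node has a bounding order, a supremum bounds the node. A node
    without bound thus has a child without bound, and iteration from the root gives a branch against
    [wfd]. *)
Lemma tree_rank (T : fam) : hereditary T -> wfd T ->
  exists a, proper a /\ ~ emb (Schr a) T.
Proof.
(* Sortedness is put into the tree so that a bad branch is automatically strictly increasing. *)
move=> hT wT; pose T' s := sorted ltn s /\ T s.
pose Good s := exists a, proper a /\ forall p, strictly_incr p ->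
  ~ (forall E, sorted ltn E -> Schr a E -> T' (s ++ map p E)).
have step s : (forall n, Good (rcons s n)) -> Good s.
  move=> /choice[g hg]; have [f [pf gf]] := osup (fun n => (hg n).1).
  (* Sets with minimum 1 may have two pieces, so {1} followed by a set of [Schr (OL f)] is
     admissible. Its first point is sent to [p 1], which reduces to the bound for
     [rcons s (p 1)]. *)
  exists (OS (OL f)); split=> // p sp hp.
  have /ole_emb[r [sr hr]] : ole (g (p 1%N)) (OL f) := ole_LR (gf _).
  have [_ h] := hg (p 1%N).
  apply: (h (p \o (addn 2 \o r))).
    exact: sincr_comp sp (sincr_comp (sincr_addn 2) sr).
  move=> E sE /(hr _ sE) hE; rewrite cat_rcons map_comp.
  have sE' : sorted ltn (map (addn 2 \o r) E).
    exact: sorted_map_sincr (sincr_comp (sincr_addn 2) sr) sE.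
  apply: (hp (1%N :: map (addn 2 \o r) E)).
    rewrite /= path_min_sorted //; apply/allP => i /mapP[j _ ->] /=; lia.
  have [->|ne] := eqVneq E [::]; first by apply: size1_comp => //; exact: (Schr1 (OL f)).
  exists [:: [:: 1%N]; map (addn 2 \o r) E]; split=> //=.
  - by rewrite cats0.
  - by rewrite -size_eq0 size_map size_eq0 ne.
  - move=> e; rewrite !inE => /orP[/eqP->|/eqP->]; first exact: (Schr1 (OL f)).
    rewrite map_comp; apply: (@spreading_sincr (Schr (OL f))) hE; first exact: Schr_spreading.
      exact: sorted_map_sincr.
    exact: sincr_addn.
have [[a [pa ha]]|nG] := EM (Good [::]).
  exists a; split=> // -[p [sp hp]]; apply: (ha p sp) => E sE hE; split.
    exact: sorted_map_sincr.
  exact: hp.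
have nx s : exists n, ~ Good s -> ~ Good (rcons s n).
  have [|ns] := EM (Good s); first by exists 0%N.
  have /existsNP[n hn] : ~ forall n, Good (rcons s n) by move=> /step.
  by exists n.
have [nxt hnxt] := choice nx.
pose S := fix S k := if k is j.+1 then rcons (S j) (nxt (S j)) else [::].
have nS k : ~ Good (S k) by elim: k => //= k; exact: hnxt.
pose N k := nxt (S k).
have SN k : S k = mkseq N k by elim: k => //= k IH; rewrite mkseqS -IH.
have TS k : T' (mkseq N k).
  rewrite -SN; apply: contrapT => nT; apply: (nS k); exists OZ; split=> // p sp.
  by move=> /(_ [::] isT isT); rewrite cats0.
have sN : strictly_incr N.
  move=> k; have [sk _] := TS k.+2.
  have := sorted_ltn_nth ltn_trans 0%N sk k k.+1.
  by rewrite !inE size_mkseq !nth_mkseq //; apply.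
by have [k []] := wT N sN; case: (TS k).
Qed.

(** The orders bounding the trees at the levels 1/(k+1) have a countable supremum; the slot 0 of
    [osup] holds [OS z] to push it above z. *)
Lemma weakly_null_wn (X : normedModType RR) (x : nat -> X) z : weakly_null x -> proper z ->
  exists a, [/\ proper a, olt z a & wn a x].
Proof.
move=> wx pz.
have hk k : exists a, proper a /\ ~ emb (Schr a) (lowE x k.+1%:R^-1).
  apply: tree_rank; first exact: lowE_hered.
  by apply: weakly_null_wfd => //; rewrite invr_gt0.
have [g hg] := choice hk.
have [|f [pf gf]] := @osup (fun n => if n is k.+1 then g k else OS z).
  by case=> [|k] //; case: (hg k).
exists (OL f); split=> //; first exact: ole_LR (gf 0%N).
split; first exact: weakly_null_bounded.
move=> d d0 h; pose k := Num.truncn d^-1.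
have kd : k.+1%:R^-1 <= d.
  by rewrite invf_ple ?posrE // ltW // truncnS_gt.
case: (hg k) => _; apply.
have [p [sp hp]] := emb_trans (ole_emb (ole_LR (gf k.+1))) h.
by exists p; split=> // E sE /(hp _ sE); exact: lowE_le.
Qed.

(** * Mixed Schreier spaces as sequence spaces *)

Record mixed_data := MixedData {
  mw : nat -> RR;
  mF : nat -> fam;
  mw_gt0 : forall n, 0 < mw n <= 1;
  mF_hered : forall n, hereditary (mF n);
  mF_single : forall n, has_singletons (mF n) }.

Section MixedSpace.
Variable P : mixed_data.
Local Notation w := (mw P).
Local Notation Fs := (mF P).
Implicit Types a b : nat -> RR^o.

Definition msums a : set RR := fun r =>
  exists n E, [/\ sorted ltn E, Fs n E & r = w n * \sum_(i <- E) `|a i|].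

Definition mtail N a : nat -> RR^o := fun i => if (i < N)%N then 0 else a i.

Definition mle a (c : RR) := forall r, msums a r -> r <= c.

(** Vanishing tails single out, among sequences of finite norm, the closure of c00; the completion
    is thus realised by actual sequences and keeps its coordinates. *)
Definition in_mixed : pred (nat -> RR^o) := fun a =>
  `[< (exists c, mle a c) /\ forall e : RR, 0 < e -> exists N, mle (mtail N a) e >].

Let w0 n : 0 < w n. Proof. by case/andP: (mw_gt0 P n). Qed.
Let w0' n : 0 <= w n. Proof. exact: ltW. Qed.
Let w1 n : w n <= 1. Proof. by case/andP: (mw_gt0 P n). Qed.

Lemma mle_norm a b c : (forall i, `|a i| <= `|b i|) -> mle b c -> mle a c.
Proof.
move=> ab h r [n [E [sE FE ->]]]; apply: le_trans (h _ _); last by exists n, E.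
by rewrite ler_wpM2l ?w0' //; apply: ler_sum => i _; exact: ab.
Qed.

Lemma mleD a b c d : mle a c -> mle b d -> mle (a + b) (c + d).
Proof.
move=> ha hb r [n [E [sE FE ->]]].
have h1 : w n * \sum_(i <- E) `|a i| <= c by apply: ha; exists n, E.
have h2 : w n * \sum_(i <- E) `|b i| <= d by apply: hb; exists n, E.
apply: le_trans (lerD h1 h2); rewrite -mulrDr ler_wpM2l ?w0' // -big_split /=.
by apply: ler_sum => i _; exact: ler_normD.
Qed.

Lemma mleZ (l : RR) a c : mle a c -> mle (l *: a) (`|l| * c).
Proof.
move=> ha r [n [E [sE FE ->]]].
have h1 : w n * \sum_(i <- E) `|a i| <= c by apply: ha; exists n, E.
rewrite (eq_bigr (fun i => `|l| * `|a i|)); last by move=> i _; exact: normrM.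
by rewrite -big_distrr /= mulrCA ler_wpM2l.
Qed.

Lemma mle_ge0 a c : mle a c -> 0 <= c.
Proof.
move=> h; apply: le_trans (h (w 0%N * \sum_(i <- [:: 0%N]) `|a i|) _).
  by rewrite mulr_ge0 ?w0' // sumr_ge0.
by exists 0%N, [:: 0%N]; split=> //; exact: mF_single.
Qed.

Lemma mle_le a c d : c <= d -> mle a c -> mle a d.
Proof. by move=> cd h r /h hr; exact: le_trans hr cd. Qed.

Fact in_mixed_submod : submod_closed in_mixed.
Proof.
split.
  apply/asboolP; split=> [|e e0].
    exists 0 => r [n [E [_ _ ->]]]; rewrite big1 ?mulr0 // => i _; exact: normr0.
  exists 0%N => r [n [E [_ _ ->]]]; rewrite big1 ?mulr0 ?ltW // => i _.
  by rewrite /mtail ltn0 normr0.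
move=> l a b /asboolP[[c hc] ta] /asboolP[[d hd] tb]; apply/asboolP; split.
  by exists (`|l| * c + d); apply: mleD => //; exact: mleZ.
move=> e e0; have l1 : 0 < `|l| + 1 by rewrite ltr_wpDl.
have e1 : 0 < e / 2 / (`|l| + 1) by rewrite !divr_gt0.
have [N hN] := ta _ e1; have [M hM] := tb (e / 2) ltac:(by rewrite divr_gt0).
exists (maxn N M).
have := mleD (mleZ (l := l) hN) hM.
have le : `|l| * (e / 2 / (`|l| + 1)) + e / 2 <= e.
  have : `|l| * (e / 2 / (`|l| + 1)) <= e / 2.
    rewrite mulrA ler_pdivrMr // mulrC ler_wpM2l ?lerDl // ltW // divr_gt0 //.
  lra.
move/(mle_le le) => h; apply: mle_norm h => i.
rewrite /mtail; case: (ltnP i (maxn N M)) => hi; first by rewrite normr0 normr_ge0.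
rewrite -[X in _ <= `|X|]/(l * (if (i < N)%N then 0 else a i) + (if (i < M)%N then 0 else b i)).
by move: hi; rewrite geq_max => /andP[h1 h2]; rewrite !ltnNge h1 h2.
Qed.

HB.instance Definition _ := GRing.isSubmodClosed.Build RR (nat -> RR^o) in_mixed in_mixed_submod.

Record mixed_space := MixedSpace { mval : nat -> RR^o; mvalP : in_mixed mval }.

HB.instance Definition _ := [isSub for mval].
HB.instance Definition _ := [Choice of mixed_space by <:].
HB.instance Definition _ := [SubChoice_isSubLmodule of mixed_space by <:].

Lemma mvalD x y : mval (x + y) = mval x + mval y. Proof. by []. Qed.
Lemma mvalZ (l : RR) x : mval (l *: x) = l *: mval x. Proof. by []. Qed.
Lemma mvalB x y : mval (x - y) = mval x - mval y. Proof. by []. Qed.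

Definition mnorm (x : mixed_space) : RR := sup (msums (mval x)).

Lemma mnorm_le x c : mle (mval x) c -> mnorm x <= c.
Proof.
move=> h; apply: ge_sup => //.
by exists (w 0%N * \sum_(i <- [:: 0%N]) `|mval x i|), 0%N, [:: 0%N]; split=> //; exact: mF_single.
Qed.

Lemma mle_mnorm x : mle (mval x) (mnorm x).
Proof.
move=> r hr; apply: ub_le_sup => //; case/asboolP: (mvalP x) => [[c hc] _].
by exists c.
Qed.

Arguments mle_mnorm : clear implicits.

Fact mnormD x y : mnorm (x + y) <= mnorm x + mnorm y.
Proof. by apply: mnorm_le; rewrite mvalD; exact: (mleD (mle_mnorm x) (mle_mnorm y)). Qed.

Fact mnormZ (l : RR) x : mnorm (l *: x) = `|l| * mnorm x.
Proof.
apply/eqP; rewrite eq_le; apply/andP; split.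
  by apply: mnorm_le; rewrite mvalZ; exact: mleZ (mle_mnorm x).
have [->|l0] := eqVneq l 0.
  by rewrite normr0 mul0r; exact: mle_ge0 (mle_mnorm _).
rewrite -ler_pdivlMl ?normr_gt0 // -normfV.
apply: mnorm_le; have := mleZ (l := l^-1) (mle_mnorm (l *: x)).
by rewrite mvalZ scalerA mulVf // scale1r.
Qed.

Lemma coord_le x i : w 0%N * `|mval x i| <= mnorm x.
Proof.
apply: mle_mnorm; exists 0%N, [:: i]; rewrite big_seq1; split=> //; exact: mF_single.
Qed.

Fact mnorm_eq0 x : mnorm x = 0 -> x = 0.
Proof.
move=> h; apply: val_inj; apply/funext => i /=; apply/eqP.
by rewrite -normr_le0 -(pmulr_rle0 _ (w0 0%N)) -h coord_le.
Qed.

HB.instance Definition _ :=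
  Lmodule_isNormed.Build RR mixed_space mnormD mnormZ mnorm_eq0.

Lemma mixed_seq_complete (t : nat -> mixed_space) :
  (forall e : RR, 0 < e -> exists N, forall m n, (N <= m)%N -> (N <= n)%N -> `|t m - t n| < e) ->
  exists l, forall e : RR, 0 < e -> exists N, forall n, (N <= n)%N -> `|l - t n| < e.
Proof.
move=> ct.
have /choice[l hl] : forall i, exists l : RR^o, forall e : RR, 0 < e ->
    exists N, forall n, (N <= n)%N -> `|l - mval (t n) i| < e.
  move=> i; apply: (@seq_complete RR^o) => e e0.
  have [N hN] := ct (w 0%N * e) (mulr_gt0 (w0 0%N) e0); exists N => m n hm hn.
  have := le_lt_trans (coord_le (t m - t n) i) (hN m n hm hn).
  by rewrite ltr_pM2l.
(* A Fatou-type argument: for each finite test set an index M is chosen where the coordinates have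
   nearly converged on that set, and the Cauchy bound, which is independent of the set, does the
   rest. *)
have close (e : RR) : 0 < e -> exists N, forall n, (N <= n)%N -> mle (l - mval (t n)) e.
  move=> e0; have [N hN] := ct (e / 2) ltac:(by rewrite divr_gt0).
  exists N => n hn r [k [E [sE FE ->]]].
  have [M [NM hM]] : exists M, (N <= M)%N /\ \sum_(i <- E) `|l i - mval (t M) i| <= e / 2.
    have e1 : 0 < e / 2 / (size E).+1%:R by rewrite !divr_gt0 // ltr0n.
    have /choice[K hK] := fun i => hl i _ e1.
    exists (maxn N (\max_(i <- E) K i)); split; first exact: leq_maxl.
    apply: (@le_trans _ _ (\sum_(i <- E) (e / 2 / (size E).+1%:R))).
      rewrite big_seq [leRHS]big_seq; apply: ler_sum => i iE; apply/ltW/hK.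
      rewrite leq_max; apply/orP; right; exact: (@leq_bigmax_seq _ E predT K i).
    rewrite big_const_seq count_predT iter_addr addr0 -[leLHS]mulr_natl mulrA ler_pdivrMr ?ltr0n //.
    by rewrite mulrC ler_wpM2l ?ler_nat // ltW // divr_gt0.
  have h1 := mle_mnorm (t M - t n) ; have := hN M n NM hn => /ltW/mle_le/(_ h1).
  move/(_ (w k * \sum_(i <- E) `|mval (t M - t n) i|)) => h2.
  have {}h2 : w k * \sum_(i <- E) `|mval (t M - t n) i| <= e / 2 by apply: h2; exists k, E.
  apply: (@le_trans _ _ (w k * \sum_(i <- E) `|l i - mval (t M) i| +
     w k * \sum_(i <- E) `|mval (t M - t n) i|)).
    rewrite -mulrDr ler_wpM2l ?w0' // -big_split /=; apply: ler_sum => i _.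
    exact: ler_distD.
  have : w k * \sum_(i <- E) `|l i - mval (t M) i| <= e / 2.
    by apply: le_trans hM; rewrite ler_piMl // sumr_ge0.
  lra.
have lP : in_mixed l.
  apply/asboolP; split.
    have [N hN] := close 1 ltr01; exists (1 + mnorm (t N)).
    have := mleD (hN N (leqnn N)) (mle_mnorm (t N)).
    by rewrite subrK.
  move=> e e0; have [N hN] := close (e / 2) ltac:(by rewrite divr_gt0).
  have [_ /(_ (e / 2) ltac:(by rewrite divr_gt0))[M hM]] := asboolP _ (mvalP (t N)).
  exists M; have := mleD (hN N (leqnn N)) hM.
  rewrite -splitr; apply: mle_norm => i; rewrite /mtail.
  case: (ltnP i M) => hi; first by rewrite normr0 normr_ge0.
  rewrite -[X in _ <= `|X|]/(l i - mval (t N) i + (if (i < M)%N then 0 else mval (t N) i)).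
  by rewrite ltnNge hi /= subrK.
exists (MixedSpace lP) => e e0; have [N hN] := close (e / 2) ltac:(by rewrite divr_gt0).
exists N => n /hN h; apply: (@le_lt_trans _ _ (e / 2)); last lra.
exact: mnorm_le.
Qed.

Fact mixed_complete (F : set_system mixed_space) : ProperFilter F -> cauchy F -> cvg F.
Proof.
move=> PF cF.
have hx n : exists x : mixed_space, F (ball x n.+1%:R^-1).
  by apply: (@cauchyP _ _ F PF).1 cF _ _; rewrite invr_gt0.
have [x {}hx] := choice hx.
have [|l hl] := @mixed_seq_complete x.
  move=> e e0; have [N hN] := @inv_succ_lt (e / 2) ltac:(by rewrite divr_gt0).
  exists N => m n hm hn.
  have [y] := filter_ex (filterI (hx m) (hx n)); rewrite -!ball_normE => -[/= h1 h2].
  apply: le_lt_trans (ler_distD y (x m) (x n)) _; rewrite (splitr e) ltrD //.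
    exact: lt_trans h1 (hN m hm).
  rewrite distrC; exact: lt_trans h2 (hN n hn).
apply/cvg_ex; exists l; apply/cvgrPdist_lt => e e0.
have e2 : 0 < e / 2 by rewrite divr_gt0.
have [N1 h1] := inv_succ_lt e2; have [N2 h2] := hl _ e2.
pose N := maxn N1 N2; apply: filterS (hx N) => y; rewrite -ball_normE /= => h3.
apply: le_lt_trans (ler_distD (x N) l y) _; rewrite (splitr e) ltrD //.
  exact: h2 (leq_maxr _ _).
exact: lt_trans h3 (h1 N (leq_maxl _ _)).
Qed.

HB.instance Definition _ := Uniform_isComplete.Build mixed_space mixed_complete.

Lemma msum_le x n E : sorted ltn E -> Fs n E -> w n * \sum_(i <- E) `|mval x i| <= `|x|.
Proof. by move=> sE FE; apply: mle_mnorm; exists n, E. Qed.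

Lemma mixed_norm_le x c :
  (forall n E, sorted ltn E -> Fs n E -> w n * \sum_(i <- E) `|mval x i| <= c) -> `|x| <= c.
Proof. by move=> h; apply: mnorm_le => r [n [E [sE FE ->]]]; exact: h. Qed.

Lemma mixed_norm_gt x (e : RR) : 0 < e -> exists n E,
  [/\ sorted ltn E, Fs n E & `|x| - e < w n * \sum_(i <- E) `|mval x i|].
Proof.
move=> e0; apply: contrapT => nh.
have : `|x| <= `|x| - e.
  apply: mixed_norm_le => n E sE FE; rewrite leNgt; apply/negP => h.
  by apply: nh; exists n, E.
lra.
Qed.

Lemma mcoord_lin i : lin_functional (fun x => mval x i).
Proof.
split=> //; exists (w 0%N)^-1 => x.
by rewrite mulrC ler_pdivlMr // mulrC; exact: coord_le.
Qed.

Lemma mixed_tail x (e : RR) : 0 < e -> exists N, forall n E, sorted ltn E -> Fs n E ->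
  w n * \sum_(i <- E | (N <= i)%N) `|mval x i| <= e.
Proof.
move=> e0; have [_ /(_ e e0)[N hN]] := asboolP _ (mvalP x).
exists N => n E sE FE; rewrite big_mkcond /=.
apply: le_trans (hN _ _); last by exists n, E.
rewrite ler_wpM2l ?w0' //; apply: ler_sum => i _; rewrite /mtail.
by case: leqP => //; rewrite normr0.
Qed.

Fact munit_in i : in_mixed (fun j => (j == i)%:R).
Proof.
have le1 n E : sorted ltn E -> w n * \sum_(j <- E) `|(j == i)%:R : RR| <= 1.
  move=> sE; apply: mulr_ile1; rewrite ?w0' ?w1 ?sumr_ge0 //.
  rewrite (eq_bigr (fun j => if j == i then 1 else 0)); last first.
    by move=> j _; case: eqP; rewrite ?normr1 ?normr0.
  rewrite -big_mkcond -big_filter.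
  have [iE|nE] := boolP (i \in E).
    by rewrite filter_pred1_uniq ?big_seq1 // (sorted_uniq ltn_trans ltnn).
  rewrite big_filter big_seq_cond big_pred0 ?ler01 // => j.
  by apply/negP => /andP[jE /eqP e]; rewrite -e jE in nE.
apply/asboolP; split; first by exists 1 => r [n [E [sE FE ->]]]; exact: le1.
move=> e e0; exists i.+1 => r [n [E [sE FE ->]]].
rewrite big1 ?mulr0 ?ltW // => j _; rewrite /mtail; case: ltnP => h; first exact: normr0.
by rewrite gtn_eqF // normr0.
Qed.

Definition munit i : mixed_space := MixedSpace (munit_in i).

Lemma mval_sum (I : Type) (s : seq I) (a : I -> RR) (f : I -> mixed_space) i :
  mval (\sum_(j <- s) a j *: f j) i = \sum_(j <- s) a j * mval (f j) i.
Proof. exact: (lin_sum s a f (mcoord_lin i)). Qed.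

Lemma mval_comb N (a : nat -> RR) i :
  mval (\sum_(j < N) a j *: munit j) i = if (i < N)%N then a i else 0.
Proof.
rewrite mval_sum /=; case: (ltnP i N) => h.
  rewrite (bigD1 (Ordinal h)) //= eqxx mulr1 big1 ?addr0 // => j.
  by rewrite -val_eqE /= eq_sym => /negbTE ->; rewrite mulr0.
by rewrite big1 // => j _; rewrite gtn_eqF ?mulr0 // (leq_trans _ h).
Qed.

Lemma mixed_space_norm N (a : nat -> RR) :
  mixed_norm_is w Fs N a `|\sum_(i < N) a i *: munit i|.
Proof.
have eS E : \sum_(i <- E) `|mval (\sum_(j < N) a j *: munit j) i| = \sum_(i <- E | (i < N)%N) `|a i|.
  rewrite [RHS]big_mkcond; apply: eq_bigr => i _; rewrite mval_comb.
  by case: ifP => // _; rewrite normr0.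
split=> [n E sE FE|e e0]; first by rewrite -eS; exact: msum_le.
have [n [E [sE FE h]]] := mixed_norm_gt (\sum_(i < N) a i *: munit i) e0.
by exists n, E; rewrite -eS.
Qed.

Lemma mixed_space_span x : cspan munit x.
Proof.
move=> e e0; have [N hN] := mixed_tail x (divr_gt0 e0 (ltr0Sn RR 1)).
exists (\sum_(i < N) mval x i *: munit i); split; first by exists N, (mval x).
apply: (@le_lt_trans _ _ (e / 2)); last by rewrite ltr_pdivrMr // ltr_pMr // ltr1n.
apply: mixed_norm_le => n E sE FE; apply: le_trans (hN n E sE FE).
rewrite [X in _ <= _ * X]big_mkcond ler_wpM2l ?w0' //; apply: ler_sum => i _.
rewrite mvalB -[X in `|X|]/(mval x i - mval (\sum_(i < N) mval x i *: munit i) i) mval_comb.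
by case: ltnP => h; rewrite ?subr0 // subrr normr0.
Qed.

End MixedSpace.

Lemma mixed_space_schreier (P : mixed_data) :
  (forall eps : RR, 0 < eps -> exists K, forall n, (K <= n)%N -> mw P n < eps) ->
  (forall n, regular (mF P n)) -> mixed_schreier (mw P) (mF P) (@munit P).
Proof.
move=> hw hF; split; first exact: mw_gt0.
split=> //; split; first by move=> n; split=> //; exact: mF_single.
by split; [exact: mixed_space_norm|exact: mixed_space_span].
Qed.

(** * Schreier unconditionality and upper estimates *)

Section Operators.
Variables V W : normedModType RR.

Lemma op_on_eq (u : nat -> V) (C C' : set W) (T T' : V -> W) :
  bounded_op_on (cspan u) C T -> bounded_op_on (cspan u) C' T' ->
  (forall i, T (u i) = T' (u i)) -> forall v, cspan u v -> T v = T' v.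
Proof.
move=> bT bT' e v hv; have cs := cspan_closed u.
have [c [c0 hc]] := op_on_bound bT; have [c' [c'0 hc']] := op_on_bound bT'.
have key b (D : set W) (R : V -> W) : bounded_op_on (cspan u) D R ->
    (forall z, cspan u z -> `|R z| <= b * `|z|) -> forall z, cspan u z ->
    `|R v - R z| <= b * `|v - z|.
  move=> [_ [lR _]] hb z hz; have [_ [cD _]] := cs.
  have -> : R v - R z = R (v - z).
    by have := lR (-1) _ _ hz hv; rewrite !scaleN1r addrC => ->; rewrite addrC.
  by apply: hb; rewrite -[v - z]addrC -scaleN1r; exact: cD.
apply/eqP; rewrite -subr_eq0 -normr_le0; apply/ler_addgt0Pr => eps e0; rewrite add0r.
have [z [hz vz]] := hv (eps / (c + c')) ltac:(by rewrite divr_gt0 // addr_gt0).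
have cz := cspan_lin hz.
have eTz : T z = T' z.
  have [N [a ->]] := hz.
  rewrite (op_on_sum _ _ cs bT) ?(op_on_sum _ _ cs bT') //; last first.
  - by move=> i; exact: cspan_mem.
  - by move=> i; exact: cspan_mem.
  by apply: eq_bigr => i _; rewrite e.
have h1 := key _ _ _ bT hc z cz; have h2 := key _ _ _ bT' hc' z cz.
apply: le_trans (ler_distD (T z) _ _) _; rewrite [`|T z - _|]distrC {2}eTz.
apply: le_trans (lerD h1 h2) _; rewrite -mulrDl mulrC -ler_pdivlMr ?addr_gt0 //.
exact: ltW.
Qed.

Lemma op_on_cspan (T : V -> W) (D : set V) (C : set W) (u : nat -> V) :
  bounded_op_on D C T -> (forall v, cspan u v -> D v) ->
  forall v, cspan u v -> cspan (T \o u) (T v).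
Proof.
move=> bT uD v hv e e0; have [c [c0 hc]] := op_on_bound bT.
have [z [hz vz]] := hv (e / c) ltac:(by rewrite divr_gt0).
have bT' : bounded_op_on (cspan u) setT T.
  have [_ [lT _]] := bT; split=> //; split; first by move=> a x y /uD hx /uD hy; exact: lT.
  by exists c => x /uD; exact: hc.
have cs := cspan_closed u; have cz := cspan_lin hz.
exists (T z); split.
  have [N [a ->]] := hz; exists N, a.
  by rewrite (op_on_sum _ _ cs bT') // => i; exact: cspan_mem.
have [_ [lT _]] := bT'; have [_ [cD _]] := cs.
have -> : T v - T z = T (v - z).
  by have := lT (-1) _ _ cz hv; rewrite !scaleN1r addrC => ->; rewrite addrC.
apply: le_lt_trans (hc _ _) _; last by rewrite mulrC -ltr_pdivlMr.
by apply: uD; rewrite -[v - z]addrC -scaleN1r; exact: cD.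
Qed.

End Operators.

Section Unconditional.
Variables (Y : normedModType RR) (y : nat -> Y).

Lemma dual_ballN (phi : Y -> RR) : dual_ball phi -> dual_ball (fun v => - phi v).
Proof.
move=> [h1 h2]; split=> [a u v|v]; last by rewrite normrN.
by rewrite h1 opprD mulrN.
Qed.

Lemma dual_ball_lowE phi d E : dual_ball phi -> (forall i, i \in E -> d <= phi (y i)) ->
  lowE y d E.
Proof.
move=> bp h a a0; apply: le_trans (bp.2 _); apply: le_trans (ler_norm _).
rewrite (lin_sum _ _ _ (dual_ball_lin bp)) big_distrr /= big_seq [leRHS]big_seq.
by apply: ler_sum => i iE; rewrite mulrC ler_wpM2l // h.
Qed.

Lemma lowE_dual_ball d E : sorted ltn E -> lowE y d E ->
  exists phi, dual_ball phi /\ forall i, i \in E -> d <= phi (y i).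
Proof.
move=> sE h; apply: lowE_functional => E' sE' /allP sub.
by apply: lowE_hered h _ => //; exact: sorted_subset_subseq.
Qed.

(** An infinite set whose two first elements are i and j, so that [nash_williams] yields Ramsey's
    theorem for pairs; in [Psi_dense] it provides sets differing only in the first point. *)
Definition pairq i j n := (if n is m.+1 then j + m else i)%N.

Lemma pairq_sincr i j : (i < j)%N -> strictly_incr (pairq i j).
Proof. by move=> ij [|n] /=; rewrite ?addn0 // addnS. Qed.

(* Ramsey for pairs makes the signs constant, and then weak nullity is contradicted. *)
Lemma weakly_null_no_large M e : weakly_null y -> strictly_incr M -> 0 < e ->
  ~ forall r, exists phi, dual_ball phi /\ forall s, (s < r)%N -> e < `|phi (y (M s))|.
Proof.
move=> wy sM e0 /choice[phi hphi].
pose O (s : seq nat) := (1 < size s)%N /\ 0 < phi (nth 0%N s 1) (y (M (nth 0%N s 0))).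
have Oext s t : O s -> O (s ++ t).
  move=> [h1 h2]; rewrite /O size_cat ltn_addr // !nth_cat h1 ltnW //.
have [p [sp hp]] := nash_williams Oext sincr_id.
have [th hth] : exists th : nat -> Y -> RR, (forall j, dual_ball (th j)) /\
    forall i j, (i < j)%N -> e <= th j (y (M (p i))).
  case: hp => hp.
    exists (fun j => phi (p j)); split=> [j|i j ij]; first by case: (hphi (p j)).
    have [k [+ +]] := hp _ (pairq_sincr ij); rewrite size_mkseq => k1.
    rewrite !nth_mkseq ?(ltnW k1) //= addn0 => ph.
    have [_ /(_ (p i))] := hphi (p j); rewrite sincr_ltE // => /(_ ij)/ltW.
    by rewrite gtr0_norm.
  exists (fun j v => - phi (p j) v); split=> [j|i j ij].
    by apply: dual_ballN; case: (hphi (p j)).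
  have := hp _ 2%N (pairq_sincr ij); rewrite /O /= addn0 => /not_andP[//|/negP].
  rewrite -leNgt => ph; have [_ /(_ (p i))] := hphi (p j).
  by rewrite sincr_ltE // => /(_ ij)/ltW; rewrite ler0_norm.
have [k []] := weakly_null_wfd wy e0 (sincr_comp sM sp).
apply: (dual_ball_lowE (hth.1 k)) => i /mapP[j]; rewrite mem_iota add0n => /andP[_ jk] ->.
exact: hth.2.
Qed.

Variables (d : RR) (eps : nat -> RR).
Hypotheses (wy : weakly_null y) (eps0 : forall n, 0 < eps n).

Let K (u F : seq nat) (phi : Y -> RR) := [/\ dual_ball phi, forall i, i \in F -> d <= phi (y i) &
  forall i, (i < size u)%N -> nth 0%N u i \notin F -> `|phi (y (nth 0%N u i))| <= eps i].

Let up (phi : Y -> RR) (N : nat -> nat) j := forall i, (0 < i <= j)%N -> d <= phi (y (N i)).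

(** The requirement to be fused: [N 0] is the next point of the subsequence, and a functional can be
    made small there without spoiling its bounds on F, on the earlier points and at the later points
    [N 1], ..., [N j]. *)
Let Psi (u : seq nat) F (A : nat -> Prop) := forall N j, strictly_incr N -> (forall i, A (N i)) ->
  (exists phi, K u F phi /\ up phi N j) ->
  exists phi, [/\ K u F phi, up phi N j & `|phi (y (N 0%N))| <= eps (size u)].

(** Nash-Williams is applied to the failures of [Psi]. If failures were unavoidable, for each r some
    functional would be large at all of the first r points, which [weakly_null_no_large] forbids. *)
Let Psi_dense u F A : infin A -> exists A', infin A' /\ (forall n, A' n -> A n) /\ Psi u F A'.
Proof.
move=> /infin_enum[L [sL LA]].
pose O (s : seq nat) := exists j, [/\ (j < size s)%N,
  exists phi, K u F phi /\ up phi (nth 0%N s) j &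
  forall phi, K u F phi -> up phi (nth 0%N s) j -> eps (size u) < `|phi (y (nth 0%N s 0))|].
have upeq phi N N' j : (forall i, (i <= j)%N -> N i = N' i) -> up phi N j -> up phi N' j.
  by move=> e h i hi; rewrite -e ?h //; case/andP: hi.
have Oext s t : O s -> O (s ++ t).
  move=> [j [h1 [phi [h2 h3]] h4]]; exists j.
  have e i : (i <= j)%N -> nth 0%N s i = nth 0%N (s ++ t) i.
    by move=> ij; rewrite nth_cat (leq_ltn_trans ij).
  split; first by rewrite size_cat ltn_addr.
    by exists phi; split=> //; exact: upeq h3.
  move=> th hK hu; rewrite -e //; apply: h4 => //.
  by apply: upeq hu => i hi; rewrite e.
have [p [sp [hp|hp]]] := nash_williams Oext sL; last first.
  exists (fun n => exists i, n = (L \o p) i).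
  have sLp := sincr_comp sL sp.
  split; first exact: infin_range; split; first by move=> n [i ->]; exact: LA.
  move=> N j sN /(sincr_factor sLp sN)[q [sq eN]] [phi [hK hu]]; apply: contrapT => nex.
  apply: (hp q j.+1 sq).
  have e i : (i <= j)%N -> N i = nth 0%N (mkseq (L \o p \o q) j.+1) i.
    by move=> ij; rewrite nth_mkseq // eN.
  exists j; rewrite size_mkseq; split=> //.
    by exists phi; split=> //; exact: upeq hu.
  move=> th hKt hut; rewrite -e // ltNge; apply/negP => le.
  by apply: nex; exists th; split=> //; apply: upeq hut => i hi; rewrite e.
exfalso; have sLp := sincr_comp sL sp.
apply: (weakly_null_no_large wy sLp (eps0 (size u))) => r.
have /choice[J hJ] : forall s, exists j, (s < r)%N ->
    (exists phi, K u F phi /\ up phi ((L \o p) \o pairq s r) j) /\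
    forall phi, K u F phi -> up phi ((L \o p) \o pairq s r) j ->
      eps (size u) < `|phi (y ((L \o p) s))|.
  move=> s; case: (ltnP s r) => sr; last by exists 0%N.
  have [k [j [+ [phi [h2 h3]] h4]]] := hp _ (pairq_sincr sr).
  rewrite size_mkseq => jk; exists j => _.
  have e i : (i <= j)%N -> nth 0%N (mkseq (L \o p \o pairq s r) k) i = L (p (pairq s r i)).
    by move=> ij; rewrite nth_mkseq // (leq_ltn_trans ij).
  split; first by exists phi; split=> //; apply: upeq h3 => i /e.
  move=> th hK hu; have := h4 th hK; rewrite e //=; apply.
  by apply: upeq hu => i /e.
have [r0|r0] := posnP r.
  have [phi [bp _]] := norming (0 : Y); exists phi; split=> // s; by rewrite r0.
(* The sets [pairq s r] share everything after the first point. A functional belonging to the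
   largest [J s] meets the conditions for every other s, and is therefore large at all of them. *)
case: (@arg_maxnP _ (Ordinal r0) xpredT (fun s : 'I_r => J s)) => // m _ hm.
have [[phi [hK hu]] _] := hJ m (ltn_ord m).
exists phi; split; first by case: hK.
move=> s sr; have [_ h] := hJ s sr; apply: h => // i /andP[i0 iJ].
have := hu i; rewrite i0 (leq_trans iJ (hm (Ordinal sr) isT)) => /(_ isT).
by case: i i0 {iJ}.
Qed.

(** After fusion over all subsets of the points chosen so far, a functional large on F is corrected
    at the successive points outside F, each correction preserving the earlier ones. *)
Lemma schreier_unconditional L : strictly_incr L -> exists p, strictly_incr p /\
  forall N F, sorted ltn F -> (forall i, i \in F -> (i < N)%N) ->
    (exists phi, dual_ball phi /\ forall i, i \in F -> d <= phi (y (L (p i)))) ->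
    exists phi, [/\ dual_ball phi, forall i, i \in F -> d <= phi (y (L (p i))) &
      forall i, (i < N)%N -> i \notin F -> `|phi (y (L (p i)))| <= eps i].
Proof.
move=> sL.
have mono u F A A' : (forall n, A' n -> A n) -> Psi u F A -> Psi u F A'.
  by move=> sA h N j sN hN; apply: h => // i; exact: sA.
have [a [sa [aL ha]]] : exists a, strictly_incr a /\ (forall k, exists i, a k = L i) /\
    forall k F, F \in subs (mkseq a k) -> Psi (mkseq a k) F (fun n => exists i, n = a (k + i)%N).
  apply: (@fusion (fun u A => forall F, F \in subs u -> Psi u F A) _ _ _ (infin_range sL)).
    by move=> u A A' sA h F /h; exact: mono.
  move=> u A iA sA; apply: (@dense_list _ _ (fun F A => Psi u F A)) => //.
    by move=> F A1 A2; exact: mono.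
  by move=> F A' iA' _; exact: Psi_dense.
have [p [sp ep]] := sincr_factor sL sa aL; exists p; split=> // N F sF FN [phi0 [b0 h0]].
have ea i : L (p i) = a i by rewrite ep.
pose Fk k := [seq i <- F | (i < k)%N].
have main k : exists phi, K (mkseq a k) (map a (Fk k)) phi /\
    forall i, i \in F -> (k <= i)%N -> d <= phi (y (a i)).
  elim: k => [|k [phi [[b1 b2 b3] b4]]].
    exists phi0; split; last by move=> i iF _; rewrite -ea h0.
    by split=> // i /mapP[j]; rewrite mem_filter.
  have Fk_sub : subseq (map a (Fk k)) (mkseq a k).
    apply: map_subseq; apply: sorted_subset_subseq.
    - exact: sorted_filter ltn_trans _ _ sF.
    - exact: iota_ltn_sorted.
    - by move=> i; rewrite mem_filter mem_iota => /andP[].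
  have memk i : (a i \in map a (Fk k.+1)) = (i \in F) && (i < k.+1)%N.
    by rewrite mem_map; [rewrite mem_filter andbC|exact: sincr_inj].
  have memk' i : (a i \in map a (Fk k)) = (i \in F) && (i < k)%N.
    by rewrite mem_map; [rewrite mem_filter andbC|exact: sincr_inj].
  have fin th : K (mkseq a k) (map a (Fk k)) th ->
      (forall i, i \in F -> (k <= i)%N -> d <= th (y (a i))) ->
      (k \notin F -> `|th (y (a k))| <= eps k) ->
      exists phi, K (mkseq a k.+1) (map a (Fk k.+1)) phi /\
       forall i, i \in F -> (k < i)%N -> d <= phi (y (a i)).
    move=> [c1 c2 c3] c4 c5; exists th; split; last by move=> i iF /ltnW; exact: c4.
    split=> // [i /mapP[j + ->]|i].
      rewrite mem_filter ltnS leq_eqVlt => /andP[/orP[/eqP-> kF|jk jF]]; first exact: c4.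
      by apply: c2; rewrite memk' jF.
    rewrite size_mkseq => ik; rewrite nth_mkseq // memk ik andbT => iF.
    move: ik; rewrite ltnS leq_eqVlt => /orP[/eqP ik|ik].
      by rewrite ik; apply: c5; rewrite -ik.
    have := c3 i; rewrite size_mkseq nth_mkseq // memk' (negbTE iF); exact.
  have [kF|kF] := boolP (k \in F); first by apply: (fin phi) => //; rewrite kF.
  (* To correct at k, the set to which [Psi] is applied starts with k and continues with the points
     of F beyond k, where the bound d must be kept. *)
  pose G := [seq i <- F | (k < i)%N].
  have sG : sorted ltn (k :: G).
    rewrite /= path_min_sorted ?sorted_filter //; first exact: ltn_trans.
    by apply/allP => i; rewrite mem_filter => /andP[].
  have [q [sq eq]] := sorted_extend sG.
  have eqn i : (i < (size G).+1)%N -> q i = nth 0%N (k :: G) i.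
    by move=> hi; rewrite -[k :: G]eq nth_mkseq.
  have upq th : up th (a \o q) (size G) <-> forall i, i \in F -> (k < i)%N -> d <= th (y (a i)).
    split=> [h i iF ki|h i /andP[i0 iG]].
      have iG : i \in G by rewrite mem_filter ki.
      have := h (index i G).+1; rewrite /= index_mem iG eqn ?ltnS ?index_mem //= nth_index //.
      exact.
    rewrite /= eqn ?ltnS //; case: i i0 iG => // i _ iG /=.
    by have := mem_nth 0%N iG; rewrite mem_filter => /andP[ki iF]; exact: h.
  have [||||th [c1 c2 c3]] := ha k (map a (Fk k)) _ (a \o q) (size G).
  - by rewrite mem_subs.
  - exact: sincr_comp.
  - move=> i; exists (q i - k)%N => /=; congr a; rewrite subnKC //.
    by have -> : k = q 0%N; [rewrite eqn|exact: sincr_le].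
  - by exists phi; split=> //; apply/upq => i iF /ltnW; exact: b4.
  apply: (fin th) => //; last first.
    by move=> _; move: c3; rewrite /= size_mkseq eqn.
  move=> i iF; rewrite leq_eqVlt => /orP[/eqP e|]; last exact: (upq th).1 c2 i iF.
  by rewrite -e (negbTE kF) in iF.
have [phi [[b1 b2 b3] b4]] := main N; exists phi; split=> //.
  move=> i iF; rewrite ea; apply: b2; rewrite mem_map ?mem_filter ?iF ?FN //.
  exact: sincr_inj.
move=> i iN iF; rewrite ea; have := b3 i.
rewrite size_mkseq nth_mkseq // mem_map ?mem_filter; last exact: sincr_inj.
by rewrite (negbTE iF) andbF; apply.
Qed.

End Unconditional.

(** * The unit vector basis of a mixed Schreier space *)

Definition wt (n : nat) : RR := n.+1%:R^-1.

Lemma wt_gt0 n : 0 < wt n <= 1.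
Proof. by rewrite /wt invr_gt0 ltr0n /= invf_le1 ?ltr0n // ler1n. Qed.

Lemma wt_null (e : RR) : 0 < e -> exists K, forall n, (K <= n)%N -> wt n < e.
Proof. exact: inv_succ_lt. Qed.

Section Units.
Variable P : mixed_data.

Lemma mval_list (s : seq nat) (a : nat -> RR) p j :
  mval (\sum_(i <- s) a i *: munit P (p i)) j = \sum_(i <- s | p i == j) a i.
Proof.
rewrite mval_sum [RHS]big_mkcond; apply: eq_bigr => i _ /=.
by rewrite eq_sym; case: eqP; rewrite ?mulr1 ?mulr0.
Qed.

Lemma sum_mval_list (s E : seq nat) (a : nat -> RR) p : (forall i, 0 <= a i) -> sorted ltn E ->
  \sum_(j <- E) `|mval (\sum_(i <- s) a i *: munit P (p i)) j| = \sum_(i <- s | p i \in E) a i.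
Proof.
move=> a0 sE; under eq_bigr do rewrite mval_list ger0_norm ?sumr_ge0 //.
rewrite (exchange_big_dep predT) //= [RHS]big_mkcond; apply: eq_bigr => i _.
rewrite (eq_bigl (fun j => j == p i)); last by move=> j; rewrite eq_sym.
rewrite -big_filter; case: (boolP (p i \in E)) => h.
  by rewrite filter_pred1_uniq ?big_seq1 // (sorted_uniq ltn_trans ltnn).
rewrite big_filter big_seq_cond big_pred0 // => j.
by apply/negP => /andP[jE /eqP e]; rewrite -e jE in h.
Qed.

Lemma munit_lowE n E : mF P n E -> sorted ltn E -> lowE (munit P) (mw P n) E.
Proof.
move=> FE sE a a0; apply: le_trans (msum_le _ sE FE); rewrite ler_wpM2l //.
  by case/andP: (mw_gt0 P n) => /ltW.
by rewrite (sum_mval_list E id a0 sE) -big_seq.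
Qed.

Lemma munit_bounded : bounded_seq (munit P).
Proof.
exists 1 => i; apply: mixed_norm_le => n E sE FE.
have /andP[w0 w1] := mw_gt0 P n; apply: mulr_ile1 => //; [exact: ltW|exact: sumr_ge0|].
have := @sum_mval_list [:: i] E (fun=> 1) id (fun=> ler01) sE.
rewrite big_seq1 scale1r => ->; rewrite big_mkcond big_seq1.
by case: ifP => _; rewrite ?lexx ?ler01.
Qed.

(** Levels of small weight never norm a probability vector by more than d/2; the finitely many
    others are handled by one average small on all of them. *)
Lemma munit_wn xi :
  (forall e : RR, 0 < e -> exists K, forall n, (K <= n)%N -> mw P n < e) ->
  (forall K p (eps : RR), strictly_incr p -> 0 < eps ->
    exists F a, [/\ sorted ltn F, Schr xi F, (forall i, 0 <= a i), \sum_(i <- F) a i = 1 &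
    forall k E, (k < K)%N -> sorted ltn E -> mF P k E ->
      \sum_(i <- F | p i \in E) a i <= eps]) ->
  wn xi (munit P).
Proof.
move=> hw small; split; first exact: munit_bounded.
move=> d d0 [p [sp hp]]; have d2 : 0 < d / 2 by rewrite divr_gt0.
have [K hK] := hw _ d2; have [F [a [f1 f2 f3 f4 f5]]] := small K p _ sp d2.
have := (lowE_map (munit P) d F sp).2 (hp F f1 f2) a f3; rewrite f4 mulr1.
suff : `|\sum_(i <- F) a i *: munit P (p i)| <= d / 2 by move=> h /le_trans/(_ h); lra.
apply: mixed_norm_le => n E sE FE; rewrite sum_mval_list //.
have /andP[w0 w1] := mw_gt0 P n; have s0 : 0 <= \sum_(i <- F | p i \in E) a i by exact: sumr_ge0.
case: (ltnP n K) => nK; first by apply: le_trans (f5 n E nK sE FE); rewrite ler_piMl.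
apply: le_trans (ltW (hK n nK)); rewrite ler_piMr ?(ltW w0) // -f4; exact: sum_sub_le.
Qed.

End Units.

Section UpperEstimate.
Variables (X : normedModType RR) (x : nat -> X) (B : RR) (F : fam) (M : nat -> nat).
Hypotheses (B0 : 0 < B) (xB : forall i, `|x i| <= B).
Hypothesis hM : forall j E, sorted ltn E -> (forall i, i \in E -> (j <= i)%N) ->
  lowE (x \o M) (B / 2 ^+ j) E -> F (map M E).

Let layer (b : RR) j : RR := if B / 2 ^+ j <= b then B / 2 ^+ j else 0.

Let pow0 j : 0 < B / 2 ^+ j. Proof. by rewrite divr_gt0 // exprn_gt0. Qed.

Let layer_cake (b : RR) J : b <= B -> b <= 2 * (B / 2 ^+ J) + \sum_(j < J) layer b j.
Proof.
move=> bB; elim: J => [|J IH]; first by rewrite big_ord0 expr0 divr1; apply: le_trans bB _; rewrite addr0 ler_peMl ?ler1n // ltW.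
have e : B / 2 ^+ J.+1 = B / 2 ^+ J / 2 by rewrite exprSr invfM mulrA.
rewrite big_ord_recr /= [layer b J]/layer e; case: (leP (B / 2 ^+ J) b) => h /=; first lra.
have : 0 <= \sum_(j < J) layer b j.
  by apply: sumr_ge0 => j _; rewrite /layer; case: ifP => // _; exact: ltW.
lra.
Qed.

Let layer_sum J : \sum_(j < J) (j%:R + 2) * (B / 2 ^+ j) <= 6 * B.
Proof.
have -> : \sum_(j < J) (j%:R + 2) * (B / 2 ^+ j) = 6 * B - 2 * (J%:R + 3) * (B / 2 ^+ J).
  elim: J => [|J IH]; first by rewrite big_ord0 expr0; field.
  rewrite big_ord_recr /= IH.
  have -> : B / 2 ^+ J.+1 = B / 2 ^+ J / 2 by rewrite exprSr invfM mulrA.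
  rewrite -natr1; field; by rewrite expf_neq0.
by rewrite lerBlDr lerDl !mulr_ge0 ?ltW // addr_gt0 ?ltr0n // ltr_wpDl ?ler0n.
Qed.

(** A norming functional is split into dyadic layers. Layer j costs at most (j+2) S: the first j
    indices, and the two sets where phi or its opposite is large. The sum of (j+2)/2^j is 6 and the
    remainder below the last layer costs 2, whence 8. *)
Lemma upper_estimate N (a : nat -> RR) S :
  (forall E, sorted ltn E -> F (map M E) -> (forall i, i \in E -> (i < N)%N) ->
     \sum_(i <- E) `|a i| <= S) ->
  (forall i, (i < N)%N -> `|a i| <= S) ->
  `|\sum_(i < N) a i *: x (M i)| <= 8 * B * S.
Proof.
move=> aS a1.
have S0 : 0 <= S.
  have := aS [::] isT; rewrite big_nil; apply=> //.
  by apply: (@hM 0%N [::]) => //; exact: lowE_nil.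
have [phi [bp <-]] := norming (\sum_(i < N) a i *: x (M i)).
rewrite (lin_sum _ _ (fun i : 'I_N => x (M i)) (dual_ball_lin bp)).
apply: (@le_trans _ _ (\sum_(i < N) `|a i| * `|phi (x (M i))|)).
  by apply: ler_sum => i _; rewrite -normrM ler_norm.
have bB i : `|phi (x (M i))| <= B by apply: le_trans (bp.2 _) (xB _).
apply: (@le_trans _ _ (\sum_(i < N) `|a i| * (2 * (B / 2 ^+ N) +
    \sum_(j < N) layer `|phi (x (M i))| j))).
  by apply: ler_sum => i _; rewrite ler_wpM2l // layer_cake.
under eq_bigr do rewrite mulrDr mulr_sumr.
rewrite big_split /= exchange_big /=.
have h1 : \sum_(i < N) `|a i| * (2 * (B / 2 ^+ N)) <= 2 * B * S.
  rewrite -big_distrl /=.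
  have : \sum_(i < N) `|a i| <= N%:R * S.
    apply: (@le_trans _ _ (\sum_(i < N) S)); first by apply: ler_sum => i _; exact: a1.
    by rewrite sumr_const card_ord mulr_natl.
  move=> h; apply: le_trans (ler_wpM2r _ h) _; first by rewrite mulr_ge0 // ltW.
  have : N%:R / 2 ^+ N <= 1 :> RR.
    by rewrite ler_pdivrMr ?exprn_gt0 // mul1r -natrX ler_nat ltnW // ltn_expl.
  have -> : N%:R * S * (2 * (B / 2 ^+ N)) = 2 * B * S * (N%:R / 2 ^+ N) by ring.
  by move=> h'; rewrite ler_piMr // !mulr_ge0 // ltW.
have h2 : \sum_(j < N) \sum_(i < N) `|a i| * layer `|phi (x (M i))| j <= 6 * B * S.
  apply: (@le_trans _ _ (\sum_(j < N) (j%:R + 2) * (B / 2 ^+ j) * S)); last first.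
    by rewrite -big_distrl /=; apply: ler_wpM2r => //; exact: layer_sum.
  apply: ler_sum => j _.
  rewrite mulrAC.
  rewrite (eq_bigr (fun i : 'I_N => (if B / 2 ^+ j <= `|phi (x (M i))| then `|a i| else 0) * (B / 2 ^+ j))); last first.
    by move=> i _; rewrite /layer; case: ifP => _; rewrite ?mulr0 ?mul0r.
  rewrite -big_distrl /= ler_wpM2r ?(ltW (pow0 j)) //.
  pose Q (th : X -> RR) := [seq i <- iota 0 N | (j <= i)%N && (B / 2 ^+ j <= th (x (M i)))].
  have sQ th : sorted ltn (Q th) by apply: sorted_filter; [exact: ltn_trans|exact: iota_ltn_sorted].
  have hQ th : dual_ball th -> \sum_(i <- Q th) `|a i| <= S.
    move=> bt; apply: aS => //; last by move=> i; rewrite mem_filter mem_iota => /andP[_].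
    apply: (@hM j) => // [i|]; first by rewrite mem_filter => /andP[/andP[]].
    apply: (@dual_ball_lowE _ (x \o M) th) => // i.
    by rewrite mem_filter => /andP[/andP[]].
  have h3 := hQ _ bp; have h4 := hQ _ (dual_ballN bp).
  have h5 : \sum_(i <- iota 0 (minn j N)) `|a i| <= j%:R * S.
    apply: (@le_trans _ _ (\sum_(i <- iota 0 (minn j N)) S)).
      rewrite big_seq [leRHS]big_seq; apply: ler_sum => i.
      by rewrite mem_iota add0n => /andP[_]; rewrite leq_min => /andP[_ hi]; exact: a1.
    rewrite big_const_seq count_predT size_iota iter_addr addr0 -[leLHS]mulr_natl.
    by rewrite ler_wpM2r // ler_nat geq_minl.
  rewrite -(big_mkord xpredT (fun i => if B / 2 ^+ j <= `|phi (x (M i))| then `|a i| else 0)).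
  rewrite /index_iota subn0.
  suff h6 : \sum_(i <- iota 0 N) (if B / 2 ^+ j <= `|phi (x (M i))| then `|a i| else 0) <=
     \sum_(i <- iota 0 (minn j N)) `|a i| + \sum_(i <- Q phi) `|a i| + \sum_(i <- Q (fun v => - phi v)) `|a i|.
    lra.
  have -> : iota 0 (minn j N) = [seq i <- iota 0 N | (i < j)%N].
    apply: (irr_sorted_eq ltn_trans ltnn); rewrite ?iota_ltn_sorted //.
      by apply: sorted_filter; [exact: ltn_trans|exact: iota_ltn_sorted].
    by move=> i; rewrite mem_filter !mem_iota !add0n leq_min.
  rewrite /Q !big_filter [X in _ <= X + _ + _]big_mkcond [X in _ <= _ + X + _]big_mkcond [X in _ <= _ + _ + X]big_mkcond.
  rewrite -!big_split /=; apply: ler_sum => i _.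
  rewrite ler_normr; have := normr_ge0 (a i); case: (ltnP i j) => /= _.
    by case: (_ || _); rewrite ?addr0; lra.
  by case: (B / 2 ^+ j <= phi (x (M i))); case: (B / 2 ^+ j <= - phi (x (M i))) => /=; lra.
lra.
Qed.

End UpperEstimate.

(** * The positive result for mixed Schreier spaces *)

Lemma op_on_comp (V W Z : normedModType RR) (D : set V) (C : set W) (E : set Z) T T' :
  bounded_op_on D C T -> bounded_op_on C E T' -> bounded_op_on D E (T' \o T).
Proof.
move=> bT bT'; have [c [c0 hc]] := op_on_bound bT; have [c' [c'0 hc']] := op_on_bound bT'.
have [DT [lT _]] := bT; have [CT' [lT' _]] := bT'.
split; first by move=> v /DT/CT'.
split; first by move=> a u v Du Dv /=; rewrite lT // lT' //; exact: DT.
exists (c' * c) => v Dv /=; apply: le_trans (hc' _ (DT _ Dv)) _.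
by rewrite -mulrA ler_wpM2l ?hc // ltW.
Qed.

Lemma op_on_restrict (V W : normedModType RR) (D : set V) (T : V -> W) :
  bounded_op T -> bounded_op_on D setT T.
Proof.
by move=> [_ [lT [c hc]]]; split=> //; split; [move=> a u v _ _; exact: lT|exists c => v _; exact: hc].
Qed.

Lemma weakly_null_op (V W : normedModType RR) (T : V -> W) x :
  bounded_op T -> weakly_null x -> weakly_null (T \o x).
Proof.
move=> bT wx phi [l1 [c hc]]; apply: (wx (phi \o T)).
have [_ [lT _]] := bT; have [c' [c'0 hc']] := op_on_bound bT.
split=> [a u v /=|]; first by rewrite lT // l1.
exists (`|c| * c') => v /=; apply: le_trans (hc _) _.
apply: (@le_trans _ _ (`|c| * `|T v|)); first by rewrite ler_wpM2r // ler_norm.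
by rewrite -mulrA ler_wpM2l // hc'.
Qed.

Lemma geo_sum_le1 N : \sum_(i < N) (2 ^- i.+1 : RR) <= 1.
Proof.
have -> : \sum_(i < N) (2 ^- i.+1 : RR) = 1 - 2 ^- N.
  elim: N => [|N IH]; first by rewrite big_ord0 expr0 invr1 subrr.
  have e : 2 ^- N = 2 * 2 ^- N.+1 :> RR by rewrite exprS invfM mulrA divff ?mul1r.
  rewrite big_ord_recr /= IH e; ring.
by rewrite gerBl invr_ge0 exprn_ge0.
Qed.

Section CombM.
Variables (P : mixed_data) (M : nat -> nat).
Hypothesis sM : strictly_incr M.

Lemma mval_combM N (a : nat -> RR) k :
  mval (\sum_(j < N) a j *: munit P (M j)) (M k) = if (k < N)%N then a k else 0.
Proof.
rewrite mval_sum /=; case: (ltnP k N) => h.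
  rewrite (bigD1 (Ordinal h)) //= eqxx mulr1 big1 ?addr0 // => j.
  rewrite -val_eqE /= => jk; rewrite (inj_eq (sincr_inj sM)) eq_sym (negbTE jk).
  by rewrite mulr0.
rewrite big1 // => j _; rewrite (inj_eq (sincr_inj sM)) gtn_eqF ?mulr0 //.
exact: leq_trans h.
Qed.

Lemma sum_mval_combM N (a : nat -> RR) E : sorted ltn E ->
  \sum_(i <- E) `|mval (\sum_(j < N) a j *: munit P (M j)) i| <=
  \sum_(k <- iota 0 N | M k \in E) `|a k|.
Proof.
move=> sE; have := @sum_mval_list P (iota 0 N) E (fun k => `|a k|) M (fun k => normr_ge0 _) sE.
move=> <-; apply: ler_sum => i _.
rewrite -(big_mkord xpredT (fun j => a j *: munit P (M j))) /index_iota subn0 !mval_list.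
rewrite [leRHS]ger0_norm ?sumr_ge0 //; exact: ler_norm_sum.
Qed.

End CombM.

Section Universal.
Variables (P1 P2 : mixed_data) (beta z b : ord) (n0 : nat).
Hypotheses (wfbeta : wf_ord beta) (wfz : wf_ord z) (bb : ole beta b).
Hypotheses (Pb : forall E, Schr b E -> mF P1 n0 E) (Pz : forall n, mF P2 n = Schr z)
  (w0 : mw P2 0%N = 1).

Section Construction.
Variables (X Y : normedModType RR) (A : X -> Y) (x : nat -> X) (d B : RR) (L : nat -> nat).
Hypotheses (bA : bounded_op A) (wx : wn b x) (d0 : 0 < d) (B0 : 0 < B) (xB : forall i, `|x i| <= B).
Hypothesis low : forall E, sorted ltn E -> Schr z E -> lowE (A \o x) d E.
Hypothesis sL : strictly_incr L.

(** Two refinements. Weak nullity excludes the large alternative of the dichotomy at each dyadic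
    level, which feeds [upper_estimate]; unconditionality of [A \o x] on the result then gives the
    lower bound. *)
Lemma dominated_subsequence : exists p, strictly_incr p /\
  (forall N (a : nat -> RR), `|\sum_(i < N) a i *: x (L (p i))| <=
     8 * B / mw P1 n0 * `|\sum_(i < N) a i *: munit P1 (L (p i))|) /\
  (forall N (a : nat -> RR), `|\sum_(i < N) a i *: munit P2 (L (p i))| <=
     4 / d * `|\sum_(i < N) a i *: A (x (L (p i)))|).
Proof.
have wy : weakly_null (A \o x) by apply: weakly_null_op => //; exact: wn_weakly_null wx.
have step j M : strictly_incr M -> exists p, strictly_incr p /\
    forall E, sorted ltn E -> lowE x (B / 2 ^+ j) (map (M \o p) E) -> Schr b (map (M \o p) E).
  move=> sM.
  have [p [sp [h|h]]] := dichotomy (@Schr_hered b) (Schr_nil b) (@lowE_hered _ x (B / 2 ^+ j)) sM.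
    by exists p.
  exfalso; apply: (wx.2 (B / 2 ^+ j)); first by rewrite divr_gt0 // exprn_gt0.
  have sMp := sincr_comp sM sp.
  exists (M \o p); split=> // E sE hE; apply: h => //.
  exact: (spreading_sincr (@Schr_spreading b) sE sMp hE).
have [p0 [M0 [sp0 _ hM0 hD]]] := @diagonalize
   (fun j M => forall E, sorted ltn E -> lowE x (B / 2 ^+ j) (map M E) -> Schr b (map M E))
   L id step sL.
have sLp0 := sincr_comp sL sp0.
(* These errors sum to at most d/4, small enough to be absorbed at the end of the lower estimate. *)
have eps0 i : 0 < d / 4 * 2 ^- i.+1 by rewrite !mulr_gt0 ?invr_gt0 ?exprn_gt0.
have [p1 [sp1 unc]] := schreier_unconditional d wy eps0 sLp0.
pose M := L \o p0 \o p1; have sM : strictly_incr M := sincr_comp sLp0 sp1.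
exists (p0 \o p1); split; first exact: sincr_comp.
split=> N a.
- set v1 := \sum_(i < N) a i *: munit P1 (M i).
  have /andP[wn0 _] := mw_gt0 P1 n0.
  have e1 : 8 * B / mw P1 n0 * `|v1| = 8 * B * (`|v1| / mw P1 n0) by ring.
  rewrite [leRHS]e1; have bound E : sorted ltn E -> Schr b (map M E) ->
      (forall i, i \in E -> (i < N)%N) -> \sum_(i <- E) `|a i| <= `|v1| / mw P1 n0.
    move=> sE hE EN; rewrite ler_pdivlMr // mulrC.
    apply: le_trans (msum_le v1 (sorted_map_sincr sM sE) (Pb hE)).
    rewrite ler_wpM2l ?(ltW wn0) // big_map big_seq [leRHS]big_seq.
    by apply: ler_sum => i /EN iN; rewrite mval_combM // iN.
  apply: (@upper_estimate X x B (Schr b) M B0 xB) => //.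
    move=> j E sE jE /(lowE_map _ _ _ sM).
    have -> : map M E = map (L \o p0) (map p1 E) by rewrite -map_comp.
    have [|D [sD ->]] := hD j (map p1 E) (sorted_map_sincr sp1 sE).
      move=> i /mapP[k kE ->]; exact: leq_trans (jE k kE) (sincr_ge k sp1).
    by have [_ h] := hM0 j; exact: h.
  move=> i iN; have := bound [:: i]; rewrite big_seq1; apply=> //; first exact: Schr1.
  by move=> k; rewrite inE => /eqP->.
- set v2 := \sum_(i < N) a i *: munit P2 (M i).
  set vy := \sum_(i < N) a i *: A (x (M i)).
  have am i : (i < N)%N -> `|a i| <= `|v2|.
    move=> iN; have := coord_le v2 (M i); rewrite w0 mul1r mval_combM // iN; exact.
  have key (a' : nat -> RR) F : sorted ltn F -> (forall i, i \in F -> (i < N)%N) ->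
      Schr z (map M F) -> (forall i, `|a' i| = `|a i|) -> (forall i, i \in F -> 0 <= a' i) ->
      d * \sum_(i <- F) `|a i| <= `|\sum_(i < N) a' i *: A (x (M i))| + d / 4 * `|v2|.
    move=> sF FN hF a'a a'0.
    have lowF := low (sorted_map_sincr sM sF) hF.
    have [phi0 [b0 h0]] := lowE_dual_ball (sorted_map_sincr sM sF) lowF.
    have [|phi [b1 b2 b3]] := unc N F sF FN.
      by exists phi0; split=> // i iF; apply: h0; exact: map_f.
    rewrite -lerBlDr; apply: le_trans (b1.2 _); apply: le_trans (ler_norm _).
    rewrite (lin_sum _ _ (fun i : 'I_N => A (x (M i))) (dual_ball_lin b1)).
    rewrite (bigID (fun i : 'I_N => val i \in F)) /=; apply: lerD.
      rewrite big_distrr /= -(big_mkord (fun i => i \in F) (fun i => a' i * phi (A (x (M i))))).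
      rewrite /index_iota subn0 -[leRHS]big_filter -sorted_subset_filter //; last 2 first.
      - exact: iota_ltn_sorted.
      - by move=> i /FN; rewrite mem_iota add0n.
      rewrite big_seq [leRHS]big_seq; apply: ler_sum => i iF.
      rewrite -a'a ger0_norm ?a'0 // mulrC ler_wpM2l ?a'0 //; exact: b2.
    rewrite lerNl -sumrN; apply: (@le_trans _ _ (\sum_(i < N) d / 4 * `|v2| * 2 ^- i.+1)).
      rewrite big_mkcond; apply: ler_sum => i _; case: ifP => iF; last first.
        by rewrite !mulr_ge0 ?invr_ge0 ?exprn_ge0 // ltW.
      apply: le_trans (ler_norm _) _; rewrite normrN normrM a'a mulrAC mulrC.
      by apply: ler_pM => //; [exact: b3|exact: am].
    by rewrite -big_distrr /= ler_piMr ?geo_sum_le1 // mulr_ge0 // divr_ge0 // ltW.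
  have vyN : `|\sum_(i < N) (- a i) *: A (x (M i))| = `|vy|.
    rewrite -normrN -sumrN; congr `|_|; apply: eq_bigr => i _; by rewrite scaleNr opprK.
  (* The coordinates with a_k >= 0 and those with a_k < 0 each cost |vy| + (d/4)|v2|; after division
     by d half of |v2| remains on the right and is moved to the left, giving 4/d. *)
  have main : `|v2| <= 2 / d * `|vy| + `|v2| / 2.
    apply: mixed_norm_le => n E sE; rewrite Pz => hE.
    apply: (@le_trans _ _ (\sum_(k <- iota 0 N | M k \in E) `|a k|)).
      apply: le_trans (@sum_mval_combM P2 M N a E sE).
      by have /andP[_ w1] := mw_gt0 P2 n; rewrite ler_piMl // sumr_ge0.
    pose Q (s : pred nat) := [seq k <- iota 0 N | (M k \in E) && s k].
    have hQ s : [/\ sorted ltn (Q s), forall i, i \in Q s -> (i < N)%N & Schr z (map M (Q s))].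
      have sQ : sorted ltn (Q s) by apply: sorted_filter; [exact: ltn_trans|exact: iota_ltn_sorted].
      split=> //; first by move=> i; rewrite mem_filter mem_iota => /andP[_ /andP[]].
      apply: (@Schr_hered z E _ sE hE); apply: sorted_subset_subseq => //.
        exact: sorted_map_sincr.
      by move=> i /mapP[k + ->]; rewrite mem_filter => /andP[/andP[]].
    have [s1 s2 s3] := hQ (fun k => 0 <= a k).
    have [t1 t2 t3] := hQ (fun k => ~~ (0 <= a k)).
    have h1 := key a _ s1 s2 s3 (fun i => erefl _).
    have h2 := key (fun k => - a k) _ t1 t2 t3 (fun i => normrN _).
    have -> : \sum_(k <- iota 0 N | M k \in E) `|a k| =
        \sum_(k <- Q (fun k => 0 <= a k)) `|a k| + \sum_(k <- Q (fun k => ~~ (0 <= a k))) `|a k|.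
      by rewrite /Q !big_filter; exact: bigID.
    have e : 2 / d * `|vy| + `|v2| / 2 = (2 * `|vy| + 2 * (d / 4 * `|v2|)) / d.
      by field; rewrite gt_eqF.
    rewrite e ler_pdivlMr // mulrC mulrDr.
    have k1 : d * \sum_(i <- Q (fun k => 0 <= a k)) `|a i| <= `|vy| + d / 4 * `|v2|.
      by apply: h1 => i; rewrite mem_filter => /andP[/andP[]].
    have k2 : d * \sum_(i <- Q (fun k => ~~ (0 <= a k))) `|a i| <= `|vy| + d / 4 * `|v2|.
      rewrite -vyN; apply: h2 => i; rewrite mem_filter => /andP[/andP[_]].
      by rewrite -ltNge oppr_ge0 => /ltW.
    apply: le_trans (lerD k1 k2) _; lra.
  have e : 4 / d * `|vy| = 2 * (2 / d * `|vy|) by ring.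
  rewrite e; lra.
Qed.

End Construction.

Variable I : mixed_space P1 -> mixed_space P2.
Hypotheses (bI : bounded_op I) (eI : forall i, I (munit P1 i) = munit P2 i).

Lemma mixed_universal : subseq_universal (Ctbl beta) (Ctbl z) (munit P1) (munit P2) I.
Proof.
move=> X Y A bA /existsNP[x0 /not_implyP[/(wnull_wn _ wfbeta) wx0 nw]] L sL.
have [c [c0 hc]] := op_on_bound bA.
have [d [d0 [s [ss hs]]]] : exists d : RR, 0 < d /\ emb (Schr z) (lowE (A \o x0) d).
  apply: contrapT => /forallNP h; apply: nw; apply/(wnull_wn _ wfz); split.
    have [[C hC] _] := wx0; exists (c * C) => n /=.
    by apply: le_trans (hc _ _) _ => //; rewrite ler_wpM2l // ltW.
  by move=> d d0 hd; apply: (h d).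
pose x := x0 \o s.
have wx : wn b x by apply: wn_ole bb _; exact: wn_sub.
have [[C hC] _] := wx.
have [p [sp [up low]]] := @dominated_subsequence X Y A x d (`|C| + 1) L bA wx d0
  ltac:(by rewrite ltr_wpDl) ltac:(by move=> i; apply: le_trans (hC i) _;
    apply: le_trans (ler_norm C) _; rewrite lerDl)
  ltac:(by move=> E sE /(hs _ sE) h; apply/(lowE_map (A \o x0) _ _ ss)) sL.
exists p; split=> //.
have [Rop [bR eR]] := @extend_op _ X (munit P1 \o (L \o p)) (x \o (L \o p)) _ up.
have [Sop [bS eS]] := @extend_op _ (mixed_space P2) (A \o x \o (L \o p)) (munit P2 \o (L \o p)) _ low.
exists (cspan (x \o (L \o p))), (cspan (A \o x \o (L \o p))), Rop, Sop.
split; first exact: cspan_closed.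
split; first exact: cspan_closed.
have bA' : bounded_op_on (cspan (x \o (L \o p))) (cspan (A \o x \o (L \o p))) A.
  have [h1 h2] := op_on_restrict (cspan (x \o (L \o p))) bA.
  by split=> // v hv; exact: (op_on_cspan bA _ hv).
split; first by case: bA'.
split=> //; split=> //.
apply: op_on_eq (op_on_restrict _ bI) (op_on_comp (op_on_comp bR bA') bS) _.
by move=> i /=; rewrite eI eR eS.
Qed.

End Universal.

(** Level 0 of the first space, of weight 1, already controls the norm of the second. That
    coordinates are preserved is recorded for the block arguments. *)
Lemma formal_identity (P1 P2 : mixed_data) (F : fam) : mw P1 0%N = 1 -> mF P1 0%N = F ->
  (forall n, mF P2 n = F) ->
  exists I : mixed_space P1 -> mixed_space P2, bounded_op I /\
    (forall i, I (munit P1 i) = munit P2 i) /\ forall v i, mval (I v) i = mval v i.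
Proof.
move=> w1 F1 F2.
have [I [bI eI]] : exists I : mixed_space P1 -> mixed_space P2,
    bounded_op_on (cspan (munit P1)) (cspan (munit P2)) I /\ forall i, I (munit P1 i) = munit P2 i.
  apply: (@extend_op _ _ _ _ 1) => N a; rewrite mul1r.
  apply: mixed_norm_le => n E sE; rewrite F2 -F1 => hE.
  have /andP[w20 w21] := mw_gt0 P2 n.
  apply: le_trans (@msum_le P1 _ 0%N E sE hE); rewrite w1 ler_pM ?sumr_ge0 ?(ltW w20) //.
  by apply: ler_sum => i _; rewrite !mval_comb.
have {}bI : bounded_op I.
  have [_ [lI [c hc]]] := bI; split=> //; split.
    by move=> a u v _ _; apply: lI; exact: mixed_space_span.
  by exists c => v _; apply: hc; exact: mixed_space_span.
exists I; split=> //; split=> // v i.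
have lin (P : mixed_data) : @bounded_op_on (mixed_space P) RR^o setT setT (fun u => mval u i).
  by have [l1 [c hc]] := mcoord_lin P i; split=> //; split=> [a u w _ _|]; [exact: l1|exists c].
have := @op_on_eq _ RR^o (munit P1) setT setT (fun u => mval (I u) i) (fun u => mval u i).
apply; last exact: mixed_space_span.
- have [_ h] := op_on_comp bI (lin P2); split=> //.
  by have [h1 [c hc]] := h; split=> [a u w _ _|]; [exact: h1|exists c => u _; exact: hc].
- have [_ [h1 [c hc]]] := lin P1; split=> //.
  by split=> [a u w _ _|]; [exact: h1|exists c => u _; exact: hc].
by move=> j; rewrite eI.
Qed.

(** One space serves all beta: by cofinality beta lies below some [g n], and level n+1 contains
    [Schr (g n)]. Only the constant, through the weight of that level, depends on beta. *)
Theorem mixed_universal_example (z xi : ord) : wf_ord z -> wf_ord xi -> olt z xi ->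
     exists (w1 w2 : nat -> RR) (Fs1 Fs2 : nat -> fam)
            (Z1 Z2 : completeNormedModType RR) (e1 : nat -> Z1) (e2 : nat -> Z2)
            (I : Z1 -> Z2),
       mixed_schreier w1 Fs1 e1 /\ mixed_schreier w2 Fs2 e2 /\
       bounded_op I /\ (forall i, I (e1 i) = e2 i) /\
       ~ inG (Ctbl xi) (Ctbl z) I /\
       forall beta : ord, wf_ord beta -> olt z beta -> olt beta xi ->
         subseq_universal (Ctbl beta) (Ctbl z) e1 e2 I.
Proof.
move=> wz wxi zxi; have pxi := wf_proper wxi.
have [g [pg gm gxi zg [cof _]]] := approx pxi zxi.
pose P1 := @MixedData wt (chain z g id) wt_gt0 (@chain_hered z g id)
   (fun n => (chain_regular z g id n).2).
pose P2 := @MixedData wt (fun=> Schr z) wt_gt0 (fun=> @Schr_hered z) (fun=> @Schr1 z).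
have [|||I [bI [eI _]]] := @formal_identity P1 P2 (Schr z) => //.
  by rewrite /= /wt invr1.
exists wt, wt, (chain z g id), (fun=> Schr z), (mixed_space P1), (mixed_space P2), (munit P1), (munit P2), I.
split; first by apply: (@mixed_space_schreier P1); [exact: wt_null|move=> n; case: (chain_regular z g id n)].
split; first by apply: (@mixed_space_schreier P2); [exact: wt_null|move=> n; exact: Schr_regular].
split=> //; split=> //; split.
  move=> /(_ (munit P1)) h.
  have /h/(wnull_wn _ wz)[_ /(_ 1 ltr01)] : wnull (Ctbl xi) (munit P1).
    apply/(wnull_wn _ wxi)/munit_wn; first exact: wt_null.
    move=> K p e sp e0.
    exact: (chain_small pxi gm gxi zg (fun n => ole_refl (g n)) id K sp e0).
  apply; exists id; split=> // E sE hE; rewrite map_id.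
  have -> : I \o munit P1 = munit P2 by apply/funext => i; exact: eI.
  by have := @munit_lowE P2 0%N E hE sE; rewrite /= /wt invr1.
move=> beta wb zb /cof[n hn].
apply: (@mixed_universal P1 P2 beta z (g n) n.+1) => //.
  by move=> E; exact: size1_comp.
by rewrite /= /wt invr1.
Qed.

(** * Block sequences in mixed Schreier spaces *)

Section Blocks.
Variables (P1 P2 : mixed_data) (z : ord).
Hypotheses (F1z : mF P1 0%N = Schr z) (w10 : mw P1 0%N = 1) (F2z : forall n, mF P2 n = Schr z).
Variables (x : nat -> mixed_space P1) (y : nat -> mixed_space P2) (d : RR).
Hypotheses (d0 : 0 < d) (xy : forall m i, mval (y m) i = mval (x m) i).
Hypothesis xnull : weakly_null x.
Hypothesis low : forall E, sorted ltn E -> Schr z E -> lowE y d E.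

(** A gliding hump: coordinates tend to 0 by weak nullity, which clears the part before [s k], and
    each vector has small tails, which fixes [s k.+1]. *)
Lemma block_sequence (eta : nat -> RR) : (forall k, 0 < eta k) ->
  exists m s : nat -> nat, [/\ strictly_incr m, strictly_incr s,
    forall k, \sum_(i < s k) `|mval (x (m k)) i| <= eta k &
    forall k n E, sorted ltn E -> mF P1 n E ->
      mw P1 n * \sum_(i <- E | (s k.+1 <= i)%N) `|mval (x (m k)) i| <= eta k].
Proof.
move=> eta0.
have head (e : RR) s0 : 0 < e -> exists N, forall n, (N <= n)%N ->
    \sum_(i < s0) `|mval (x n) i| <= e.
  elim: s0 e => [|s0 IH] e e0; first by exists 0%N => n _; rewrite big_ord0 ltW.
  have e2 : 0 < e / 2 by rewrite divr_gt0.
  have [N hN] := IH _ e2; have [N' hN'] := xnull (mcoord_lin P1 s0) e2.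
  exists (maxn N N') => n; rewrite geq_max => /andP[h1 h2].
  rewrite big_ord_recr /=; have := hN n h1; have := hN' n h2; lra.
have step k (st : nat * nat) : exists st' : nat * nat, [/\ (st.1 < st'.1)%N, (st.2 < st'.2)%N,
    \sum_(i < st.2) `|mval (x st'.1) i| <= eta k &
    forall n E, sorted ltn E -> mF P1 n E ->
      mw P1 n * \sum_(i <- E | (st'.2 <= i)%N) `|mval (x st'.1) i| <= eta k].
  have [N hN] := head _ st.2 (eta0 k); pose m' := maxn N st.1.+1.
  have [T hT] := mixed_tail (x m') (eta0 k).
  exists (m', maxn T st.2.+1); split=> /=; rewrite ?leq_maxr //.
    by apply: hN; rewrite leq_maxl.
  move=> n E sE FE; apply: le_trans (hT n E sE FE).
  rewrite ler_wpM2l //; first by case/andP: (mw_gt0 P1 n) => /ltW.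
  rewrite [leLHS]big_mkcond [leRHS]big_mkcond; apply: ler_sum => i _.
  by rewrite geq_max; case: (T <= i)%N => //=; case: ifP => //.
have [nx hnx] : exists nx : nat -> nat * nat -> nat * nat, forall k st,
    [/\ (st.1 < (nx k st).1)%N, (st.2 < (nx k st).2)%N,
    \sum_(i < st.2) `|mval (x (nx k st).1) i| <= eta k &
    forall n E, sorted ltn E -> mF P1 n E ->
      mw P1 n * \sum_(i <- E | ((nx k st).2 <= i)%N) `|mval (x (nx k st).1) i| <= eta k].
  exists (fun k => projT1 (choice (step k))) => k; exact: projT2 (choice (step k)).
pose S := fix S k := if k is j.+1 then nx j (S j) else (0%N, 0%N).
exists (fun k => (S k.+1).1), (fun k => (S k).2); split=> k.
- by case: (hnx k.+1 (S k.+1)).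
- by case: (hnx k (S k)).
- by case: (hnx k (S k)).
- by case: (hnx k (S k)).
Qed.

Variables (m s : nat -> nat).
Hypotheses (sm : strictly_incr m) (ss : strictly_incr s).
(** The factor 1/(k+1) makes the errors small even compared with the weight of a given level, once
    the block indices are large. *)
Let eta k : RR := d / 8 / k.+1%:R.
Hypothesis hhead : forall k, \sum_(i < s k) `|mval (x (m k)) i| <= eta k.
Hypothesis htail : forall k n E, sorted ltn E -> mF P1 n E ->
      mw P1 n * \sum_(i <- E | (s k.+1 <= i)%N) `|mval (x (m k)) i| <= eta k.

Definition inblock k i := (s k <= i < s k.+1)%N.

Definition mass (G : seq nat) k : RR := \sum_(i <- G | inblock k i) `|mval (x (m k)) i|.

Definition offmass (G : seq nat) k : RR := \sum_(i <- G | ~~ inblock k i) `|mval (x (m k)) i|.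

Lemma mass_ge0 G k : 0 <= mass G k. Proof. exact: sumr_ge0. Qed.

Lemma offmass_le n G k : sorted ltn G -> mF P1 n G -> mw P1 n * offmass G k <= 2 * eta k.
Proof.
move=> sG FG; have /andP[w0 w1] := mw_gt0 P1 n.
have h1 := htail k sG FG.
have h2 : \sum_(i <- G | (i < s k)%N) `|mval (x (m k)) i| <= eta k.
  apply: le_trans (hhead k); rewrite -(big_mkord xpredT (fun i => `|mval (x (m k)) i|)).
  rewrite /index_iota subn0 -[leLHS]big_filter.
  have -> : [seq i <- G | (i < s k)%N] = [seq i <- iota 0 (s k) | i \in G].
    apply: (irr_sorted_eq ltn_trans ltnn).
    - exact: sorted_filter ltn_trans _ _ sG.
    - by apply: sorted_filter; [exact: ltn_trans|exact: iota_ltn_sorted].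
    - by move=> i; rewrite !mem_filter mem_iota add0n andbC.
  by rewrite big_filter; exact: sum_sub_le.
have h3 : mw P1 n * \sum_(i <- G | (i < s k)%N) `|mval (x (m k)) i| <= eta k.
  by apply: le_trans h2; rewrite ler_piMl // sumr_ge0.
have : offmass G k = \sum_(i <- G | (i < s k)%N) `|mval (x (m k)) i| +
    \sum_(i <- G | (s k.+1 <= i)%N) `|mval (x (m k)) i|.
  rewrite /offmass /inblock [LHS]big_mkcond [X in _ = X + _]big_mkcond [X in _ = _ + X]big_mkcond.
  rewrite -big_split /=; apply: eq_bigr => i _.
  have := ss k; case: (leqP (s k) i) => h4; case: (ltnP i (s k.+1)) => h5 //=;
    rewrite ?addr0 ?add0r // => h6; exfalso; lia.
move=> ->; rewrite mulrDr; lra.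
Qed.

(** [G] may depend on the coefficients: it plays the part of the set norming one combination.
    Requiring [G] in the same F as [E] is what lets the estimate pass through [comp]. *)
Definition block_low (F : fam) (c : RR) := forall E, sorted ltn E -> F E ->
  forall a : nat -> RR, (forall k, 0 <= a k) ->
  exists G, [/\ sorted ltn G, F G, (forall i, i \in G -> exists2 k, k \in E & inblock k i) &
    c * \sum_(k <- E) a k <= \sum_(k <- E) a k * mass G k].

(** [G] nearly norms the combination of the [y]. Near-attainment costs d/4 and the mass outside the
    blocks another d/4, leaving d/2. *)
Lemma block_low_base : block_low (Schr z) (d / 2).
Proof.
move=> E sE hE a a0; set A := \sum_(k <- E) a k.
have A0 : 0 <= A by exact: sumr_ge0.
move: (A0); rewrite le_eqVlt => /orP[/eqP eA|A1].
  exists [::]; split=> //; first exact: Schr_nil.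
  by rewrite -eA mulr0; apply: sumr_ge0 => k _; rewrite mulr_ge0 // mass_ge0.
have hm := spreading_sincr (@Schr_spreading z) sE sm hE.
have := (lowE_map y d E sm).2 (low (sorted_map_sincr sm sE) hm) a a0.
rewrite -/A; set v := \sum_(k <- E) _ => dv.
have [n [G0 [sG0 + hG0]]] := mixed_norm_gt v (mulr_gt0 (divr_gt0 d0 (ltr0Sn RR 3)) A1).
rewrite F2z => FG0.
pose G := [seq i <- G0 | has (inblock^~ i) E].
have sG : sorted ltn G by exact: sorted_filter ltn_trans _ _ sG0.
have massG k : k \in E -> mass G k = mass G0 k.
  move=> kE; rewrite /mass /G big_filter_cond; apply: eq_bigl => i.
  by apply: andb_idl => h; apply/hasP; exists k.
exists G; split=> //.
- exact: (@Schr_hered z G0 _ sG0 FG0 (filter_subseq _ _)).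
- by move=> i; rewrite mem_filter => /andP[/hasP[k kE ki] _]; exists k.
have h1 : mw P2 n * \sum_(i <- G0) `|mval v i| <= \sum_(i <- G0) `|mval v i|.
  by have /andP[_ w1] := mw_gt0 P2 n; rewrite ler_piMl // sumr_ge0.
have h2 : \sum_(i <- G0) `|mval v i| <= \sum_(k <- E) a k * (mass G k + d / 4).
  apply: (@le_trans _ _ (\sum_(i <- G0) \sum_(k <- E) a k * `|mval (x (m k)) i|)).
    apply: ler_sum => i _; rewrite mval_sum; apply: le_trans (ler_norm_sum _ _ _) _.
    by apply: ler_sum => k _; rewrite normrM ger0_norm //= xy.
  rewrite exchange_big /= big_seq [leRHS]big_seq; apply: ler_sum => k kE.
  rewrite -big_distrr /= ler_wpM2l // (bigID (inblock k)) /= massG // lerD2l.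
  have := @offmass_le 0%N G0 k sG0; rewrite F1z w10 mul1r => /(_ FG0)/le_trans; apply.
  have -> : 2 * eta k = d / 4 / k.+1%:R by rewrite /eta mulrA; congr (_ * _); field.
  by rewrite ler_pdivrMr ?ltr0n // ler_peMr ?ler1n // divr_ge0 // ltW.
have h3 : \sum_(k <- E) a k * (mass G k + d / 4) = \sum_(k <- E) a k * mass G k + d / 4 * A.
  under eq_bigr do rewrite mulrDr; rewrite big_split /=; congr (_ + _).
  by rewrite -big_distrl /= mulrC.
rewrite h3 in h2; move: (le_trans h1 h2) => /(lt_le_trans hG0); lra.
Qed.

(** The sets found for the pieces of [E] are concatenated. Their number is allowed since a point of
    block k is at least [s k], hence at least k, so the minimum has not decreased. *)
Lemma block_low_comp phi F c : {homo phi : i j / (i <= j)%N} -> hereditary F ->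
  block_low F c -> block_low (comp phi F) c.
Proof.
move=> mphi hF lF E sE [Es [e1 e2 e3 e4]] a a0.
have [Gs [g1 g2 g3 g4 g5]] : exists Gs, [/\ size Gs = size Es, forall G, G \in Gs -> F G,
    sorted ltn (flatten Gs), (forall i, i \in flatten Gs -> exists2 k, k \in flatten Es & inblock k i) &
    c * \sum_(k <- flatten Es) a k <= \sum_(k <- flatten Es) a k * mass (flatten Gs) k].
  move: sE e3; rewrite -e1; elim: Es {e1 e2 e4} => [|e Es IH] /= sE e3.
    by exists [::]; split=> //; rewrite !big_nil mulr0.
  have [se sEs] := cat_sorted2 sE.
  have [|Gs [g1 g2 g3 g4 g5]] := IH sEs.
    by move=> e' he; apply: e3; rewrite inE he orbT.
  have [G [h1 h2 h3 h4]] := lF e se (e3 e (mem_head _ _)) a a0.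
  exists (G :: Gs); split=> /=.
  - by rewrite g1.
  - by move=> G'; rewrite inE => /orP[/eqP->//|]; exact: g2.
  - apply: sorted_ltn_cat => // i j /h3[k ke /andP[_ ik]] /g4[k' ke' /andP[jk _]].
    apply: leq_trans ik (leq_trans _ jk); apply: sincr_le => //.
    exact: sorted_ltn_cat_lt sE ke ke'.
  - move=> i; rewrite mem_cat => /orP[/h3|/g4] [k ke ki]; exists k => //;
      by rewrite mem_cat ke ?orbT.
  have massD k : mass (G ++ flatten Gs) k = mass G k + mass (flatten Gs) k by exact: big_cat.
  rewrite !big_cat /= mulrDr; apply: lerD.
    apply: le_trans h4 _; apply: ler_sum => k _; rewrite massD ler_wpM2l // lerDl.
    exact: mass_ge0.
  apply: le_trans g5 _; apply: ler_sum => k _; rewrite massD ler_wpM2l // lerDr.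
  exact: mass_ge0.
exists (flatten Gs); rewrite -{1 2 3}e1; split=> //.
exists [seq G <- Gs | G != [::]]; split.
- exact: flatten_nil.
- exact: filter_all.
- by move=> G; rewrite mem_filter => /andP[_]; exact: g2.
have [e|ne] := eqVneq (flatten Gs) [::].
  have -> : [seq G <- Gs | G != [::]] = [::].
    by apply: flatten_eq_nil; [exact: filter_all|rewrite flatten_nil].
  by [].
rewrite size_filter (leq_trans (count_size _ _)) // g1 (leq_trans e4) // mphi //.
have [k kE /andP[ki _]] := g4 _ (head_mem ne).
apply: leq_trans (leq_trans (sincr_ge k ss) ki).
by rewrite head_le_mem // -e1.
Qed.

(** Addition recurses on its right argument, so the induction starts at order z, the only one for
    which a lower estimate is given. *)
Lemma block_low_oadd b : block_low (Schr (oadd z b)) (d / 2).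
Proof.
elim: b => [|b IH|f IH] /=.
- exact: block_low_base.
- by apply: block_low_comp IH => //; exact: Schr_hered.
- move=> E sE [n [nE hE]] a a0; have [G [g1 g2 g3 g4]] := IH n E sE hE a a0.
  exists G; split=> //; have [->|ne] := eqVneq G [::].
    by exists 0%N; split=> //; exact: Schr_nil.
  exists n; split=> //; have [k kE /andP[ki _]] := g3 _ (head_mem ne).
  apply: leq_trans nE (leq_trans _ (leq_trans (sincr_ge k ss) ki)).
  by rewrite head_le_mem.
Qed.

Lemma inblock_inj k k' i : inblock k i -> inblock k' i -> k = k'.
Proof.
move=> /andP[h1 h2] /andP[h3 h4].
have := leq_ltn_trans h1 h4; have := leq_ltn_trans h3 h2; rewrite !sincr_ltE //; lia.
Qed.

(** The set G norms the combination up to mass outside the blocks. With weight, that mass is at most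
    (d/4)/(k+1) for each k, hence at most d/4 times the weight, which is half of the main term. *)
Lemma block_lowE n E : sorted ltn E -> mF P1 n E -> block_low (mF P1 n) (d / 2) ->
  (forall k, k \in E -> k.+1%:R^-1 <= mw P1 n) -> lowE (x \o m) (mw P1 n * d / 4) E.
Proof.
move=> sE FE lF wE a a0; have [G [sG FG gE hG]] := lF E sE FE a a0.
have /andP[w0 w1] := mw_gt0 P1 n.
set v := \sum_(k <- E) a k *: _.
apply: le_trans (msum_le v sG FG).
have h1 : \sum_(k <- E) a k * mass G k - \sum_(k <- E) a k * offmass G k <= \sum_(i <- G) `|mval v i|.
  under eq_bigr do rewrite /mass mulr_sumr; under [X in _ - X]eq_bigr do rewrite /offmass mulr_sumr.
  rewrite (exchange_big_dep xpredT) //= [X in _ - X](exchange_big_dep xpredT) //= -sumrB.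
  apply: ler_sum => i _; rewrite mval_sum [X in `|X|](bigID (fun k => inblock k i)) /=.
  set b := fun k => a k * mval (x (m k)) i.
  (* Blocks are disjoint, so at most one k contributes and the absolute value moves outside the
     sum. *)
  have -> : \sum_(k <- E | inblock k i) a k * `|mval (x (m k)) i| = `|\sum_(k <- E | inblock k i) b k|.
    rewrite -[LHS]big_filter -[X in `|X|]big_filter.
    have u : uniq [seq k <- E | inblock k i].
      exact/filter_uniq/(sorted_uniq ltn_trans ltnn).
    case e : [seq k <- E | inblock k i] u => [|k [|k' r]] /=.
    - by rewrite !big_nil normr0.
    - by rewrite !big_seq1 normrM ger0_norm.
    move=> /andP[nk _]; exfalso; move: nk.
    have hk : k \in [seq k <- E | inblock k i] by rewrite e mem_head.
    have hk' : k' \in [seq k <- E | inblock k i] by rewrite e !inE eqxx orbT.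
    move: hk hk'; rewrite !mem_filter => /andP[ki _] /andP[ki' _].
    by rewrite (inblock_inj ki ki') mem_head.
  apply: le_trans (lerB_normD _ _); rewrite lerD2l lerN2.
  apply: le_trans (ler_norm_sum _ _ _) _; apply: ler_sum => k _.
  by rewrite /b normrM ger0_norm.
have h2 : mw P1 n * \sum_(k <- E) a k * offmass G k <= mw P1 n * d / 4 * \sum_(k <- E) a k.
  rewrite !mulr_sumr big_seq [leRHS]big_seq; apply: ler_sum => k kE.
  rewrite mulrCA [leRHS]mulrC ler_wpM2l //; apply: le_trans (offmass_le k sG FG) _.
  have -> : 2 * eta k = d / 4 * k.+1%:R^-1 by rewrite /eta mulrA; congr (_ * _); field.
  rewrite [leLHS]mulrC -[leRHS]mulrA ler_wpM2r ?wE //.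
  by rewrite divr_ge0 // ltW.
have h3 : mw P1 n * (d / 2 * \sum_(k <- E) a k) <= mw P1 n * \sum_(k <- E) a k * mass G k.
  by rewrite ler_wpM2l // ltW.
have h4 := ler_wpM2l (ltW w0) h1; rewrite mulrBr in h4.
lra.
Qed.

End Blocks.

(** * Failure of universality *)

Section NoUniversal.
Variables (z xi : ord) (xiw : ordw).
Hypotheses (wz : wf_ord z) (pxi : proper xi) (zxi : olt z xi).
(** Covers both cases of the theorem: [xiw] is [Ctbl xi], or it is [Omega1] and [xi] is a countable
    order extracted from [f]. *)
Hypothesis weaker : forall (X : normedModType RR) (x : nat -> X), wn xi x -> wnull xiw x.
Variables (F G : completeNormedModType RR) (f : nat -> F) (g : nat -> G) (U : F -> G).
Hypotheses (wf : wn xi f) (wg : ~ wnull (Ctbl z) g)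
  (bU : bounded_op_on (cspan f) (cspan g) U) (Ufg : forall i, U (f i) = g i).

Let eps j : RR := j.+1%:R^-1 ^+ 2.

(* The levels [eps j] of [f] are caught by the families with index [n j], whereas *)
(* the norm of the space below contains strictly larger families with weights [j.+2%:R^-1]. *)
Lemma not_universal : ~ subseq_universal xiw (Ctbl z) f g U.
Proof.
have [h [ph hm hxi zh [_ hap]]] := approx pxi zxi.
have [eta het] := choice (fun n => osub (zh n)).
pose c n := oadd z (eta n).
have ch n : ole (c n) (h n) by case: (het n).
have hc n : ole (h n) (c n) by case: (het n).
have [cU [cU0 hU]] := op_on_bound bU.
have [d0 [d00 [L0 [sL0 hL0]]]] : exists d : RR, 0 < d /\ emb (Schr z) (lowE g d).
  apply: contrapT => /forallNP hn; apply: wg; apply/(wnull_wn _ wz); split; last first.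
    by move=> d d0 hd; apply: (hn d).
  have [[C hC] _] := wf; exists (cU * C) => n; rewrite -Ufg.
  by apply: le_trans (hU _ (cspan_mem f n)) _; rewrite ler_wpM2l // ltW.
have eps0 j : 0 < eps j by rewrite exprn_gt0 // invr_gt0.
pose Q j M := exists n, forall E, sorted ltn E -> lowE f (eps j) (map M E) ->
  comp (fun=> n.+1) (Schr (c n)) (map M E).
have step j L : strictly_incr L -> exists p, strictly_incr p /\ Q j (L \o p).
  move=> sL.
  have [p [n [sp hp]]] := chain_captures hc hap (@lowE_hered _ f (eps j)) (lowE_nil f (eps j)) sL
    (wf.2 _ (eps0 j)).
  by exists p; split=> //; exists n.
have [p0 [M0 [sp0 _ hM0 hD]]] := @diagonalize Q L0 id step sL0.
have [n hn] := choice (fun j => (hM0 j).2).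
(* Level j+1 then allows 2(n_j+1)+1 pieces, the number that n_j+1 sets cannot cover in
   [blocks_not_emb]. *)
pose N j := (2 * (n j).+1)%N.
pose P1 := @MixedData wt (chain z c N) wt_gt0 (@chain_hered z c N)
   (fun k => (chain_regular z c N k).2).
pose P2 := @MixedData wt (fun=> Schr z) wt_gt0 (fun=> @Schr_hered z) (fun=> @Schr1 z).
have w10 : mw P1 0%N = 1 by rewrite /= /wt invr1.
have [I [bI [eI cI]]] := @formal_identity P1 P2 (Schr z) w10 (erefl _) (fun=> erefl _).
move=> /(_ (mixed_space P1) (mixed_space P2) I bI) univ.
have {univ} := univ _ (L0 \o p0) (sincr_comp sL0 sp0); case.
  move=> /(_ (munit P1)) hI.
  have /hI/(wnull_wn _ wz)[_ /(_ 1 ltr01)] : wnull xiw (munit P1).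
    apply/weaker/munit_wn; first exact: wt_null.
    move=> K p e sp e0; exact: (chain_small pxi hm hxi zh ch N K sp e0).
  apply; exists id; split=> // E sE hE; rewrite map_id.
  have -> : I \o munit P1 = munit P2 by apply/funext => i; exact: eI.
  by have := @munit_lowE P2 0%N E hE sE; rewrite /= /wt invr1.
move=> p [sp [X0 [Y0 [Rop [Sop [cX0 [cY0 [hXY [bR [bS fac]]]]]]]]]].
pose M := (L0 \o p0) \o p.
have sL := sincr_comp sL0 sp0; have sM : strictly_incr M := sincr_comp sL sp.
pose x k := Rop (f (M k)); pose y k := I (x k).
have [C [C0 hR]] := op_on_bound bR; have [cS [cS0 hS]] := op_on_bound bS.
have csM := cspan_closed (f \o M).
have xX0 k : X0 (x k) by case: bR => h1 _; apply: h1; exact: cspan_mem (f \o M) k.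
(* Boundedness of [Rop] turns lower estimates for [x] into lower estimates for [f]; boundedness of
   [Sop] will carry those of [g] to [y]. *)
have Rlow d E : lowE x d E -> lowE (f \o M) (d / C) E.
  move=> lx a a0; rewrite mulrAC ler_pdivrMr // [leRHS]mulrC.
  have := lx a a0; rewrite -(op_on_sum E a csM bR (cspan_mem (f \o M))) => /le_trans; apply.
  apply: hR.
  by apply: sum_in_subspace => // i; exact: cspan_mem.
have xnull : weakly_null x.
  apply: (@wn_weakly_null _ xi); split.
    have [[B hB] _] := wf; exists (C * B) => k; apply: le_trans (hR _ (cspan_mem (f \o M) k)) _.
    by rewrite ler_wpM2l ?hB // ltW.
  move=> d dd0 [q [sq hq]]; apply: (wf.2 (d / C)); first by rewrite divr_gt0.
  exists (M \o q); split; first exact: sincr_comp.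
  move=> E sE /(hq _ sE)/Rlow/(lowE_map _ _ _ sM); by rewrite -map_comp.
pose d1 := d0 / cS; have d10 : 0 < d1 by rewrite divr_gt0.
have ylow E : sorted ltn E -> Schr z E -> lowE y d1 E.
  move=> sE hE a a0; rewrite mulrAC ler_pdivrMr // [leRHS]mulrC.
  have sq := sincr_comp sp0 sp.
  have hM : lowE (g \o M) d0 E.
    apply/(lowE_map _ _ _ sM); have := hL0 _ (sorted_map_sincr sq sE)
      (spreading_sincr (@Schr_spreading z) sE sq hE).
    by rewrite -map_comp.
  have yY0 k : Y0 (y k) by apply: hXY; exact: xX0.
  have yg k : Sop (y k) = g (M k).
    by rewrite /y /x -fac ?Ufg //; exact: cspan_mem (f \o M) k.
  have := hM a a0 => /le_trans; apply.
  have -> : \sum_(i <- E) a i *: (g \o M) i = Sop (\sum_(i <- E) a i *: y i).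
    by rewrite (op_on_sum E a cY0 bS yY0); apply: eq_bigr => i _; rewrite yg.
  by apply: hS; exact: sum_in_subspace.
have et0 k : 0 < d1 / 8 / k.+1%:R by rewrite !divr_gt0.
have [m [s [sm ss hh ht]]] := block_sequence xnull et0.
have blow j : block_low x m s (mF P1 j.+1) (d1 / 2).
  apply: block_low_comp => //; first exact: Schr_hered.
  exact: (@block_low_oadd P1 P2 z (erefl _) w10 (fun=> erefl _) x y d1 d10
    (fun k i => cI (x k) i) ylow m s sm ss hh ht).
(* Since 1/(j+2) is at least 1/(2(j+1)), this choice gives 1/(j+1)^2 <= d1/(4C(j+2)), the estimate
   recovered for [f]. *)
have [j hj] : exists j : nat, 8 * C / d1 < j.+1%:R.
  by exists (Num.truncn (8 * C / d1)); exact: truncnS_gt.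
have xlow E : sorted ltn E -> chain z c N j.+1 E -> (forall k, k \in E -> (j.+1 <= k)%N) ->
    lowE (x \o m) (wt j.+1 * d1 / 4) E.
  move=> sE hE jE; apply: (@block_lowE P1 x d1 d10 m s ss hh ht j.+1) => //.
  by move=> k /jE jk; rewrite /= /wt lef_pV2 ?posrE ?ltr0n // ler_nat.
have small : eps j <= wt j.+1 * d1 / 4 / C.
  have j0 : (0 : RR) < j.+1%:R by rewrite ltr0n.
  have h1 : 8 * C < d1 * j.+1%:R by rewrite [ltRHS]mulrC -ltr_pdivrMr.
  have h2 : (j.+2%:R : RR) <= 2 * j.+1%:R by rewrite -natrM ler_nat; lia.
  have h3 : j.+1%:R^-1 <= d1 / (8 * C) by rewrite ler_pdivlMr ?mulr_gt0 // mulrC ler_pdivrMr // ltW.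
  have h4 : (2 * j.+1%:R)^-1 <= j.+2%:R^-1 :> RR by rewrite lef_pV2 ?posrE ?mulr_gt0 ?ltr0n.
  apply: (@le_trans _ _ (j.+1%:R^-1 * (d1 / (8 * C)))); first by rewrite /eps expr2 ler_wpM2l // invr_ge0 ltW.
  have -> : j.+1%:R^-1 * (d1 / (8 * C)) = (2 * j.+1%:R)^-1 * (d1 / 4 / C).
    have e (J K e1 : RR) : 0 < J -> 0 < K -> J^-1 * (e1 / (8 * K)) = (2 * J)^-1 * (e1 / 4 / K).
      by move=> J0 K0; field; rewrite !gt_eqF.
    exact: e.
  by rewrite -!mulrA ler_wpM2r // !mulr_ge0 ?invr_ge0 // ltW.
have nN : (n j <= N j)%N by rewrite /N; lia.
(* The shift by j+1 is part of the re-indexing because the estimate on level j+1 holds only for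
   block indices from j+1 on; spreading keeps the shifted set in the level. *)
have [Fe [sF hF nF]] := @blocks_not_emb (h (N j)) (c (n j)) (c (N j)) (n j)
   ((M \o m) \o addn j.+1) (ph _) (hc _)
   (ole_trans (ch _) (hm _ _ nN))
   (sincr_comp (sincr_comp sM sm) (sincr_addn j.+1)).
apply: nF; pose E := map (addn j.+1) Fe.
have sE : sorted ltn E by exact: sorted_map_sincr (sincr_addn _) sF.
have hE : chain z c N j.+1 E.
  have [_ [spr _]] := (chain_regular z c N j.+1).1.
  exact: (spreading_sincr spr sF (sincr_addn j.+1) hF).
have jE k : k \in E -> (j.+1 <= k)%N by move=> /mapP[i _ ->]; exact: leq_addr.
have fE : lowE f (eps j) (map (M \o m) E).
  apply: lowE_le small _; rewrite map_comp; apply/(lowE_map _ _ _ sM)/Rlow/(lowE_map _ _ _ sm).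
  exact: xlow.
(* All positions are at least j, so the capture at level j applies: the set would be covered by
   n_j+1 sets, contradicting its choice. *)
have [|D [sD eD]] := hD j (map (p \o m) E) (sorted_map_sincr (sincr_comp sp sm) sE).
  move=> i /mapP[k /jE jk ->]; apply: leq_trans (sincr_ge k (sincr_comp sp sm)).
  exact: ltnW.
rewrite -map_comp in eD; rewrite [map _ Fe]map_comp -/E.
rewrite [map _ E]eD; apply: hn => //; rewrite -eD; exact: fE.
Qed.

End NoUniversal.

(** For omega_1 the argument is run at a countable order above zeta at which [f] is already null,
    nullity of that order implying weak nullity. *)
Theorem no_universal_operator (zeta : ord) (xi : ordw) :
     wf_ord zeta -> wf_ordw xi -> ltw (Ctbl zeta) xi ->
     ~ exists (F G : completeNormedModType RR) (f : nat -> F) (g : nat -> G) (U : F -> G),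
         basic f /\ basic g /\
         wnull xi f /\ ~ wnull (Ctbl zeta) g /\
         bounded_op_on (cspan f) (cspan g) U /\ (forall i, U (f i) = g i) /\
         subseq_universal xi (Ctbl zeta) f g U.
Proof.
move=> wz wxi zxi [F [G [f [g [U [_ [_ [wf [wg [bU [Ufg univ]]]]]]]]]]].
case: xi wxi zxi wf univ => [xi|] wxi zxi wf univ.
  apply: (@not_universal zeta xi (Ctbl xi) wz (wf_proper wxi) zxi _ F G f g U) => //.
    by move=> X x; exact: (wnull_wn x wxi).2.
  exact/(wnull_wn _ wxi).
have [a [pa za wa]] := weakly_null_wn wf (wf_proper wz).
apply: (@not_universal zeta a Omega1 wz pa za _ F G f g U) => //.
by move=> X x; exact: wn_weakly_null.
Qed.

Theorem theorem3p6 :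
  (* (i) *)
  (forall (zeta : ord) (xi : ordw),
     wf_ord zeta -> wf_ordw xi -> ltw (Ctbl zeta) xi ->
     ~ exists (F G : completeNormedModType RR) (f : nat -> F) (g : nat -> G) (U : F -> G),
         basic f /\ basic g /\
         wnull xi f /\ ~ wnull (Ctbl zeta) g /\
         bounded_op_on (cspan f) (cspan g) U /\ (forall i, U (f i) = g i) /\
         subseq_universal xi (Ctbl zeta) f g U)
  /\
  (* (ii) *)
  (forall zeta xi : ord, wf_ord zeta -> wf_ord xi -> olt zeta xi ->
     exists (w1 w2 : nat -> RR) (Fs1 Fs2 : nat -> fam)
            (Z1 Z2 : completeNormedModType RR) (e1 : nat -> Z1) (e2 : nat -> Z2)
            (I : Z1 -> Z2),
       mixed_schreier w1 Fs1 e1 /\ mixed_schreier w2 Fs2 e2 /\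
       bounded_op I /\ (forall i, I (e1 i) = e2 i) /\
       ~ inG (Ctbl xi) (Ctbl zeta) I /\
       forall beta : ord, wf_ord beta -> olt zeta beta -> olt beta xi ->
         subseq_universal (Ctbl beta) (Ctbl zeta) e1 e2 I).
Proof.
by split=> [zeta xi|zeta xi]; [exact: no_universal_operator|exact: mixed_universal_example].
Qed.
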